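(* The energy functional $\mathcal E\colon \mathcal S'\to\mathbb C$ is a moment map for the natural $S^1$-action on $\mathcal S'$ with respect to the holomorphic symplectic form $\Omega_0$; that is, for every $s\in\mathcal S'$ and $V\in T_s\mathcal S'$, $$d\mathcal E_s(V)= i\,\Omega_0|_s(X_s,V),$$ where $X$ is the vector field on $\mathcal S'$ generated by the $S^1$-action. In particular, the $S^1$-fixed points in $\mathcal S'$ are precisely the critical points of $\mathcal E\colon \mathcal S'\to\mathbb C$.
   Context: Let $(M,g_0,I,J,K)$ be a hyperkähler manifold of complex dimension $2d$ with Kähler forms $\omega_L=g_0(L\cdot,\cdot)$, $L\in\{I,J,K\}$. The twistor space $Z$ is the smooth manifold $S^2\times M$ with complex structure $I_{\mathbb{CP}^1}\oplus I_x$ at $(x,m)$, where $I_x=x_1I+x_2J+x_3K$ and $S^2\cong\mathbb{CP}^1$ by stereographic projection with $(1,0,0)\leftrightarrow 0$, $(-1,0,0)\leftrightarrow\infty$. Let $\varpi\colon Z\to\mathbb{CP}^1$ be the holomorphic projection, $Z_\lambda=\varpi^{-1}(\lambda)$ (so $Z_0=(M,I)$), $T_\varpi Z=\ker d\varpi$, $V(m)=V\otimes\varpi^*\mathcal O_{\mathbb{CP}^1}(m)$, $\mathcal O(2)\cong T\mathbb{CP}^1$. The affine coordinate $\lambda$ is chosen so that the antipodal map is $\lambda\mapsto-\bar\lambda^{-1}$ and $$\omega=\big(\omega_J+i\omega_K+2i\lambda\omega_I+\lambda^2(\omega_J-i\omega_K)\big)\otimes\tfrac{\partial}{\partial\lambda}\in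 H^0(Z,(\Lambda^2T_\varpi^* )(2))$$ is the holomorphic twisted relative symplectic form of $Z$. Let $\mathcal S$ be the space of holomorphic sections of $\varpi$, with $T_s\mathcal S=H^0(\mathbb{CP}^1,s^*T_\varpi Z)$, and let $\mathcal S'\subset\mathcal S$ be the open subset of sections with $s^*T_\varpi Z\cong\mathcal O(1)^{\oplus 2d}$, a complex manifold of dimension $4d$. For $m\in M$ the twistor line $s_m\in\mathcal S'$ is the constant section $\lambda\mapsto(\lambda,m)$. Assume $S^1$ acts isometrically on $M$, preserving $I$ and acting with weight one on $\omega_J+i\omega_K$ (i.e. $\zeta^*(\omega_J+i\omega_K)=\zeta(\omega_J+i\omega_K)$), with Killing field $X$ and a moment map $\mu\colon M\to i\mathbb R$ satisfying $d\mu=i\omega_I(X,\cdot)$. Assume also $[\omega_I/2\pi]\in H^2(M,\mathbb Z)$. The action induces a holomorphic action on $Z$, $\zeta.(\lambda,m)=(\zeta\lambda,\zeta.m)$, with associated vector field $Y$ (vertical along $Z_0$), and an action on $\mathcal S$ and $\mathcal S'$ by $(\zeta.s)(\lambda)=\zeta.(s(\zeta^{-1}\lambda))$. The holomorphic symplectic form $\Omega_0$ on $\mathcal S'$ is $$\Omega_0|_s(V,W)=-\tfrac{i}{2}\tfrac{\partial}{\partial\lambda}\Big|_{\lambda=0}\omega_{s(\lambda)}(V(\lambda),W(\lambda)),$$ where $\omega$ is regarded as a function-valued form using the trivialization $\partial/\partial\lambda$; it restricts to $\omega_I$ on $M$. The energy functional is the holomorphic function $$\mathcal E(s)=\tfrac12\,(\omega_J+i\omega_K)\big(Y_{s(0)},\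 \dot s(0)-\dot s_{s(0)}(0)\big)+\mu(s(0)),$$ where $\dot s(0)=ds_0(\partial/\partial\lambda)$ and $s_{s(0)}$ is the twistor line through $s(0)\in Z_0=M$ (the difference of the two vectors is vertical). It is the (suitably normalized) residue at $\lambda=0$ of the pullback by $s$ of Hitchin's meromorphic connection on the hyperholomorphic line bundle on $Z$, and $\mathcal E(s_m)=\mu(m)$. *)

(* Defs.v *)
From HB Require Import structures.
From mathcomp Require Import all_boot all_order all_algebra.
From mathcomp Require Import complex.
From mathcomp Require Import all_classical all_reals all_analysis.

Set Implicit Arguments.
Unset Strict Implicit.
Unset Printing Implicit Defensive.

Import Order.TTheory GRing.Theory Num.Theory.
Import numFieldNormedType.Exports.

Local Open Scope classical_set_scope.
Local Open Scope ring_scope.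
Local Open Scope complex_scope.

(* Over K = R this is the class C^k near x; over K = R[i] the derivatives are
   complex ones, so that C^1 already means holomorphic near x. *)
Fixpoint Ck_at (K : numFieldType) (V W : normedModType K) (k : nat)
    (f : V -> W) (x : V) : Prop :=
  if k is k'.+1 then
    (\forall y \near x, differentiable f y) /\ (forall v, Ck_at k' ('D_v f) x)
  else {for x, continuous f}.

Definition smooth_at (K : numFieldType) (V W : normedModType K)
    (f : V -> W) (x : V) : Prop := forall k, Ck_at k f x.

(* A space with a preferred chart [chart p] around each point p, with domain
   [cdom p] and inverse [cinv p].  The tangent space at p is modelled on 'rV_n
   by means of the preferred chart at p. *)
Record charted (K : numFieldType) (n : nat) := Charted {
  carrier :> topologicalType;
  cdom : carrier -> set carrier;
  chart : carrier -> carrier -> 'rV[K]_n;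
  cinv : carrier -> 'rV[K]_n -> carrier }.

Arguments cdom {K n c}.
Arguments chart {K n c}.
Arguments cinv {K n c}.

(* Smooth manifold for K = R, complex manifold for K = R[i]. *)
Record is_manifold (K : numFieldType) (n : nat) (M : charted K n) : Prop := {
  mfd_hausdorff : hausdorff_space M;
  mfd_second_countable : @second_countable M;
  mfd_mem : forall p : M, cdom p p;
  mfd_dom_open : forall p : M, open (cdom p);
  mfd_img_open : forall p : M, open (chart p @` cdom p);
  mfd_inv : forall p q : M, cdom p q -> cinv p (chart p q) = q;
  mfd_chart_cont : forall p q : M, cdom p q -> {for q, continuous (chart p)};
  mfd_inv_cont : forall p q : M, cdom p q ->
    {for chart p q, continuous (cinv p)};
  mfd_transition : forall p q r : M, cdom p r -> cdom q r ->
    smooth_at (chart q \o cinv p) (chart p r) }.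

Definition prod_mfd (K : numFieldType) (m n : nat)
    (M : charted K m) (N : charted K n) : charted K (m + n) :=
  {| carrier := (M * N)%type : topologicalType;
     cdom p := cdom p.1 `*` cdom p.2;
     chart p q := row_mx (chart p.1 q.1) (chart p.2 q.2);
     cinv p x := (cinv p.1 (lsubmx x), cinv p.2 (rsubmx x)) |}.

Definition affine_mfd (K : numFieldType) (n : nat) : charted K n :=
  {| carrier := 'rV[K]_n : topologicalType;
     cdom _ := setT; chart _ x := x; cinv _ x := x |}.

Section Calculus.
Variables (K : numFieldType) (m n : nat) (M : charted K m) (N : charted K n).
Implicit Types (f : M -> N) (p : M).

Definition tmap f p : 'rV[K]_m -> 'rV[K]_n :=
  'd (chart (f p) \o f \o cinv p) (chart p p).

Definition smooth_map f : Prop := continuous f /\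
  forall p, smooth_at (chart (f p) \o f \o cinv p) (chart p p).

Definition holomorphic_map (JM : M -> 'rV[K]_m -> 'rV[K]_m)
    (JN : N -> 'rV[K]_n -> 'rV[K]_n) f : Prop :=
  smooth_map f /\ forall p v, tmap f p (JM p v) = JN (f p) (tmap f p v).

End Calculus.

Section Tensors.
Variables (R : realType) (n : nat) (M : charted R n).

(* From coordinates in [chart p] at the point of coordinates y to the tangent
   space at that point, and back. *)
Definition frame (p : M) (y v : 'rV[R]_n) : 'rV[R]_n :=
  'd (chart (cinv p y) \o cinv p) y v.
Definition coframe (p q : M) (v : 'rV[R]_n) : 'rV[R]_n :=
  'd (chart p \o cinv q) (chart q q) v.

Definition loc1 (A : M -> 'rV[R]_n -> R) (p : M) (y v : 'rV[R]_n) : R :=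
  A (cinv p y) (frame p y v).
Definition loc2 (w : M -> 'rV[R]_n -> 'rV[R]_n -> R) (p : M)
    (y u v : 'rV[R]_n) : R :=
  w (cinv p y) (frame p y u) (frame p y v).
Definition locE (L : M -> 'rV[R]_n -> 'rV[R]_n) (p : M)
    (y v : 'rV[R]_n) : 'rV[R]_n :=
  coframe p (cinv p y) (L (cinv p y) (frame p y v)).

Definition smooth_function_at (f : M -> R) (p : M) : Prop :=
  smooth_at (f \o cinv p) (chart p p).
Definition dfun (f : M -> R) (p : M) (v : 'rV[R]_n) : R :=
  'd (f \o cinv p) (chart p p) v.

Definition smooth_form1_at (A : M -> 'rV[R]_n -> R) (p : M) : Prop :=
  forall v, smooth_at (fun y => loc1 A p y v) (chart p p).
Definition d1 (A : M -> 'rV[R]_n -> R) (p : M) (u v : 'rV[R]_n) : R :=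
  'D_u (fun y => loc1 A p y v) (chart p p)
  - 'D_v (fun y => loc1 A p y u) (chart p p).

Definition smooth_form2 (w : M -> 'rV[R]_n -> 'rV[R]_n -> R) : Prop :=
  forall p u v, smooth_at (fun y => loc2 w p y u v) (chart p p).
Definition d2 (w : M -> 'rV[R]_n -> 'rV[R]_n -> R) (p : M)
    (t u v : 'rV[R]_n) : R :=
  'D_t (fun y => loc2 w p y u v) (chart p p)
  - 'D_u (fun y => loc2 w p y t v) (chart p p)
  + 'D_v (fun y => loc2 w p y t u) (chart p p).

Definition smooth_endo (L : M -> 'rV[R]_n -> 'rV[R]_n) : Prop :=
  forall p v, smooth_at (fun y => locE L p y v) (chart p p).

(* [Lu,Lv] - L[Lu,v] - L[u,Lv] - [u,v] for u, v of constant coordinates. *)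
Definition nijenhuis (L : M -> 'rV[R]_n -> 'rV[R]_n) (p : M)
    (u v : 'rV[R]_n) : 'rV[R]_n :=
  'D_(L p u) (fun y => locE L p y v) (chart p p)
  - 'D_(L p v) (fun y => locE L p y u) (chart p p)
  + L p ('D_v (fun y => locE L p y u) (chart p p))
  - L p ('D_u (fun y => locE L p y v) (chart p p)).

(* [w] is in the image of H^2(M,Z) in H^2_dR(M), by the Cech-de Rham
   isomorphism: for some open cover, the Cech cocycle attached to w takes
   integer values. *)
Definition integral_class (w : M -> 'rV[R]_n -> 'rV[R]_n -> R) : Prop :=
  exists (T : Type) (U : T -> set M) (A : T -> M -> {scalar 'rV[R]_n})
      (f : T -> T -> M -> R),
  [/\ (forall i, open (U i)) /\ (forall p, exists i, U i p),
      forall i p, U i p ->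
        smooth_form1_at (A i) p /\ (forall u v, d1 (A i) p u v = w p u v),
      forall i j p, U i p -> U j p ->
        smooth_function_at (f i j) p /\
        (forall v, dfun (f i j) p v = A j p v - A i p v) &
      forall i j k p, U i p -> U j p -> U k p ->
        exists z : int, f i j p + f j k p - f i k p = z%:~R].

End Tensors.

Section Complex.
Variable R : realType.
Local Notation C := (R[i]).

Definition toR (n : nat) (z : 'rV[C]_n) : 'rV[R]_(n + n) :=
  row_mx (map_mx (@complex.Re R) z) (map_mx (@complex.Im R) z).
Definition ofR (n : nat) (x : 'rV[R]_(n + n)) : 'rV[C]_n :=
  \row_j (lsubmx x 0 j +i* rsubmx x 0 j).

Definition realify (n : nat) (M : charted C n) : charted R (n + n) :=
  {| carrier := M; cdom := @cdom _ _ M;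
     chart p q := toR (chart p q); cinv p x := cinv p (ofR x) |}.

(* Multiplication by i on the tangent spaces of [realify M]. *)
Definition stdJ (n : nat) (v : 'rV[R]_(n + n)) : 'rV[R]_(n + n) :=
  row_mx (- rsubmx v) (lsubmx v).

(* Some z is the point of affine coordinate z, None is infinity; the preferred
   coordinate is 1/z at infinity, z elsewhere. *)
Definition CP1 : charted C 1 :=
  {| carrier := one_point_compactification (C^o : topologicalType);
     cdom p := if p is Some _ then [set q | q <> None]
               else [set q | q <> Some 0];
     chart p q := const_mx (match p, q with
                            | Some _, Some z => z
                            | None, Some z => z^-1
                            | _, None => 0
                            end);
     cinv p x := if p is Some _ then Some (x 0 0)
                 else if x 0 0 == 0 then None else Some (x 0 0)^-1 |}.

Definition P1 : charted R (1 + 1) := realify CP1.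

Definition P1pt (z : C) : P1 := Some z : one_point_compactification C^o.
Definition P1inf : P1 := None : one_point_compactification C^o.

Definition Ci : C := 0 +i* 1.

Definition expi (t : R) : C := cos t +i* sin t.

Definition generator (n : nat) (M : charted R n) (a : C -> M -> M) (p : M) :
    'rV[R]_n :=
  derive1 (fun t : R => chart p (a (expi t) p)) 0.

Record is_circle_action (n : nat) (M : charted R n) (a : C -> M -> M) : Prop := {
  act_one : forall m, a 1 m = m;
  act_mul : forall z w m, `|z| = 1 -> `|w| = 1 -> a (z * w) m = a z (a w m);
  act_smooth : @smooth_map R _ _ (prod_mfd (affine_mfd R 1) M) M
    (fun q => a (expi (q.1 0 0)) q.2) }.

Section Hyperkaehler.
Variables (n : nat) (M : charted R n).
Local Notation T := ('rV[R]_n).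

Definition gform (g : M -> 'M[R]_n) (m : M) (v w : T) : R :=
  (v *m g m *m w^T) 0 0.

Definition riemannian (g : M -> 'M[R]_n) : Prop :=
  [/\ smooth_form2 (gform g),
      forall m v w, gform g m v w = gform g m w v &
      forall m v, v != 0 -> 0 < gform g m v v].

Definition kform (g : M -> 'M[R]_n) (L : M -> {linear T -> T}) (m : M)
  (v w : T) : R := gform g m (L m v) w.

Record is_kaehler (g : M -> 'M[R]_n) (L : M -> {linear T -> T}) : Prop := {
  kaehler_smooth : smooth_endo (fun m => L m);
  kaehler_square : forall m v, L m (L m v) = - v;
  kaehler_integrable : forall m v w, nijenhuis (fun m => L m) m v w = 0;
  kaehler_hermitian : forall m v w,
    gform g m (L m v) (L m w) = gform g m v w;
  kaehler_closed : forall m t u v, d2 (kform g L) m t u v = 0 }.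

Record is_hyperkaehler (g : M -> 'M[R]_n) (I J K : M -> {linear T -> T}) :
    Prop := {
  hk_manifold : is_manifold M;
  hk_metric : riemannian g;
  hk_I : is_kaehler g I;
  hk_J : is_kaehler g J;
  hk_K : is_kaehler g K;
  hk_IJ : forall m v, I m (J m v) = K m v;
  hk_JI : forall m v, J m (I m v) = - K m v }.

Variables (g : M -> 'M[R]_n) (I J K : M -> {linear T -> T}).

(* omega_J + i omega_K *)
Definition kformJK (m : M) (v w : T) : C := kform g J m v w +i* kform g K m v w.

Variables (a : C -> M -> M) (mu : M -> C).

Record is_hk_circle_action : Prop := {
  hka_action : is_circle_action a;
  hka_isometric : forall z m v w, `|z| = 1 ->
    gform g (a z m) (tmap (a z) m v) (tmap (a z) m w) = gform g m v w;
  hka_I : forall z m v, `|z| = 1 ->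
    tmap (a z) m (I m v) = I (a z m) (tmap (a z) m v);
  hka_weight : forall z m v w, `|z| = 1 ->
    kformJK (a z m) (tmap (a z) m v) (tmap (a z) m w) = z * kformJK m v w }.

Record is_I_moment_map : Prop := {
  mu_imaginary : forall m, complex.Re (mu m) = 0;
  mu_smooth : forall m, smooth_function_at (fun q => complex.Im (mu q)) m;
  mu_moment : forall m v,
    dfun (fun q => complex.Im (mu q)) m v = kform g I m (generator a m) v }.

(* Inverse stereographic projection, x_2 + i x_3 = -2 i z / (1 + |z|^2).  The
   factor -i is forced by the formula [twform] below: this is the choice for
   which [twform z] is of type (2,0) for I_x. *)
Definition sphere (p : P1) : R * R * R :=
  if p is Some z then
    let: u := complex.Re z in let: v := complex.Im z in
    let: N := 1 + u ^+ 2 + v ^+ 2 in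
    ((1 - u ^+ 2 - v ^+ 2) / N, 2 * v / N, - (2 * u / N))
  else (-1, 0, 0).

Definition Isphere (p : P1) (m : M) (v : T) : T :=
  (sphere p).1.1 *: I m v + (sphere p).1.2 *: J m v + (sphere p).2 *: K m v.

Definition Z : charted R (1 + 1 + n) := prod_mfd P1 M.

Definition JZ (z : Z) (v : 'rV[R]_(1 + 1 + n)) : 'rV[R]_(1 + 1 + n) :=
  row_mx (stdJ (lsubmx v)) (Isphere z.1 z.2 (rsubmx v)).

Definition varpi (z : Z) : P1 := z.1.

Definition vertical (z : Z) (v : 'rV[R]_(1 + 1 + n)) : Prop :=
  @tmap R _ _ Z P1 varpi z v = 0.

Definition is_section (s : P1 -> Z) : Prop :=
  holomorphic_map (fun=> @stdJ 1) JZ s /\ forall p, varpi (s p) = p.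

Definition twistor_line (m : M) (p : P1) : Z := (p, m).

(* Holomorphy at p of a section V of s^*TZ, the total space of TZ being a
   complex manifold: in a chart, the Cauchy-Riemann equation
   dV o i = JZ dV + (d_V JZ) ds, i.e. the linearization of ds o i = JZ ds. *)
Definition holomorphic_along_at (s : P1 -> Z)
    (V : P1 -> 'rV[R]_(1 + 1 + n)) (p : P1) : Prop :=
  let: Vloc := fun y => @coframe R _ Z (s p) (s (cinv p y)) (V (cinv p y)) in
  smooth_at Vloc (chart p p) /\
  forall b : 'rV[R]_(1 + 1),
    'D_(stdJ b) Vloc (chart p p) =
      JZ (s p) ('D_b Vloc (chart p p))
      + 'D_(V p) (fun x => @locE R _ Z JZ (s p) x (tmap s p b))
          (chart (s p) (s p)).

Definition holomorphic_vertical_on (A : set P1) (s : P1 -> Z)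
    (V : P1 -> 'rV[R]_(1 + 1 + n)) : Prop :=
  forall p, A p -> vertical (s p) (V p) /\ holomorphic_along_at s V p.

(* H^0(CP^1, s^* T_varpi Z) *)
Definition H0 (s : P1 -> Z) (V : P1 -> 'rV[R]_(1 + 1 + n)) : Prop :=
  holomorphic_vertical_on setT s V.

Definition Zscale (z : Z) (c : C) (v : 'rV[R]_(1 + 1 + n)) :=
  complex.Re c *: v + complex.Im c *: JZ z v.

Definition vertical_frame_on (A : set P1) (r : nat) (s : P1 -> Z)
    (e : 'I_r -> P1 -> 'rV[R]_(1 + 1 + n)) : Prop :=
  (forall k, holomorphic_vertical_on A s (e k)) /\
  forall p, A p -> forall v, vertical (s p) v ->
    exists! c : 'rV[C]_r, v = \sum_(k < r) Zscale (s p) (c 0 k) (e k p).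

(* s^* T_varpi Z is isomorphic to O(1)^r: O(1) has the frames 1 away from
   infinity and z away from 0, with transition function z. *)
Definition pullback_is_O1 (r : nat) (s : P1 -> Z) : Prop :=
  exists e f : 'I_r -> P1 -> 'rV[R]_(1 + 1 + n),
    [/\ vertical_frame_on [set p | p <> P1inf] s e,
        vertical_frame_on [set p | p <> P1pt 0] s f &
        forall k (z : C), z != 0 ->
          f k (P1pt z) = Zscale (s (P1pt z)) z (e k (P1pt z))].

Definition actP1 (z : C) (p : P1) : P1 :=
  if p is Some l then P1pt (z * l) else P1inf.

Definition actZ (z : C) (q : Z) : Z := (actP1 z q.1, a z q.2).

Definition actS (z : C) (s : P1 -> Z) (p : P1) : Z :=
  actZ z (s (actP1 z^-1 p)).

(* The vector field generated by [actS], at s, as a section of s^*T_varpi Z: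
   the derivative of the orbit of s, evaluated pointwise. *)
Definition generatorS (s : P1 -> Z) (p : P1) : 'rV[R]_(1 + 1 + n) :=
  derive1 (fun t : R => @chart R _ Z (s p) (actS (expi t) s p)) 0.

(* Real tangent vectors stand for their (1,0) parts; this changes no value,
   since [kformJK] and [twform z] are of type (2,0). *)

Definition twform (z : C) (m : M) (v w : T) : C :=
  kformJK m v w + 2 * Ci * z * (kform g I m v w)%:C
  + z ^+ 2 * conjc (kformJK m v w).

Definition Omega0 (s : P1 -> Z) (V W : P1 -> 'rV[R]_(1 + 1 + n)) : C :=
  - (Ci / 2) * derive1 (fun z : C^o =>
      twform z (s (P1pt z)).2 (rsubmx (V (P1pt z))) (rsubmx (W (P1pt z))) : C^o) 0.

(* ds_0(d/dz), with d/dz identified with the real vector d/d(Re z). *)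
Definition dot0 (s : P1 -> Z) : 'rV[R]_(1 + 1 + n) :=
  tmap s (P1pt 0) (row_mx 1%:M 0).

Definition energy (s : P1 -> Z) : C :=
  let: m := (s (P1pt 0)).2 in
  2^-1 * kformJK m (rsubmx (@generator _ Z actZ (s (P1pt 0))))
                   (rsubmx (dot0 s - dot0 (twistor_line m)))
  + mu m.

(* Infinitesimal deformation of ev s in the direction w. *)
Definition deformation (N : nat) (S : charted C N) (ev : S -> P1 -> Z) (s : S)
    (w : 'rV[C]_N) (p : P1) : 'rV[R]_(1 + 1 + n) :=
  @tmap R _ _ (realify S) Z (fun s' => ev s' p) s (toR w).

(* S, with evaluation map ev, is the space of holomorphic sections s such that
   s^*T_varpi Z is isomorphic to O(1)^r, with the compact-open topology and the
   complex structure of Kodaira's deformation theory, which is characterized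
   by: evaluation is holomorphic and T_s S = H^0(CP^1, s^*T_varpi Z). *)
Record is_section_space (r N : nat) (S : charted C N) (ev : S -> P1 -> Z) :
    Prop := {
  ss_manifold : is_manifold S;
  ss_inj : injective ev;
  ss_range : range ev = [set s | is_section s /\ pullback_is_O1 r s];
  ss_topology : forall A : set S, open A <->
    exists2 B : set {compact-open, P1 -> Z}, open B & A = ev @^-1` B;
  ss_holomorphic : @holomorphic_map R _ _ (prod_mfd (realify S) P1) Z
    (fun _ v => row_mx (stdJ (lsubmx v)) (stdJ (rsubmx v))) JZ
    (fun q => ev q.1 q.2);
  ss_tangent : forall s w, H0 (ev s) (deformation ev s w);
  ss_tangent_iso : forall s V, H0 (ev s) V ->
    exists! w, deformation ev s w = V }.

Definition energy_loc (N : nat) (S : charted C N) (ev : S -> P1 -> Z) (s : S) :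
  'rV[C]_N -> C^o := fun y => energy (ev (cinv s y)).

Definition denergy (N : nat) (S : charted C N) (ev : S -> P1 -> Z) (s : S)
    (w : 'rV[C]_N) : C := 'd (energy_loc ev s) (chart s s) w.

End Hyperkaehler.
End Complex.

(* Main.v *)
(* Write w for omega_J + i omega_K.  In charts, E(s) is half of
   w(X, ds_0(d/dz)) at s(0), plus mu(s(0)).  When s moves in the direction V,
   closedness of w and Cartan's formula L_X w = i w turn the derivative of the
   first term into the part of i Omega_0(X_s, V) that comes from the variation
   of w(X_s, V) along s; the moment map equation d mu = i omega_I(X, .) accounts
   for the coefficient 2 i z omega_I of the twisted symplectic form.

   Omega_0 is nondegenerate: if e_k is a frame of s^*T_varpi Z away from infinity
   that trivializes it as O(1)^r, then the sections e_k and z e_k form a basis of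
   T_s S; Omega_0(z e_j, z e_k) = 0 and Omega_0(z e_j, e_k) is -i/2 times
   w(e_j, e_k) at s(0), where w is nondegenerate of type (2,0).  Hence dE_s = 0
   exactly when the generator X_s vanishes.  If it does, each curve
   t |-> (e^{it}.s)(p) has zero velocity at every time by the group law, so it is
   constant and s is a fixed point. *)

Require Import Defs.
From HB Require Import structures.
From mathcomp Require Import all_boot all_order all_algebra.
From mathcomp Require Import complex ring lra.
From mathcomp Require Import all_classical all_reals all_analysis.

Set Implicit Arguments.
Unset Strict Implicit.
Unset Printing Implicit Defensive.

Import Order.TTheory GRing.Theory Num.Theory.
Import numFieldNormedType.Exports.

Local Open Scope classical_set_scope.
Local Open Scope ring_scope.
Local Open Scope complex_scope.

(** * Functions of class C^k *)

(** Two complex derivatives occur in the statement, the z-derivative in Omega_0 and the differential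
    of the energy. Both are total functions without meaning where no limit exists, so existence has
    to be proved; it comes from real derivatives and the Cauchy-Riemann equations. For Omega_0 these
    follow from closedness of omega_J and omega_K, their type for I, and the linearized holomorphy
    of V and W. For the energy they are a consequence of the moment map formula itself, since i
    Omega_0(X_s, w) is complex linear in w. Tangent vectors at different points are modelled in
    different preferred charts. Derivatives at z = 0 are therefore taken in the one chart at s(0),
    while [frame] and [coframe] translate to the tangent spaces at nearby points. Schwarz's theorem
    is used on three jointly smooth maps: the action in time and position, the orbit of s in time
    and P1-coordinate, and evaluation in section and P1-coordinate. The second makes X_s a
    holomorphic section, the third exchanges varying s with moving along s. *)

Section Differentiability.
Variables (K : numFieldType) (V W : normedModType K).
Implicit Types (f g : V -> W) (x v : V).

(** The value of the differential is forced by uniqueness of the linear term in a little-o expansion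
    ([diff_unique]). *)
Lemma is_diff_eps f (df : {linear V -> W}) x : continuous df ->
  (forall e : K, 0 < e ->
     \forall h \near 0, `|f (h + x) - f x - df h| <= e * `|h|) ->
  is_diff x f df.
Proof.
move=> dfc fe.
have E : f \o shift x = cst (f x) + df +o_ 0 id.
  apply/eqaddoP => _/posnumP[e]; near=> h.
  rewrite !fctE /= opprD addrA.
  by near: h; exact: fe.
have D := diff_unique dfc E.
apply: DiffDef => //; apply/diff_locallyP; rewrite D; split => //.
Unshelve. all: by end_near. Qed.

Lemma near_eq_is_diff f g x : (\near x, f x = g x) -> differentiable f x ->
  is_diff x g ('d f x).
Proof.
move=> fg dfx; apply: is_diff_eps; first exact: diff_continuous dfx.
move=> e e0.
have /eqaddoP/(_ e e0) H := diff_locally dfx.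
have fgx := nbhs_singleton fg.
near=> h; rewrite -fgx.
have <- : f (h + x) = g (h + x).
  by near: h; move: fg; rewrite (near_shift 0) subr0.
near: h; apply: filterS H => h /=.
by rewrite !fctE /= opprD addrA.
Unshelve. all: by end_near. Qed.

Lemma near_eq_differentiable f g x : (\near x, f x = g x) ->
  differentiable f x -> differentiable g x.
Proof. by move=> fg /(near_eq_is_diff fg) []. Qed.

Lemma near_eq_diff f g x v : (\near x, f x = g x) -> differentiable f x ->
  'd g x v = 'd f x v.
Proof. by move=> fg /(near_eq_is_diff fg) [_ ->]. Qed.

Lemma derive_shift_in f x v w : 'D_v (fun y => f (y + w)) x = 'D_v f (x + w).
Proof.
rewrite /derive; set d := (fun _ : K => _); set d' := (fun _ : K => _).
by suff -> : d = d' by []; apply/funext => h; rewrite /d /d' /= addrA.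
Qed.

(** Agreement near x is agreement near every point near x ([near_join]), so the property passes to
    the derivatives. *)
Lemma Ck_at_near k f g x : (\near x, f x = g x) -> Ck_at k f x -> Ck_at k g x.
Proof.
elim: k f g => [|k IH] f g fg /=.
  have E : f x = g x := nbhs_singleton fg.
  move=> fc; apply: cvg_trans (near_eq_cvg fg) _.
  by rewrite -E; exact: fc.
have fg2 := near_join fg.
move=> [df Df]; split.
  near=> y; apply: (@near_eq_differentiable f); last by near: y.
  by near: y.
move=> v; apply: (IH ('D_v f)) => //.
near=> y; apply: near_eq_derive; by near: y.
Unshelve. all: by end_near. Qed.

Lemma Ck_at_S k f x : Ck_at k.+1 f x -> Ck_at k f x.
Proof.
elim: k f => [|k IH] f [df Df].
  by apply: differentiable_continuous; exact: nbhs_singleton df.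
by split=> // v; apply: IH; apply: Df.
Qed.

Lemma Ck_at_le k l f x : (k <= l)%N -> Ck_at l f x -> Ck_at k f x.
Proof.
elim: l => [|l IH]; first by rewrite leqn0 => /eqP ->.
by rewrite leq_eqVlt => /orP[/eqP -> //|kl] /Ck_at_S; exact: IH.
Qed.

Lemma Ck_at_continuous k f x : Ck_at k f x -> {for x, continuous f}.
Proof. by move=> /(Ck_at_le (leq0n k)). Qed.

Lemma Ck_at_differentiable k f x : Ck_at k.+1 f x -> differentiable f x.
Proof. by case=> /nbhs_singleton. Qed.

Lemma Ck_at_cst k (c : W) x : Ck_at k (fun _ : V => c) x.
Proof.
elim: k c => [|k IH] c /=; first exact: cst_continuous.
split; first by near=> y; exact: differentiable_cst.
move=> v; rewrite (_ : 'D_v _ = fun=> 0) //.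
by apply/funext => y; exact: derive_cst.
Unshelve. all: by end_near. Qed.

Lemma Ck_at_add k f g x : Ck_at k f x -> Ck_at k g x ->
  Ck_at k (fun y => f y + g y) x.
Proof.
elim: k f g => [|k IH] f g /=; first by move=> fc gc; exact: cvgD.
move=> [df Df] [dg Dg]; split.
  near=> y; apply: (@differentiableD _ _ _ f g); by near: y.
move=> v; apply: (@Ck_at_near _ (fun y => 'D_v f y + 'D_v g y)); last exact: IH.
near=> y; rewrite (@deriveD _ _ _ f g) //; apply: diff_derivable; by near: y.
Unshelve. all: by end_near. Qed.

Lemma Ck_at_sum k (I : Type) (r : seq I) (F : I -> V -> W) x :
  (forall i, Ck_at k (F i) x) -> Ck_at k (fun y => \sum_(i <- r) F i y) x.
Proof.
move=> FC; elim: r => [|i r IH].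
  rewrite (_ : (fun y => _) = fun=> 0); first exact: Ck_at_cst.
  by apply/funext => y; rewrite big_nil.
rewrite (_ : (fun y => _) = fun y => F i y + \sum_(i <- r) F i y).
  exact: Ck_at_add.
by apply/funext => y; rewrite big_cons.
Qed.

End Differentiability.

Lemma Ck_at_id (K : numFieldType) (V : normedModType K) k (x : V) :
  Ck_at k (fun y => y) x.
Proof.
case: k => [|k]; first exact: cvg_id.
split; first by near=> y; exact: ex_diff.
move=> v; rewrite (_ : 'D_v _ = fun=> v); first exact: Ck_at_cst.
by apply/funext => y; exact: derive_id.
Unshelve. all: by end_near. Qed.

Section Scalars.
Variables (K : numFieldType) (V W : normedModType K).
Implicit Types (f g : V -> K) (x v : V).

Lemma Ck_at_mul k f g x : Ck_at k f x -> Ck_at k g x ->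
  Ck_at k (fun y => f y * g y) x.
Proof.
elim: k f g => [|k IH] f g /=; first by move=> fc gc; exact: cvgM.
move=> fC gC; have [df Df] := fC; have [dg Dg] := gC; split.
  near=> y; apply: (@differentiableM _ _ f g); by near: y.
move=> v; apply: (@Ck_at_near _ _ _ _ (fun y => f y * 'D_v g y + g y * 'D_v f y)).
  near=> y; rewrite (@deriveM _ _ f g) //; apply: diff_derivable; by near: y.
by apply: Ck_at_add; apply: IH => //; exact: Ck_at_S.
Unshelve. all: by end_near. Qed.

Lemma Ck_at_scalel k f (w : W) x : Ck_at k f x -> Ck_at k (fun y => f y *: w) x.
Proof.
elim: k f => [|k IH] f /=; first by move=> fc; exact: cvgZr_tmp.
move=> [df Df]; split.
  near=> y; apply: (@differentiableZl _ _ _ f w); by near: y.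
move=> v; apply: (@Ck_at_near _ _ _ _ (fun y => 'D_v f y *: w)); last exact: IH.
near=> y; have fy : differentiable f y by near: y.
by rewrite !deriveE ?diffZl //; exact: differentiableZl.
Unshelve. all: by end_near. Qed.

Lemma Ck_at_inv k f x : f x != 0 -> Ck_at k f x -> Ck_at k (fun y => (f y)^-1) x.
Proof.
move=> fx0; elim: k => [|k IH] fC; first exact: cvgV.
have [df Df] := fC.
have fn0 : \forall y \near x, f y != 0.
  have /cvgrPdist_lt/(_ `|f x|) := Ck_at_continuous fC.
  rewrite normr_gt0 => /(_ fx0); apply: filterS => y.
  by apply: contraTneq => ->; rewrite subr0 ltxx.
split.
  near=> y; apply: differentiableV; by near: y.
move=> v; apply: (@Ck_at_near _ _ _ _ (fun y => - 1 * ((f y)^-1 * (f y)^-1) * 'D_v f y)).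
  near=> y; rewrite deriveV.
  - by rewrite /= -exprVn expr2 mulN1r.
  - by near: y.
  - apply: diff_derivable; by near: y.
apply: Ck_at_mul; last exact: Df.
apply: Ck_at_mul; first exact: Ck_at_cst.
by apply: Ck_at_mul; exact/IH/Ck_at_S.
Unshelve. all: by end_near. Qed.

End Scalars.

Section LinearMaps.
Variable K : numFieldType.

Lemma rV_linear_sum (W : lmodType K) n (f : 'rV[K]_n -> W) u : linear f ->
  f u = \sum_j u 0 j *: f (delta_mx 0 j).
Proof.
move=> fl; pose flM := GRing.isLinear.Build _ _ _ _ _ fl.
pose fL : {linear _ -> _} := HB.pack f flM.
rewrite -[f]/(fL : _ -> _) {1}[u]row_sum_delta linear_sum.
by apply: eq_bigr => j _; rewrite linearZ.
Qed.

Lemma rV_linear_continuous (W : normedModType K) n (f : 'rV[K]_n -> W) :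
  linear f -> continuous f.
Proof.
move=> fl; rewrite (_ : f = fun u : 'rV[K]_n => \sum_j u 0 j *: f (delta_mx 0 j)).
  move=> x; apply: (@Ck_at_continuous _ _ _ 0); apply: Ck_at_sum => j.
  by apply: (@Ck_at_scalel _ _ _ 0 (fun u : 'rV[K]_n => u 0 j)); exact: coord_continuous.
by apply/funext => u; exact: rV_linear_sum.
Qed.

Lemma linear_is_diff (V W : normedModType K) (f : V -> W) x : linear f -> continuous f -> is_diff x f f.
Proof.
move=> fl; pose flM := GRing.isLinear.Build _ _ _ _ _ fl.
pose fL : {linear _ -> _} := HB.pack f flM.
by move=> fc; apply: DiffDef;
  [exact: (@linear_differentiable _ _ _ fL)|exact: (@diff_lin _ _ _ fL)].
Qed.

Variables V W X : normedModType K.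

Lemma derive_linear_comp (L : W -> X) (f : V -> W) x v : linear L -> continuous L ->
  differentiable f x -> 'D_v (fun y => L (f y)) x = L ('D_v f x).
Proof.
move=> Ll Lc df; have [dL EL] := linear_is_diff (f x) Ll Lc.
have dLf : differentiable (L \o f) x by exact: differentiable_comp.
by rewrite (deriveE _ dLf) diff_comp //= EL deriveE.
Qed.

Lemma Ck_at_linear_comp k (L : W -> X) (f : V -> W) x : linear L -> continuous L ->
  Ck_at k f x -> Ck_at k (fun y => L (f y)) x.
Proof.
move=> Ll Lc; elim: k f => [|k IH] f /=.
  by move=> fc; apply: (@continuous_comp _ _ _ f L) => //; exact: Lc.
move=> [df Df]; split.
  near=> y; apply: (@differentiable_comp _ _ _ _ f L); first by near: y.
  by have [] := linear_is_diff (f y) Ll Lc.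
move=> v; apply: (@Ck_at_near _ _ _ _ (fun y => L ('D_v f y))); last exact: IH.
near=> y; rewrite derive_linear_comp //; by near: y.
Unshelve. all: by end_near. Qed.

Lemma diff_compE (f : V -> W) (g : W -> X) x v : differentiable f x ->
  differentiable g (f x) -> 'd (g \o f) x v = 'd g (f x) ('d f x v).
Proof. by move=> df dg; rewrite diff_comp. Qed.

End LinearMaps.

Section ScalarDifferential.
Variables (K : numFieldType) (V : normedModType K).
Implicit Types (f g : V -> K) (D E : V -> K) (x : V).

(** Keeps differentiability together with all directional derivatives, so that the differential of a
    polynomial expression is obtained as a term by composing the rules below. *)
Definition has_diff f x D := differentiable f x /\ forall v, 'D_v f x = D v.

Lemma has_diff_cst (c : K) x : has_diff (fun=> c) x (fun=> 0).
Proof. by split=> [|v]; [exact: differentiable_cst|exact: derive_cst]. Qed.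

Lemma has_diff_linear f x : linear (f : V -> K^o) -> continuous f -> has_diff f x f.
Proof.
move=> fl fc; have [df Ef] := @linear_is_diff _ _ (K^o) f x fl fc.
by split=> [|v]; [exact: df|apply: etrans (deriveE v df) _; rewrite Ef].
Qed.

Lemma has_diff_add f g x D E : has_diff f x D -> has_diff g x E ->
  has_diff (fun y => f y + g y) x (fun v => D v + E v).
Proof.
move=> [df Df] [dg Dg]; split; first exact: differentiableD.
move=> v; rewrite -Df -Dg.
exact: (deriveD (diff_derivable df) (diff_derivable dg)).
Qed.

Lemma has_diff_mul f g x D E : has_diff f x D -> has_diff g x E ->
  has_diff (fun y => f y * g y) x (fun v => f x * E v + g x * D v).
Proof.
move=> [df Df] [dg Dg]; split; first exact: differentiableM.
move=> v; rewrite -Df -Dg.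
exact: (deriveM (diff_derivable df) (diff_derivable dg)).
Qed.

Lemma has_diff_near f g x D E : has_diff f x D -> (\near x, f x = g x) ->
  (forall v, D v = E v) -> has_diff g x E.
Proof.
move=> [df Df] fg DE; split; first exact: near_eq_differentiable df.
by move=> v; rewrite -DE -Df; apply: esym; exact: near_eq_derive.
Qed.

End ScalarDifferential.

Section RowVectors.
Variable K : numFieldType.
Implicit Types (V W : normedModType K).

Lemma coord_linear n (j : 'I_n) : linear (fun u : 'rV[K]_n => u 0 j : K).
Proof. by move=> a u v; rewrite !mxE. Qed.

Lemma Ck_at_coord V n k (f : V -> 'rV[K]_n) x :
  Ck_at k f x <-> forall j, Ck_at k (fun y => f y 0 j : K) x.
Proof.
split=> [fC j|fC].
  apply: (@Ck_at_linear_comp _ _ _ _ k (fun u : 'rV[K]_n => u 0 j : K)) => //.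
    exact: coord_linear.
  exact: coord_continuous.
rewrite (_ : f = fun y => \sum_j f y 0 j *: delta_mx 0 j).
  by apply: Ck_at_sum => j; exact: Ck_at_scalel.
by apply/funext => y; exact: row_sum_delta.
Qed.

Lemma derive_coord V n (f : V -> 'rV[K]_n) x v j : differentiable f x ->
  ('D_v f x) 0 j = 'D_v (fun y => f y 0 j : K) x.
Proof.
move=> df; rewrite (@derive_linear_comp _ _ _ _ (fun u : 'rV[K]_n => u 0 j : K)) //.
  exact: coord_linear.
exact: coord_continuous.
Qed.

(** By the chain rule D_v(f o g) is the sum over j of (D_v g)_j times (d_j f) o g, and both factors
    are of class C^k, so induction applies. Scalar values give access to [Ck_at_mul]. *)
Lemma Ck_at_comp_scalar V n k (f : 'rV[K]_n -> K) (g : V -> 'rV[K]_n) x :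
  Ck_at k f (g x) -> Ck_at k g x -> Ck_at k (f \o g) x.
Proof.
elim: k f => [|k IH] f /=; first by move=> fc gc; exact: continuous_comp.
move=> [df Df] gC; have [dg Dg] := gC.
have gc : g @ x --> g x := @Ck_at_continuous _ _ _ k.+1 _ _ gC.
have dfg : \forall y \near x, differentiable f (g y) := gc _ df.
split.
  near=> y; apply: differentiable_comp; by near: y.
move=> v; apply: (@Ck_at_near _ _ _ _
  (fun y => \sum_j ('D_v g y) 0 j * 'D_(delta_mx 0 j) f (g y))).
  near=> y; have dfy : differentiable f (g y) by near: y.
  have dgy : differentiable g y by near: y.
  have dfgy : differentiable (f \o g) y by exact: differentiable_comp.
  rewrite (deriveE v dfgy) diff_comp //= (deriveE v dgy).
  have dl : linear ('d f (g y) : _ -> K^o).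
    by move=> a u w; rewrite linearD linearZ.
  rewrite -[RHS]/('d f (g y) _ : K^o) (rV_linear_sum _ dl).
  by apply: eq_bigr => j _; rewrite (deriveE _ dfy).
apply: Ck_at_sum => j; apply: Ck_at_mul; first exact/(Ck_at_coord _ _ _).1.
exact: (IH ('D_(delta_mx 0 j) f) (Df _) (Ck_at_S gC)).
Unshelve. all: by end_near. Qed.

Lemma Ck_at_comp V m n k (f : 'rV[K]_n -> 'rV[K]_m) (g : V -> 'rV[K]_n) x :
  Ck_at k f (g x) -> Ck_at k g x -> Ck_at k (f \o g) x.
Proof.
move=> /Ck_at_coord fC gC; apply/Ck_at_coord => j.
exact: (@Ck_at_comp_scalar _ _ _ (fun u => f u 0 j) _ _ (fC j)).
Qed.

Lemma Ck_at_row_mx V m n k (f : V -> 'rV[K]_m) (g : V -> 'rV[K]_n) x :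
  Ck_at k f x -> Ck_at k g x -> Ck_at k (fun y => row_mx (f y) (g y)) x.
Proof.
move=> /Ck_at_coord fC /Ck_at_coord gC; apply/Ck_at_coord => j.
case: (split_ordP j) => i ->.
  rewrite (_ : (fun y => _) = fun y => f y 0 i) //.
  by apply/funext => y; rewrite row_mxEl.
rewrite (_ : (fun y => _) = fun y => g y 0 i) //.
by apply/funext => y; rewrite row_mxEr.
Qed.

Lemma lsubmx_linear m n : linear (fun u : 'rV[K]_(m + n) => lsubmx u).
Proof. by move=> a u v; rewrite linearP. Qed.

Lemma rsubmx_linear m n : linear (fun u : 'rV[K]_(m + n) => rsubmx u).
Proof. by move=> a u v; rewrite linearP. Qed.

Lemma Ck_at_lsubmx V m n k (f : V -> 'rV[K]_(m + n)) x :
  Ck_at k f x -> Ck_at k (fun y => lsubmx (f y)) x.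
Proof.
apply: Ck_at_linear_comp; first exact: lsubmx_linear.
exact/rV_linear_continuous/lsubmx_linear.
Qed.

Lemma Ck_at_rsubmx V m n k (f : V -> 'rV[K]_(m + n)) x :
  Ck_at k f x -> Ck_at k (fun y => rsubmx (f y)) x.
Proof.
apply: Ck_at_linear_comp; first exact: rsubmx_linear.
exact/rV_linear_continuous/rsubmx_linear.
Qed.

End RowVectors.

(** * Linear and bilinear families depending on a point *)

Section Families.
Variable K : numFieldType.
Variables (V : normedModType K) (m n l : nat).

(** Linearity expands [B y (u y)] over the standard basis, so regularity on basis vectors
    suffices. *)
Lemma Ck_at_family1 k (B : V -> 'rV[K]_n -> K) (u : V -> 'rV[K]_n) x :
  (forall y, linear (B y : _ -> K^o)) ->
  (forall j, Ck_at k (fun y => B y (delta_mx 0 j)) x) -> Ck_at k u x ->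
  Ck_at k (fun y => B y (u y)) x.
Proof.
move=> Bl BC uC.
rewrite (_ : (fun y => _) = fun y => \sum_j u y 0 j * B y (delta_mx 0 j)).
  by apply: Ck_at_sum => j; apply: Ck_at_mul => //; exact/(Ck_at_coord _ _ _).1.
by apply/funext => y; rewrite -[B y _]/(B y _ : K^o) (rV_linear_sum _ (Bl y)).
Qed.

Lemma derive_family1 (B : V -> 'rV[K]_n -> K) (u : V -> 'rV[K]_n) x t :
  (forall y, linear (B y : _ -> K^o)) ->
  (forall j, differentiable (fun y => B y (delta_mx 0 j)) x) ->
  differentiable u x ->
  differentiable (fun y => B y (u y)) x /\
  'D_t (fun y => B y (u y)) x = 'D_t (fun y => B y (u x)) x + B x ('D_t u x).
Proof.
move=> Bl BC uC.
have E (w : V -> 'rV[K]_n) : (fun y => B y (w y)) =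
    \sum_j ((fun y => w y 0 j) * (fun y => B y (delta_mx 0 j))).
  apply/funext => y.
  rewrite fct_sumE -[B y _]/(B y _ : K^o) (rV_linear_sum _ (Bl y)).
  by apply: eq_bigr => j _; rewrite !fctE.
have dj j : differentiable (fun y => u y 0 j : K) x.
  exact: (differentiable_comp uC (differentiable_coord _ _ _)).
split.
  rewrite E; apply: differentiable_sum => j; exact: differentiableM.
rewrite E derive_sum => [|j]; last exact/diff_derivable/differentiableM.
rewrite (E (fun=> u x)) derive_sum => [|j]; last first.
  exact/diff_derivable/differentiableM.
rewrite -[B x _]/(B x _ : K^o) (rV_linear_sum _ (Bl x)) -big_split /=.
apply: eq_bigr => j _.
rewrite !deriveM //; try exact: diff_derivable.
rewrite derive_cst scaler0 addr0 derive_coord //.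
by rewrite [X in _ = _ + X]mulrC.
Qed.

End Families.

(** * Symmetry of second derivatives *)

Section Schwarz.
Variables (R : realType) (V : normedModType R).

Lemma line_MVT (f : V -> R) y u (h : R) : 0 < h ->
  (forall s, 0 <= s <= h -> differentiable f (y + s *: u)) ->
  exists2 s, 0 <= s <= h & f (y + h *: u) - f y = h * 'D_u f (y + s *: u).
Proof.
move=> h0 df.
pose p s : R := f (y + s *: u).
have dp s : 0 <= s <= h -> is_derive s (1 : R) p ('D_u f (y + s *: u)).
  move=> sh.
  have E : (fun t : R => t^-1 *: ((p \o shift s) t%:A - p s)) =
           (fun t : R => t^-1 *: ((f \o shift (y + s *: u)) (t *: u) - f (y + s *: u))).
    by apply/funext => t; rewrite /p /= [t%:A]mulr1 scalerDl addrCA.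
  have D : derivable f (y + s *: u) u by apply: diff_derivable; exact: df.
  by apply: DeriveDef; rewrite /derivable /derive E.
have [| |s sh E] := @MVT_segment R p (fun s => 'D_u f (y + s *: u)) _ _ (ltW h0).
- move=> s; rewrite in_itv /= => /andP[s0 sh]; apply: dp.
  by rewrite !ltW.
- apply: derivable_within_continuous => s; rewrite in_itv /= => sh.
  by have [] := dp s sh.
exists s; first by move: sh; rewrite in_itv.
by move: E; rewrite /p scale0r addr0 subr0 mulrC.
Qed.

(** The mean value theorem, for [g y := f (y + h *: v) - f y] along u and then for ['D_u f] along v,
    writes the second difference as h^2 times ['D_v ('D_u f)] at an intermediate point. Continuity
    of that derivative at x gives the estimate. *)
Lemma mixed_difference (f : V -> R) x u v : Ck_at 2 f x ->
  forall e, 0 < e -> \forall h \near 0^'+,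
   `|f (x + h *: u + h *: v) - f (x + h *: u) - f (x + h *: v) + f x
     - h ^+ 2 * 'D_v ('D_u f) x| <= e * h ^+ 2.
Proof.
move=> [df D2] e e0.
have [dDu Cuv] := D2 u.
have Cc := Cuv v.
have /nbhs_ballP[d /= d0 dP] : \forall y \near x,
    [/\ differentiable f y, differentiable ('D_u f) y &
        `|'D_v ('D_u f) x - 'D_v ('D_u f) y| < e].
  near=> y; split; [by near: y|by near: y|].
  by near: y; move/cvgrPdist_lt: Cc; exact.
(* The summand 1 keeps the divisor positive when u and v both vanish. *)
have N0 : 0 < `|u| + `|v| + 1 by rewrite ltr_wpDl.
near=> h.
have h0 : 0 < h by near: h; exact: nbhs_right_gt.
have hd : h * (`|u| + `|v| + 1) < d.
  by rewrite -ltr_pdivlMr //; near: h; apply: nbhs_right_lt; rewrite divr_gt0.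
have inb s t : 0 <= s <= h -> 0 <= t <= h -> ball x d (x + s *: u + t *: v).
  move=> /andP[s0 sh] /andP[t0 th]; rewrite -ball_normE /= -addrA opprD addNKr normrN.
  apply: le_lt_trans hd; apply: le_trans (ler_normD _ _) _.
  rewrite !normrZ (ger0_norm s0) (ger0_norm t0) mulrDr mulr1.
  rewrite -[leLHS]addr0 lerD ?(ltW h0) // mulrDr.
  by apply: lerD; apply: ler_wpM2r.
have hh : 0 <= h <= h by rewrite lexx ltW.
have zh : (0 : R) <= 0 <= h by rewrite lexx ltW.
pose g y := f (y + h *: v) - f y.
have dshift s : 0 <= s <= h -> differentiable (fun y => f (y + h *: v)) (x + s *: u).
  move=> sh; apply: (@differentiable_comp _ _ _ _ (fun y => y + h *: v) f) => //.
  by have [] := dP _ (inb _ _ sh hh).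
have dhere s : 0 <= s <= h -> differentiable f (x + s *: u).
  by move=> sh; have [] := dP _ (inb _ _ sh zh); rewrite scale0r addr0.
have [s sh Eg] : exists2 s, 0 <= s <= h &
    g (x + h *: u) - g x = h * 'D_u g (x + s *: u).
  apply: line_MVT => // s sh.
  by apply: (@differentiableB _ _ _ (fun y => f (y + h *: v)) f); auto.
have Dg : 'D_u g (x + s *: u) = 'D_u f (x + s *: u + h *: v) - 'D_u f (x + s *: u).
  rewrite (@deriveB _ _ _ (fun y => f (y + h *: v)) f).
  - by rewrite derive_shift_in.
  - by apply: diff_derivable; exact: dshift.
  - by apply: diff_derivable; exact: dhere.
have [t th Et] : exists2 t, 0 <= t <= h &
    'D_u f (x + s *: u + h *: v) - 'D_u f (x + s *: u) =
    h * 'D_v ('D_u f) (x + s *: u + t *: v).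
  by apply: (@line_MVT ('D_u f) _ v h h0) => t th; have [] := dP _ (inb _ _ sh th).
have -> : f (x + h *: u + h *: v) - f (x + h *: u) - f (x + h *: v) + f x =
    h ^+ 2 * 'D_v ('D_u f) (x + s *: u + t *: v).
  rewrite expr2 -mulrA -Et -Dg -Eg /g; ring.
have [_ _ lt] := dP _ (inb _ _ sh th).
rewrite -mulrBr normrM distrC ger0_norm ?sqr_ge0 // mulrC.
by apply: ler_wpM2r; rewrite ?sqr_ge0 // ltW.
Unshelve. all: by end_near. Qed.

(** The second difference is symmetric in u and v, so both mixed derivatives lie within e/2 of the
    same quotient. *)
Lemma schwarz_scalar (f : V -> R) x u v : Ck_at 2 f x ->
  'D_u ('D_v f) x = 'D_v ('D_u f) x.
Proof.
move=> fC; apply/eqP; rewrite -subr_eq0 -normr_le0; apply/ler_addgt0Pl => e e0.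
rewrite addr0.
have e2 : 0 < e / 2 by rewrite divr_gt0.
have Huv := mixed_difference u v fC e2.
have Hvu := mixed_difference v u fC e2.
have [h [h0 [A B]]] := filter_ex (filterI (nbhs_right_gt (0 : R)) (filterI Huv Hvu)).
have h20 : 0 < h ^+ 2 by rewrite exprn_gt0.
rewrite -(ler_pM2r h20) -{1}(ger0_norm (ltW h20)) -normrM.
move: A B; rewrite (addrAC x (h *: v)).
move: ('D_u ('D_v f) x) ('D_v ('D_u f) x) (h ^+ 2) (f x) => D D' H F.
move: (f (x + _ + _)) (f (x + h *: u)) (f (x + h *: v)) => P Q S.
rewrite !ler_norml => /andP[A1 A2] /andP[B1 B2]; apply/andP; split; lra.
Qed.

Lemma schwarz n (f : V -> 'rV[R]_n) x u v : Ck_at 2 f x ->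
  'D_u ('D_v f) x = 'D_v ('D_u f) x.
Proof.
move=> fC; have [df D2] := fC; apply/rowP => j.
have E w z : ('D_w ('D_z f) x) 0 j = 'D_w ('D_z (fun y => f y 0 j)) x.
  have [dDz _] := D2 z.
  rewrite derive_coord; last exact: nbhs_singleton dDz.
  apply: near_eq_derive; near=> y; rewrite derive_coord //; by near: y.
apply: (etrans (E u v)); apply: esym; apply: (etrans (E v u)); apply: schwarz_scalar.
exact: ((Ck_at_coord 2 f x).1 fC j).
Unshelve. all: by end_near. Qed.

End Schwarz.

Section BilinearFamilies.
Variable K : numFieldType.
Variables (V : normedModType K) (n : nat).

Lemma Ck_at_family2 m k (B : 'rV[K]_m -> 'rV[K]_n -> 'rV[K]_n -> K)
    (p : V -> 'rV[K]_m) (u v : V -> 'rV[K]_n) x :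
  (forall y w, linear (B y w : _ -> K^o)) ->
  (forall y w, linear (B y ^~ w : _ -> K^o)) ->
  (forall i j, Ck_at k (fun y => B y (delta_mx 0 i) (delta_mx 0 j)) (p x)) ->
  Ck_at k p x -> Ck_at k u x -> Ck_at k v x ->
  Ck_at k (fun y => B (p y) (u y) (v y)) x.
Proof.
move=> Bl Br BC pC uC vC.
apply: (@Ck_at_family1 _ _ _ _ (fun y w => B (p y) (u y) w)) => // j.
apply: (@Ck_at_family1 _ _ _ _ (fun y w => B (p y) w (delta_mx 0 j))) => // i.
exact: (@Ck_at_comp_scalar _ _ _ _ (fun y => B y (delta_mx 0 i) (delta_mx 0 j))).
Qed.

(** Product rule for a form with moving base point [p y] and moving arguments. In this way
    omega_L(V, W) along a section or along an orbit is differentiated in one chart. *)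
Lemma derive_family2 m (B : 'rV[K]_m -> 'rV[K]_n -> 'rV[K]_n -> K)
    (p : V -> 'rV[K]_m) (u v : V -> 'rV[K]_n) x t :
  (forall y w, linear (B y w : _ -> K^o)) ->
  (forall y w, linear (B y ^~ w : _ -> K^o)) ->
  (forall w z, differentiable (fun y => B y w z) (p x)) ->
  differentiable p x -> differentiable u x -> differentiable v x ->
  differentiable (fun y => B (p y) (u y) (v y)) x /\
  'D_t (fun y => B (p y) (u y) (v y)) x =
    'D_('D_t p x) (fun y => B y (u x) (v x)) (p x) +
    B (p x) ('D_t u x) (v x) + B (p x) (u x) ('D_t v x).
Proof.
move=> Bl Br BC pC uC vC.
have dc w z : differentiable (fun y => B (p y) w z) x.
  exact: (@differentiable_comp _ _ _ _ p (fun y => B y w z)).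
have d1 z := @derive_family1 _ _ _ (fun y w => B (p y) w z) u x t
  (fun y => Br (p y) z) (fun j => dc _ z) uC.
have [dd ->] := @derive_family1 _ _ _ (fun y w => B (p y) (u y) w) v x t
  (fun y => Bl (p y) (u y)) (fun j => (d1 _).1) vC.
split; first exact: dd.
rewrite (d1 (v x)).2; congr (_ + _ + _).
rewrite deriveE // (_ : (fun y => _) = (fun y => B y (u x) (v x)) \o p) //.
by rewrite diff_comp //= !deriveE.
Qed.

Lemma Ck_at_endo m k (L : 'rV[K]_m -> 'rV[K]_n -> 'rV[K]_n)
    (p : V -> 'rV[K]_m) (u : V -> 'rV[K]_n) x :
  (forall y, linear (L y)) ->
  (forall j, Ck_at k (fun y => L y (delta_mx 0 j)) (p x)) ->
  Ck_at k p x -> Ck_at k u x -> Ck_at k (fun y => L (p y) (u y)) x.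
Proof.
move=> Ll LC pC uC; apply/Ck_at_coord => i.
apply: (@Ck_at_family1 _ _ _ _ (fun y w => L (p y) w 0 i)) => // [y a w z|j].
  by rewrite Ll !mxE.
apply/(Ck_at_coord _ (fun y => L (p y) (delta_mx 0 j)) _).1.
exact: (@Ck_at_comp _ _ _ _ _ (fun y => L y (delta_mx 0 j))).
Qed.

Lemma derive_endo m (L : 'rV[K]_m -> 'rV[K]_n -> 'rV[K]_n)
    (p : V -> 'rV[K]_m) (u : V -> 'rV[K]_n) x t :
  (forall y, linear (L y)) ->
  (forall w, differentiable (fun y => L y w) (p x)) ->
  differentiable p x -> differentiable u x ->
  differentiable (fun y => L (p y) (u y)) x /\
  'D_t (fun y => L (p y) (u y)) x =
    'D_('D_t p x) (fun y => L y (u x)) (p x) + L (p x) ('D_t u x).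
Proof.
move=> Ll LC pC uC.
have dc w : differentiable (fun y => L (p y) w) x.
  exact: (@differentiable_comp _ _ _ _ p (fun y => L y w)).
have dcj w i : differentiable (fun y => L (p y) w 0 i : K) x.
  exact: (differentiable_comp (dc w) (differentiable_coord _ _ _)).
have dL i := @derive_family1 _ _ _ (fun y w => L (p y) w 0 i) u x t.
have dd : differentiable (fun y => L (p y) (u y)) x.
  rewrite (_ : (fun y => _) = \sum_j (fun y => L (p y) (u y) 0 j *: delta_mx 0 j)).
    apply: differentiable_sum => i; apply: differentiableZl.
    by apply: (dL i _ _ _).1 => // y a w z; rewrite Ll !mxE.
  by apply/funext => y; rewrite fct_sumE -row_sum_delta.
split=> //; apply/rowP => i; rewrite derive_coord // (dL i _ _ _).2 //; last first.
  by move=> y a w z; rewrite Ll !mxE.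
rewrite mxE; congr (_ + _).
rewrite -derive_coord // deriveE // (_ : (fun y => _) = (fun y => L y (u x)) \o p) //.
by rewrite diff_comp //= !deriveE.
Qed.

End BilinearFamilies.

(** * Complex coordinates *)

Section ComplexCoordinates.
Variable R : realType.
Local Notation C := (R[i]).
Local Notation CF := (R[i] : numFieldType).

Lemma toRK n : cancel (@toR R n) (@ofR R n).
Proof.
move=> z; apply/rowP => j; rewrite mxE row_mxKl row_mxKr !mxE.
by case: (z 0 j).
Qed.

Lemma ofRK n : cancel (@ofR R n) (@toR R n).
Proof.
move=> x; rewrite /toR -[RHS]hsubmxK.
by congr row_mx; apply/rowP => j; rewrite !mxE.
Qed.

Lemma toR_additive n : {morph @toR R n : u v / u + v}.
Proof.
move=> u v; rewrite /toR add_row_mx; congr row_mx; apply/rowP => j.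
  by rewrite !mxE; case: (u 0 j) (v 0 j) => ? ? [].
by rewrite !mxE; case: (u 0 j) (v 0 j) => ? ? [].
Qed.

Lemma toRZ n (c : C) (u : 'rV[C]_n) :
  toR (c *: u) = complex.Re c *: toR u + complex.Im c *: stdJ (toR u).
Proof.
rewrite /toR /stdJ row_mxKl row_mxKr !scale_row_mx add_row_mx.
congr row_mx; apply/rowP => j; rewrite !mxE; case: c (u 0 j) => a b [x y] /=.
  by rewrite mulrN.
by [].
Qed.

Lemma ofR_additive n : {morph @ofR R n : u v / u + v}.
Proof. by move=> u v; apply: (can_inj (@toRK n)); rewrite toR_additive !ofRK. Qed.

Lemma toR0 n : toR (0 : 'rV[C]_n) = 0.
Proof. by apply: (addrI (toR 0)); rewrite -toR_additive !addr0. Qed.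

Lemma stdJ_linear n : linear (@stdJ R n).
Proof.
move=> a u v; rewrite /stdJ scale_row_mx add_row_mx.
by congr row_mx; rewrite !linearP.
Qed.

Lemma stdJK n (v : 'rV[R]_(n + n)) : stdJ (stdJ v) = - v.
Proof.
by rewrite /stdJ row_mxKl row_mxKr -opp_row_mx hsubmxK.
Qed.

(** The constant 2 replaces the sharp square root of 2, which keeps later estimates rational. *)
Lemma complex_norm_le (z : C) (e : R) :
  `|complex.Re z| <= e -> `|complex.Im z| <= e -> `|z| <= (2 * e)%:C.
Proof.
move=> ze1 ze2; rewrite normc_def lecR.
have e0 : 0 <= e by apply: le_trans ze1.
rewrite -(@ger0_norm _ (2 * e)) ?mulr_ge0 // -sqrtr_sqr ler_wsqrtr //.
rewrite -(real_normK (num_real (complex.Re z))) -(real_normK (num_real (complex.Im z))).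
move: ze1 ze2 (normr_ge0 (complex.Re z)) (normr_ge0 (complex.Im z)).
move: `|_| `|_| => a b ze1 ze2 a0 b0.
have := ler_pM a0 a0 ze1 ze1; have := ler_pM b0 b0 ze2 ze2.
rewrite -!expr2 => H1 H2; rewrite exprMn.
have := sqr_ge0 e; nra.
Qed.

Lemma Re_norm_le (z : C) : `|complex.Re z| <= complex.Re `|z|.
Proof.
rewrite normc_def /= -sqrtr_sqr ler_wsqrtr //.
by rewrite lerDl sqr_ge0.
Qed.

Lemma Im_norm_le (z : C) : `|complex.Im z| <= complex.Re `|z|.
Proof.
rewrite normc_def /= -sqrtr_sqr ler_wsqrtr //.
by rewrite lerDr sqr_ge0.
Qed.

Lemma rV_norm_le (K : numDomainType) n (u : 'rV[K]_n) (e : K) : 0 <= e ->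
  (forall j, `|u 0 j| <= e) -> `|u| <= e.
Proof.
move=> e0 ue; rewrite [`|u|]mx_normE.
have -> : e = (NngNum e0)%:num by [].
rewrite num_le; apply/bigmax_leP; split=> [|ij _]; first by rewrite -num_le /=.
by rewrite -num_le /=; move: ij => [i j] /=; rewrite ord1.
Qed.

Lemma rV_coord_norm_le (K : numDomainType) n (u : 'rV[K]_n) j : `|u 0 j| <= `|u|.
Proof.
rewrite [leRHS]mx_normE -[leLHS]nngE num_le.
exact: (le_bigmax _ (fun ij : 'I_1 * 'I_n => `|u ij.1 ij.2|%:nng) (0, j)).
Qed.

Lemma toR_norm_le n (u : 'rV[C]_n) : (`|toR u|)%:C <= `|u|.
Proof.
have u0 : 0 <= `|u| by [].
have Eu : (complex.Re `|u|)%:C = `|u| by rewrite RRe_real // ger0_real.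
rewrite -Eu lecR; apply: rV_norm_le => [|j]; first by rewrite -ler0c Eu.
have H (j' : 'I_n) : complex.Re `|u 0 j'| <= complex.Re `|u|.
  by have := rV_coord_norm_le u j'; rewrite lecE => /andP[].
by case: (split_ordP j) => i ->; rewrite ?row_mxEl ?row_mxEr mxE;
  apply: le_trans (H i); [exact: Re_norm_le|exact: Im_norm_le].
Qed.

Lemma ofR_norm_le n (y : 'rV[R]_(n + n)) : `|ofR y| <= (2 * `|y|)%:C.
Proof.
apply: rV_norm_le => [|j]; first by rewrite ler0c mulr_ge0.
by rewrite mxE; apply: complex_norm_le => /=; rewrite mxE; exact: rV_coord_norm_le.
Qed.

(** The two norms take values in different fields, so the radii d and e have different types; this
    form allows direct estimates between real and complex row vectors. *)
Lemma continuous_eps_delta (K1 K2 : numFieldType) (V : normedModType K1)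
    (W : normedModType K2) (f : V -> W) x :
  (forall e, 0 < e -> exists2 d, 0 < d &
    forall y, `|x - y| < d -> `|f x - f y| < e) ->
  {for x, continuous f}.
Proof.
move=> H; apply/cvgrPdist_lt => e /H[d d0 dP].
by apply/nbhs_ballP; exists d => // y; rewrite -ball_normE; exact: dP.
Qed.

Lemma toR_continuous n :
  continuous (@toR R n : ('rV[C]_n : normedModType C) -> ('rV[R]_(n + n) : normedModType R)).
Proof.
move=> u; apply: continuous_eps_delta => e e0.
exists e%:C => [|v uv]; first by rewrite ltcR.
rewrite -ltcR; apply: le_lt_trans uv; apply: le_trans (toR_norm_le _).
rewrite lecR toR_additive (_ : toR (- v) = - toR v) //.
by apply: (addrI (toR v)); rewrite -toR_additive !subrr toR0.
Qed.

Lemma ofR_continuous n :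
  continuous (@ofR R n : ('rV[R]_(n + n) : normedModType R) -> ('rV[C]_n : normedModType C)).
Proof.
move=> u; apply: continuous_eps_delta => e e0.
have Ee : e = (complex.Re e)%:C by rewrite RRe_real // gtr0_real.
have e0R : 0 < complex.Re e by rewrite -ltcR -Ee.
exists (complex.Re e / 2) => [|v uv]; first by rewrite divr_gt0.
rewrite (_ : ofR u - ofR v = ofR (u - v)); last first.
  by apply/eqP; rewrite subr_eq -ofR_additive subrK.
apply: le_lt_trans (ofR_norm_le _) _.
by rewrite [ltRHS]Ee ltcR -ltr_pdivlMl // mulrC.
Qed.

(** The two equations say D_{Jw}(u + i v) = i D_w(u + i v); with [toRZ] they upgrade real linearity
    to complex linearity. *)
Lemma cauchy_riemann_linear n (u v : 'rV[R]_(n + n) -> R) (x : 'rV[R]_(n + n)) :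
  differentiable u x -> differentiable v x ->
  (forall w, 'D_(stdJ w) u x = - 'D_w v x) ->
  (forall w, 'D_(stdJ w) v x = 'D_w u x) ->
  linear (fun w : 'rV[CF]_n => ('D_(toR w) u x +i* 'D_(toR w) v x : C^o)).
Proof.
move=> du dv CR1 CR2.
have Du w : 'D_w u x = 'd u x w := deriveE w du.
have Dv w : 'D_w v x = 'd v x w := deriveE w dv.
move=> [a b] w z; rewrite toR_additive toRZ.
have -> p q : 'D_(a *: p + b *: stdJ p + q) u x = a * 'D_p u x - b * 'D_p v x + 'D_q u x.
  by rewrite (Du (_ + _)) !linearD !linearZ /= -!Du CR1 [_ *: - _]mulrN.
have -> p q : 'D_(a *: p + b *: stdJ p + q) v x = a * 'D_p v x + b * 'D_p u x + 'D_q v x.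
  by rewrite (Dv (_ + _)) !linearD !linearZ /= -!Dv CR2.
by apply/eqP; rewrite eq_complex /= !eqxx.
Qed.

(** The real first-order expansions of u and v combine into one expansion of f, whose linear part is
    complex linear by the previous lemma. *)
Lemma cauchy_riemann n (f : 'rV[CF]_n -> C^o) (x : 'rV[CF]_n)
    (u := fun y => complex.Re (f (ofR y)) : R)
    (v := fun y => complex.Im (f (ofR y)) : R) :
  differentiable u (toR x) -> differentiable v (toR x) ->
  (forall w, 'D_(stdJ w) u (toR x) = - 'D_w v (toR x)) ->
  (forall w, 'D_(stdJ w) v (toR x) = 'D_w u (toR x)) ->
  differentiable f x /\
  forall w, 'd f x w = 'D_(toR w) u (toR x) +i* 'D_(toR w) v (toR x).
Proof.
move=> du dv CR1 CR2.
pose L (w : 'rV[CF]_n) : C^o := 'D_(toR w) u (toR x) +i* 'D_(toR w) v (toR x).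
have Ll : linear L by exact: cauchy_riemann_linear.
have Lc : continuous L by exact: rV_linear_continuous.
pose LM := GRing.isLinear.Build _ _ _ _ _ Ll.
pose LL : {linear _ -> _} := HB.pack L LM.
suff [df Ef] : is_diff x f LL by split=> // w; rewrite Ef.
apply: is_diff_eps => // e e0.
have Ee : e = (complex.Re e)%:C by rewrite RRe_real // gtr0_real.
have e0R : 0 < complex.Re e by rewrite -ltcR -Ee.
(* Half of the tolerance, because [complex_norm_le] doubles the bound. *)
have e2 : 0 < complex.Re e / 2 by rewrite divr_gt0.
have /eqaddoP/(_ _ e2) Hu := diff_locally du.
have /eqaddoP/(_ _ e2) Hv := diff_locally dv.
have toR0c : toR h @[h --> (0 : 'rV[CF]_n)] --> (0 : 'rV[R]_(n + n)).
  by have := @toR_continuous n 0; rewrite /continuous_at toR0.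
have {}Hu : \forall h \near (0 : 'rV[CF]_n),
    `|u (toR h + toR x) - (u (toR x) + 'd u (toR x) (toR h))| <= complex.Re e / 2 * `|toR h|.
  exact: toR0c _ Hu.
have {}Hv : \forall h \near (0 : 'rV[CF]_n),
    `|v (toR h + toR x) - (v (toR x) + 'd v (toR x) (toR h))| <= complex.Re e / 2 * `|toR h|.
  exact: toR0c _ Hv.
have Du w : 'D_w u (toR x) = 'd u (toR x) w := deriveE w du.
have Dv w : 'D_w v (toR x) = 'd v (toR x) w := deriveE w dv.
have Eu z : u (toR z) = complex.Re (f z) by rewrite /u toRK.
have Ev z : v (toR z) = complex.Im (f z) by rewrite /v toRK.
have ELu w : 'd u (toR x) (toR w) = complex.Re (LL w) by rewrite -Du.
have ELv w : 'd v (toR x) (toR w) = complex.Im (LL w) by rewrite -Dv.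
have ReB (p q r : C) : 
      complex.Re (p - q - r) = complex.Re p - (complex.Re q + complex.Re r).
  by case: p q r => ? ? [? ?] [? ?] /=; rewrite opprD addrA.
have ImB (p q r : C) : 
      complex.Im (p - q - r) = complex.Im p - (complex.Im q + complex.Im r).
  by case: p q r => ? ? [? ?] [? ?] /=; rewrite opprD addrA.
clearbody u v LL.
apply: filterS2 Hu Hv => h.
rewrite -toR_additive (Eu (h + x)) (Eu x) (Ev (h + x)) (Ev x) ELu ELv -ReB -ImB => hu hv.
apply: le_trans (complex_norm_le hu hv) _.
have -> : (2 * (complex.Re e / 2 * `|toR h|))%:C = e * (`|toR h|)%:C.
  by rewrite [in RHS]Ee -rmorphM; congr (_%:C); field.
by apply: ler_wpM2l; [exact: ltW|exact: toR_norm_le].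
Qed.

(** The case of one variable at 0, in the form in which [Omega0] takes its derivative; the direction
    [row_mx 1%:M 0] is d/d(Re z). *)
Lemma complex_derivative0 (F : C^o -> C^o)
    (u := fun y : 'rV[R]_(1 + 1) => complex.Re (F (ofR y 0 0)) : R)
    (v := fun y : 'rV[R]_(1 + 1) => complex.Im (F (ofR y 0 0)) : R) :
  differentiable u 0 -> differentiable v 0 ->
  (forall w, 'D_(stdJ w) u 0 = - 'D_w v 0) ->
  (forall w, 'D_(stdJ w) v 0 = 'D_w u 0) ->
  is_derive (0 : C^o) (1 : C^o) F
    ('D_(row_mx 1%:M 0) u 0 +i* 'D_(row_mx 1%:M 0) v 0).
Proof.
rewrite -(toR0 1) => du dv CR1 CR2.
have [df Ef] := @cauchy_riemann 1 (fun w : 'rV[CF]_1 => F (w 0 0)) 0 du dv CR1 CR2.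
have D : derivable _ _ (const_mx 1) := diff_derivable df.
have E : (fun h : C => h^-1 *: (((fun w : 'rV[CF]_1 => F (w 0 0)) \o shift 0) (h *: const_mx 1) - F ((0 : 'rV[C]_1) 0 0))) =
         (fun h : C => h^-1 *: ((F \o shift (0 : C^o)) (h *: (1 : C^o)) - F 0)).
  by apply/funext => h /=; rewrite !mxE.
apply: DeriveDef; first by move: D; rewrite /derivable E.
have := deriveE (const_mx 1) df; rewrite /derive E => ->.
rewrite Ef (_ : toR (const_mx 1) = row_mx 1%:M 0) //.
by rewrite /toR; congr row_mx; apply/rowP => j; rewrite !ord1 !mxE.
Qed.

End ComplexCoordinates.

(** * Charts *)

Section Charts.
Variables (K : numFieldType) (n : nat) (M : charted K n).
Hypothesis hM : is_manifold M.
Variable V : normedModType K.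
Implicit Types (p q r : M) (f : V -> M).

Lemma near_chart p q : cdom p q ->
  \forall y \near chart p q, cdom p (cinv p y) /\ chart p (cinv p y) = y.
Proof.
move=> pq; have : nbhs (chart p q) (chart p @` cdom p).
  by apply: open_nbhs_nbhs; split; [exact: mfd_img_open|exists q].
by apply: filterS => _ [r pr <-]; rewrite (mfd_inv hM).
Qed.

Lemma chart_comp_near f p x : {for x, continuous f} -> cdom p (f x) ->
  \forall y \near x, cdom p (f y).
Proof.
move=> fc pf; apply: fc; apply: open_nbhs_nbhs; split=> //; exact: mfd_dom_open.
Qed.

Lemma diff_chart_change f p q x : {for x, continuous f} ->
  cdom p (f x) -> cdom q (f x) -> differentiable (chart p \o f) x ->
  differentiable (chart q \o f) x /\
  forall v, 'd (chart q \o f) x v =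
    'd (chart q \o cinv p) (chart p (f x)) ('d (chart p \o f) x v).
Proof.
move=> fc pf qf df.
have E : \forall y \near x, ((chart q \o cinv p) \o (chart p \o f)) y = (chart q \o f) y.
  by apply: filterS (chart_comp_near fc pf) => y py /=; rewrite (mfd_inv hM).
have dt : differentiable (chart q \o cinv p) (chart p (f x)).
  exact: (@Ck_at_differentiable _ _ _ 0 _ _ (mfd_transition hM pf qf 1)).
have dc : differentiable ((chart q \o cinv p) \o (chart p \o f)) x.
  exact: differentiable_comp.
split; first exact: near_eq_differentiable E dc.
by move=> v; apply: (etrans (near_eq_diff v E dc)); exact: (diff_compE v df dt).
Qed.

End Charts.

Section Frames.
Variables (R : realType) (n : nat) (M : charted R n).
Hypothesis hM : is_manifold M.
Implicit Types (p q r : M).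

Lemma frame_linear p y : linear (@frame R n M p y).
Proof. by move=> a u v; rewrite /frame linearP. Qed.

Lemma coframe_linear p q : linear (@coframe R n M p q).
Proof. by move=> a u v; rewrite /coframe linearP. Qed.

Lemma frameE p q v : cdom p q ->
  frame p (chart p q) v = 'd (chart q \o cinv p) (chart p q) v.
Proof. by move=> pq; rewrite /frame (mfd_inv hM). Qed.

(** The change-of-chart rule is applied to the map [cinv p], from p to q and back to p. The result
    is the differential of [chart p \o cinv p], which is the identity near [chart p r]. *)
Lemma transitionK p q r v : cdom p r -> cdom q r ->
  'd (chart p \o cinv q) (chart q r) ('d (chart q \o cinv p) (chart p r) v) = v.
Proof.
move=> pr qr.
have ci : {for chart p r, continuous (cinv p)} by exact: mfd_inv_cont.
have Ei := mfd_inv hM pr.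
have dp : differentiable (chart p \o cinv p) (chart p r).
  apply: (@near_eq_differentiable _ _ _ id) => //.
  by apply: filterS (near_chart hM pr) => y [_ /= ->].
have pr' : cdom p (cinv p (chart p r)) by rewrite Ei.
have qr' : cdom q (cinv p (chart p r)) by rewrite Ei.
have [dq Eq] := diff_chart_change hM ci pr' qr' dp.
have [_ Ep] := diff_chart_change hM ci qr' pr' dq.
have I : \forall y \near chart p r, y = (chart p \o cinv p) y.
  by apply: filterS (near_chart hM pr) => y [_ /= ->].
rewrite Ei in Ep.
have Epv := Ep v.
have di := @is_diff_id _ _ (chart p r).
have Eid : 'd (chart p \o cinv p) (chart p r) v = v.
  by rewrite (near_eq_diff v I (@ex_diff _ _ _ _ _ _ _ di)) diff_val.
rewrite -[RHS]Eid; exact: esym Epv.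
Qed.

Lemma coframeK p q v : cdom p q -> coframe p q (frame p (chart p q) v) = v.
Proof.
by move=> pq; rewrite frameE // /coframe transitionK //; exact: mfd_mem.
Qed.

Lemma frameK p q v : cdom p q -> frame p (chart p q) (coframe p q v) = v.
Proof.
by move=> pq; rewrite frameE // /coframe transitionK //; exact: mfd_mem.
Qed.

Lemma coframe_id p v : coframe p p v = v.
Proof.
have pp := mfd_mem hM p.
have I : \forall y \near chart p p, y = (chart p \o cinv p) y.
  by apply: filterS (near_chart hM pp) => y [_ /= ->].
apply: (etrans (near_eq_diff v I _)) => //.
by have [_ ->] := @is_diff_id _ _ (chart p p).
Qed.

Lemma frame_id p v : frame p (chart p p) v = v.
Proof.
by rewrite -[RHS](coframe_id p) -{2}(frameK v (mfd_mem hM p)) !coframe_id.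
Qed.

Variable V : normedModType R.
Implicit Types f : V -> M.

(** Compares the derivative read in a fixed chart p with the one read in the preferred chart of the
    image point, where tangent vectors live. *)
Lemma diff_to_frame f p x : {for x, continuous f} -> cdom p (f x) ->
  differentiable (chart p \o f) x ->
  differentiable (chart (f x) \o f) x /\
  forall v, 'd (chart (f x) \o f) x v =
    frame p (chart p (f x)) ('d (chart p \o f) x v).
Proof.
move=> fc pf df; have [D E] := diff_chart_change hM fc pf (mfd_mem hM _) df.
by split=> [|v]; [exact: D|exact: etrans (E v) (esym (frameE _ pf))].
Qed.

Lemma diff_to_coframe f p x : {for x, continuous f} -> cdom p (f x) ->
  differentiable (chart (f x) \o f) x ->
  differentiable (chart p \o f) x /\
  forall v, 'd (chart p \o f) x v = coframe p (f x) ('d (chart (f x) \o f) x v).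
Proof. by move=> fc pf df; apply: diff_chart_change => //; exact: mfd_mem. Qed.

End Frames.

(** * The projective line *)

Section Lines.
Variables (K : numFieldType) (V V' W : normedModType K).

(** A directional derivative only sees the restriction to one line. This moves partial derivatives
    between a joint map and its slices. *)
Lemma derive_line (f : V -> W) (g : V' -> W) x y v w :
  (forall h : K, f (h *: v + x) = g (h *: w + y)) -> 'D_v f x = 'D_w g y.
Proof.
move=> fg; have fg0 : f x = g y by have := fg 0; rewrite !scale0r !add0r.
rewrite /derive; set d := (fun _ : K => _); set d' := (fun _ : K => _).
by suff -> : d = d' by []; apply/funext => h; rewrite /d /d' /= fg fg0.
Qed.

Lemma is_diff_row_mx m n (f : V -> 'rV[K]_m) (g : V -> 'rV[K]_n) x :
  differentiable f x -> differentiable g x ->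
  differentiable (fun y => row_mx (f y) (g y)) x /\
  forall v, 'd (fun y => row_mx (f y) (g y)) x v = row_mx ('d f x v) ('d g x v).
Proof.
move=> df dg.
pose A (u : 'rV[K]_m) := row_mx u (0 : 'rV[K]_n).
pose B (u : 'rV[K]_n) := row_mx (0 : 'rV[K]_m) u.
have Al : linear A by move=> a u v; rewrite /A scale_row_mx add_row_mx scaler0 addr0.
have Bl : linear B by move=> a u v; rewrite /B scale_row_mx add_row_mx scaler0 addr0.
have [dA EA] := linear_is_diff (f x) Al (rV_linear_continuous Al).
have [dB EB] := linear_is_diff (g x) Bl (rV_linear_continuous Bl).
have dAf : differentiable (A \o f) x by exact: differentiable_comp.
have dBg : differentiable (B \o g) x by exact: differentiable_comp.
have E : (fun y => row_mx (f y) (g y)) = (A \o f) + (B \o g).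
  by apply/funext => y; rewrite !fctE /= /A /B add_row_mx addr0 add0r.
rewrite E; split=> [|v]; first exact: differentiableD.
rewrite diffD // -[LHS]/('d (A \o f) x v + 'd (B \o g) x v).
have e1 := etrans (diff_compE v df dA) (congr1 (@^~ _) EA).
have e2 := etrans (diff_compE v dg dB) (congr1 (@^~ _) EB).
apply: etrans (congr2 +%R e1 e2) _.
by rewrite /A /B add_row_mx addr0 add0r.
Qed.

End Lines.

Section ProjectiveLine.
Variable R : realType.
Local Notation C := (R[i]).
Local Notation CF := (R[i] : numFieldType).
Local Notation P1 := (P1 R).
Implicit Types (p q : P1).

(** Both affine charts are onto, so the identity holds at every y; in the chart at infinity, y = 0
    is the point [None]. *)
Lemma P1_chartK p (y : 'rV[R]_(1 + 1)) : chart p (cinv p y) = y.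
Proof.
rewrite -[RHS]ofRK /=; congr toR; apply/rowP => j; rewrite !ord1 mxE.
case: p => [z|] //=; case: eqP => [->//|_]; exact: invrK.
Qed.

Lemma P1_cdom_cinv p (y : 'rV[R]_(1 + 1)) : cdom p (cinv p y).
Proof.
case: p => [z|] //=; case: eqP => [_|h] //= [] /eqP.
by rewrite invr_eq0 => /eqP.
Qed.

Lemma P1_mem p : cdom p p.
Proof. by case: p. Qed.

Lemma P1_cinvK p q : cdom p q -> cinv p (chart p q) = q.
Proof.
rewrite /= toRK; case: p q => [z|] [w|] //= h; rewrite !mxE //.
  by rewrite invr_eq0; case: eqP => [w0|_]; [case: h; rewrite w0|rewrite invrK].
by rewrite eqxx.
Qed.

Lemma cinv_finite_continuous (y : 'rV[R]_(1 + 1)) :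
  {for y, continuous (fun y => Some (ofR y 0 0) : Defs.P1 R)}.
Proof.
apply: (@continuous_comp _ _ _ (fun y : 'rV[R]_(1 + 1) => ofR y 0 0 : C^o)
  (Some : C^o -> one_point_compactification (C^o : topologicalType))).
  have H : {for y, continuous ((fun u : 'rV[CF]_1 => u 0 0 : CF) \o (@ofR R 1 : 'rV[R]_(1 + 1) -> 'rV[CF]_1))}.
    apply: continuous_comp.
      exact: ofR_continuous.
    exact: coord_continuous.
  exact: H.
exact: one_point_compactification_some_continuous.
Qed.

(** In real coordinates 1/z is (x - i y) / (x^2 + y^2). *)
Lemma inv_transition_Ck k (y : 'rV[R]_(1 + 1)) : y != 0 ->
  Ck_at k (fun y : 'rV[R]_(1 + 1) => toR (const_mx (ofR y 0 0)^-1 : 'rV[C]_1)) y.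
Proof.
move=> y0.
pose N (y : 'rV[R]_(1 + 1)) := lsubmx y 0 0 * lsubmx y 0 0 + rsubmx y 0 0 * rsubmx y 0 0.
have cl : Ck_at k (fun y : 'rV[R]_(1 + 1) => lsubmx y 0 0) y.
  apply: ((Ck_at_coord k (fun y : 'rV[R]_(1 + 1) => lsubmx y) y).1 _ 0).
  by apply: Ck_at_lsubmx; exact: Ck_at_id.
have cr : Ck_at k (fun y : 'rV[R]_(1 + 1) => rsubmx y 0 0) y.
  apply: ((Ck_at_coord k (fun y : 'rV[R]_(1 + 1) => rsubmx y) y).1 _ 0).
  by apply: Ck_at_rsubmx; exact: Ck_at_id.
have N0 : N y != 0.
  apply: contra y0; rewrite /N -!expr2 paddr_eq0 ?sqr_ge0 // !sqrf_eq0 => /andP[/eqP a /eqP b].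
  by apply/eqP; rewrite -[y]hsubmxK -[RHS]row_mx0; congr row_mx; apply/rowP => j;
    rewrite !ord1 ?a ?b !mxE.
have cN : Ck_at k (fun y => (N y)^-1) y.
  by apply: Ck_at_inv => //; apply: Ck_at_add; apply: Ck_at_mul.
apply: Ck_at_row_mx; apply/Ck_at_coord => j.
  rewrite (_ : (fun y => _) = fun y => lsubmx y 0 0 * (N y)^-1).
    by apply: Ck_at_mul; [exact: cl|exact: cN].
  by apply/funext => z; rewrite /N !mxE /= !expr2.
rewrite (_ : (fun y => _) = fun y => (- 1 * rsubmx y 0 0) * (N y)^-1).
  apply: Ck_at_mul; last exact: cN.
  by apply: Ck_at_mul; [exact: Ck_at_cst|exact: cr].
by apply/funext => z; rewrite /N !mxE /= !expr2 mulN1r mulNr.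
Qed.

Lemma toR_const_continuous :
  continuous (fun z : C^o => toR (const_mx z : 'rV[C]_1) : 'rV[R]_(1 + 1)).
Proof.
move=> z; apply: (@continuous_eps_delta CF R (C^o) 'rV[R]_(1 + 1)) => e e0.
exists e%:C => [|w zw]; first by rewrite ltcR.
rewrite -ltcR; apply: le_lt_trans zw.
have -> : toR (const_mx z) - toR (const_mx w) = toR (const_mx (z - w) : 'rV[C]_1).
  apply/eqP; rewrite subr_eq -toR_additive; apply/eqP; congr toR.
  by apply/rowP => j; rewrite !mxE subrK.
apply: le_trans (toR_norm_le _) _.
by apply: rV_norm_le => // j; rewrite mxE.
Qed.

(** The only delicate point is the centre of the chart at infinity: there a neighbourhood is the
    complement of a compact set of finite points, and a small ball around 0 has to avoid that set.
    Elsewhere the map is [Some] composed with 1/z. *)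
Lemma P1_cinv_continuous p : continuous (cinv p : 'rV[R]_(1 + 1) -> P1).
Proof.
case: p => [z|] y; first exact: cinv_finite_continuous.
have [y0|y0] := eqVneq y 0; last first.
  pose f (y : 'rV[R]_(1 + 1)) := toR (const_mx (ofR y 0 0)^-1 : 'rV[C]_1).
  have H : {for y, continuous ((fun y => Some (ofR y 0 0) : Defs.P1 R) \o f)}.
    apply: continuous_comp; last exact: cinv_finite_continuous.
    exact: (@Ck_at_continuous _ _ _ 0 _ _ (inv_transition_Ck 0 y0)).
  have ny (u : 'rV[R]_(1 + 1)) : u != 0 -> ofR u 0 0 == 0 = false.
    move=> u0; apply: contra_neqF u0 => /eqP h.
    rewrite -[u]ofRK -[RHS](toR0 R 1); congr toR; apply/rowP => j.
    by rewrite ord1 h mxE.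
  have E u : u != 0 -> Some (ofR (f u) 0 0) = cinv (None : P1) u :> P1.
    by move=> u0; rewrite /= ny // /f toRK mxE.
  rewrite /continuous_at -(E _ y0).
  have nE : \forall u \near y, ((fun y => Some (ofR y 0 0) : Defs.P1 R) \o f) u = cinv (None : P1) u.
    apply/nbhs_ballP; exists `|y|; first by rewrite /= normr_gt0.
    move=> u; rewrite -ball_normE /= => uy; apply: E.
    by apply: contraTneq uy => ->; rewrite subr0 ltxx.
  exact: (cvg_trans (near_eq_cvg nE) H).
rewrite y0.
have E0 : cinv (None : P1) 0 = None by rewrite /= !mxE /= eqxx.
rewrite /continuous_at E0 => U [K [cK _] KU].
have /compact_bounded[B [_ HB]] := @continuous_compact _ _ _ K
  (continuous_subspaceT toR_const_continuous) cK.
pose B1 := `|B| + 1.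
have B10 : 0 < B1 by rewrite /B1 ltr_wpDl.
have BB1 : B < B1 by rewrite /B1 (le_lt_trans (ler_norm _)) // ltrDl.
have := HB _ BB1 => {}HB.
(* If z = 1/u lies in the compact set, then |z| <= 2 B1 and |1/z| <= 2 |u|, hence 1 <= 4 B1 |u|;
   this radius excludes such u. *)
have d0 : 0 < (4 * B1)^-1 by rewrite invr_gt0 mulr_gt0.
apply/nbhs_ballP; exists (4 * B1)^-1 => // u; rewrite -ball_normE /= sub0r normrN => ud.
apply: KU; rewrite /=; case: eqP => [_|/eqP h]; first by right.
left; exists (ofR u 0 0)^-1 => // Kz.
have := HB (toR (const_mx (ofR u 0 0)^-1)) (ex_intro2 _ _ _ Kz erefl).
set z := _^-1 => zB.
have z1 : `|z| <= (2 * B1)%:C.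
  have := rV_coord_norm_le (ofR (toR (const_mx z : 'rV[C]_1))) 0.
  rewrite {1}toRK mxE => /le_trans; apply.
  by apply: le_trans (ofR_norm_le _) _; rewrite lecR ler_pM2l.
have z2 : `|z^-1| <= (2 * `|u|)%:C.
  by rewrite /z invrK; apply: le_trans (rV_coord_norm_le _ _) (ofR_norm_le _).
have : `|z| * `|z^-1| <= (2 * B1)%:C * (2 * `|u|)%:C by apply: ler_pM.
rewrite -normrM divff ?normr1; last by rewrite /z invr_eq0.
rewrite -rmorphM lecR leNgt => /negP; apply.
have -> : 2 * B1 * (2 * `|u|) = `|u| * (4 * B1) by ring.
by rewrite -ltr_pdivlMr ?mulr_gt0 // div1r.
Qed.

Lemma P1_transition p q : cdom p q ->
  differentiable (chart p \o cinv q : 'rV[R]_(1 + 1) -> 'rV[R]_(1 + 1)) (chart q q).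
Proof.
case: p q => [z|] [w|] //.
- move=> _; rewrite (_ : _ \o _ = id) //.
  by apply/funext => y; exact: (P1_chartK (Some w)).
- move=> w0; apply: (@Ck_at_differentiable _ _ _ 0).
  apply: inv_transition_Ck; apply/eqP => /(congr1 (@ofR R 1)).
  by rewrite /= toRK => /rowP/(_ 0); rewrite !mxE => h; case: w0; rewrite h.
- move=> _; rewrite (_ : _ \o _ = id) //.
  by apply/funext => y; exact: (P1_chartK None).
Qed.

End ProjectiveLine.

(** * Sections of the twistor space *)

Section Sections.
Variables (R : realType) (n : nat) (M : charted R n).
Hypothesis hM : is_manifold M.
Variables (I J K : M -> {linear 'rV[R]_n -> 'rV[R]_n}).
Local Notation P1 := (P1 R).
Local Notation T := ('rV[R]_n).
Implicit Types (p q : P1) (sg : P1 -> M) (b : 'rV[R]_(1 + 1)).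

Definition graph_of sg : P1 -> Z M := fun p => (p, sg p).

Lemma section_graph (s : P1 -> Z M) : (forall p, varpi (s p) = p) ->
  s = graph_of (fun p => (s p).2).
Proof. by move=> h; apply/funext => p; rewrite /graph_of -{2}(h p) -surjective_pairing. Qed.

(** In charts [varpi] is the projection [lsubmx], a continuous linear map and so its own
    differential. *)
Lemma verticalE (z : Z M) v : vertical z v <-> lsubmx v = 0.
Proof.
rewrite /vertical /tmap.
have -> : (@chart R _ P1 (@varpi R n M z) \o @varpi R n M \o @cinv R _ (Z M) z) =
  (fun x => lsubmx x) :> ('rV[R]_(1 + 1 + n) -> 'rV[R]_(1 + 1)).
  by apply/funext => x; exact: P1_chartK.
have lc := rV_linear_continuous (@lsubmx_linear R (1 + 1) n).
by have [_ ->] := linear_is_diff (@chart R _ (Z M) z z) (@lsubmx_linear R (1 + 1) n) lc.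
Qed.

Lemma smooth_graph sg : smooth_map (graph_of sg) ->
  continuous sg /\
  forall p, smooth_at (chart (sg p) \o sg \o cinv p) (chart p p).
Proof.
move=> [sc sC]; split.
  move=> p; apply: (@continuous_comp _ _ _ (graph_of sg) (snd : P1 * M -> M)).
    exact: sc.
  exact: cvg_snd.
move=> p k; have := Ck_at_rsubmx (sC p k); congr Ck_at.
by apply/funext => y /=; rewrite row_mxKr.
Qed.

Definition sloc sg p : 'rV[R]_(1 + 1) -> T := chart (sg p) \o sg \o cinv p.

Lemma tmap_graph sg p b : smooth_map (graph_of sg) ->
  tmap (graph_of sg) p b = row_mx b ('d (sloc sg p) (chart p p) b).
Proof.
move=> /smooth_graph[_ /(_ p 1) /(@Ck_at_differentiable _ _ _ 0) ds].
rewrite /tmap.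
have -> : chart (graph_of sg p) \o graph_of sg \o cinv p = fun y => row_mx y (sloc sg p y).
  by apply/funext => y /=; congr row_mx; exact: P1_chartK.
have di := @is_diff_id _ _ (chart p p).
have [_ E] := @is_diff_row_mx _ _ _ _ id (sloc sg p) (chart p p) (@ex_diff _ _ _ _ _ _ _ di) ds.
by rewrite (E b) diff_val.
Qed.

(** This is the M-component of the equation ds o i = JZ ds; the P1-component of a graph is the
    identity. *)
Lemma holomorphic_graph sg p b : is_section I J K (graph_of sg) ->
  'd (sloc sg p) (chart p p) (stdJ b) =
  Isphere I J K p (sg p) ('d (sloc sg p) (chart p p) b).
Proof.
move=> [[ss sh] _]; have := sh p b; rewrite !tmap_graph // /JZ row_mxKl row_mxKr.
by move=> /eq_row_mx[].
Qed.

Lemma near_section sg p : continuous sg ->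
  \forall y \near chart p p, cdom (sg p) (sg (cinv p y)).
Proof.
move=> sc; apply: (@chart_comp_near _ _ _ hM _ (sg \o cinv p)).
  by apply: continuous_comp; [exact: P1_cinv_continuous|exact: sc].
rewrite (_ : (sg \o cinv p) _ = sg p); first exact: (mfd_mem hM).
by rewrite /comp (P1_cinvK (P1_mem p)).
Qed.

Lemma Z_transition (z w : Z M) (x v : 'rV[R]_(1 + 1 + n)) :
  differentiable (chart z.1 \o cinv w.1) (lsubmx x) ->
  differentiable (chart z.2 \o cinv w.2) (rsubmx x) ->
  'd (chart z \o cinv w : 'rV[R]_(1 + 1 + n) -> 'rV[R]_(1 + 1 + n)) x v =
  row_mx ('d (chart z.1 \o cinv w.1) (lsubmx x) (lsubmx v))
         ('d (chart z.2 \o cinv w.2) (rsubmx x) (rsubmx v)).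
Proof.
move=> d1 d2.
have lc := rV_linear_continuous (@lsubmx_linear R (1 + 1) n).
have rc := rV_linear_continuous (@rsubmx_linear R (1 + 1) n).
have [l1 l2] := linear_is_diff x (@lsubmx_linear R (1 + 1) n) lc.
have [r1 r2] := linear_is_diff x (@rsubmx_linear R (1 + 1) n) rc.
have [_ E] := is_diff_row_mx (differentiable_comp l1 d1) (differentiable_comp r1 d2).
apply: etrans (E _) _; congr row_mx.
  exact: etrans (diff_compE v l1 d1) (congr1 _ (congr1 (@^~ v) l2)).
exact: etrans (diff_compE v r1 d2) (congr1 _ (congr1 (@^~ v) r2)).
Qed.

Lemma P1_chart_id p :
  chart p \o cinv p = (fun y => y) :> ('rV[R]_(1 + 1) -> 'rV[R]_(1 + 1)).
Proof. by apply/funext => z; exact: P1_chartK. Qed.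

Lemma P1_transition_differentiable p (y : 'rV[R]_(1 + 1)) :
  differentiable (chart p \o cinv p : 'rV[R]_(1 + 1) -> 'rV[R]_(1 + 1)) y.
Proof. by rewrite P1_chart_id; exact: ex_diff. Qed.

Lemma P1_transition_id p (y b : 'rV[R]_(1 + 1)) :
  'd (chart p \o cinv p : 'rV[R]_(1 + 1) -> 'rV[R]_(1 + 1)) y b = b.
Proof. by rewrite P1_chart_id; have [_ ->] := @is_diff_id _ _ y. Qed.

Lemma Z_coframe (p q : Z M) v : cdom p.1 q.1 -> cdom p.2 q.2 ->
  coframe p q (row_mx 0 v) = row_mx 0 (coframe p.2 q.2 v).
Proof.
move=> h1 h2.
have d1 := P1_transition h1.
have d2 : differentiable (chart p.2 \o cinv q.2) (chart q.2 q.2).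
  exact: (@Ck_at_differentiable _ _ _ 0 _ _ (mfd_transition hM (mfd_mem hM q.2) h2 1)).
apply: etrans (Z_transition _ _ _) _; rewrite ?row_mxKl ?row_mxKr //.
congr row_mx; exact: linear0.
Qed.

(** The vertical part of V over all points near p, read in the single chart at [sg p], so that it
    can be differentiated as a map into a fixed space. *)
Definition vloc sg (V : P1 -> 'rV[R]_(1 + 1 + n)) p y : T :=
  coframe (sg p) (sg (cinv p y)) (rsubmx (V (cinv p y))).

Hypotheses (hI : smooth_endo (fun m => I m)) (hJ : smooth_endo (fun m => J m))
  (hK : smooth_endo (fun m => K m)).

Lemma locE_linear (L : M -> {linear T -> T}) m y : linear (locE (fun m => L m) m y).
Proof. by move=> a u v; rewrite /locE frame_linear linearP coframe_linear. Qed.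

Lemma Isphere_linear p m : linear (Isphere I J K p m).
Proof.
move=> a u v; rewrite /Isphere !linearP; apply/rowP => j; rewrite !mxE; ring.
Qed.

Lemma locE_Isphere p m x v : locE (Isphere I J K p) m x v =
  (sphere p).1.1 *: locE (fun m => I m) m x v
  + (sphere p).1.2 *: locE (fun m => J m) m x v
  + (sphere p).2 *: locE (fun m => K m) m x v.
Proof. by rewrite /locE /Isphere /coframe !linearD !linearZ. Qed.

Lemma locE_Isphere_linear p m y : linear (locE (Isphere I J K p) m y).
Proof. by move=> a u v; rewrite /locE frame_linear Isphere_linear coframe_linear. Qed.

Lemma locE_Isphere_smooth p m v :
  smooth_at (fun y => locE (Isphere I J K p) m y v) (chart m m).
Proof.
move=> k; rewrite (_ : (fun y => _) = fun x => (sphere p).1.1 *: locE (fun m => I m) m x v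
  + (sphere p).1.2 *: locE (fun m => J m) m x v
  + (sphere p).2 *: locE (fun m => K m) m x v); last first.
  by apply/funext => x; exact: locE_Isphere.
have H (c : R) (L : M -> {linear T -> T}) : smooth_endo (fun m => L m) ->
    Ck_at k (fun x => c *: locE (fun m => L m) m x v) (chart m m).
  move=> hL; have sl : linear (fun u : T => c *: u).
    by move=> a u w; rewrite scalerDr !scalerA mulrC.
  exact: (Ck_at_linear_comp sl (rV_linear_continuous sl) (hL m v k)).
by apply: Ck_at_add; [apply: Ck_at_add|]; exact: H.
Qed.

(** With the P1-coordinate frozen at p, [JZ] is block diagonal in the product chart. This slice
    suffices later, because vertical vectors leave the P1-coordinate fixed. *)
Lemma locE_JZ sg p x b w : cdom (sg p) (cinv (sg p) x) -> chart (sg p) (cinv (sg p) x) = x ->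
  @locE R _ (Z M) (JZ I J K) (graph_of sg p) (row_mx (chart p p) x) (row_mx b w) =
  row_mx (stdJ b) (locE (Isphere I J K p) (sg p) x w).
Proof.
move=> xd xc; rewrite /locE.
set m := cinv (sg p) x.
have Eq : @cinv _ _ (Z M) (graph_of sg p) (row_mx (chart p p) x) = (p, m).
  by rewrite /= row_mxKl row_mxKr; congr pair; exact: (P1_cinvK (P1_mem p)).
have dm : differentiable (chart m \o cinv (sg p)) x.
  by rewrite -xc; exact: (@Ck_at_differentiable _ _ _ 0 _ _ (mfd_transition hM xd (mfd_mem hM m) 1)).
have dm' : differentiable (chart (sg p) \o cinv m) (chart m m).
  exact: (@Ck_at_differentiable _ _ _ 0 _ _ (mfd_transition hM (mfd_mem hM m) xd 1)).
have -> : @frame R _ (Z M) (graph_of sg p) (row_mx (chart p p) x) (row_mx b w) =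
    row_mx b (frame (sg p) x w).
  rewrite /frame Eq; apply: etrans (Z_transition _ _ _) _.
  - by rewrite row_mxKl; exact: P1_transition_differentiable.
  - by rewrite row_mxKr.
  rewrite !row_mxKl !row_mxKr; congr row_mx.
  exact: P1_transition_id.
rewrite Eq /JZ row_mxKl row_mxKr /coframe; apply: etrans (Z_transition _ _ _) _.
- by rewrite row_mxKl; exact: P1_transition_differentiable.
- by rewrite row_mxKr.
rewrite !row_mxKl !row_mxKr; congr row_mx.
exact: P1_transition_id.
Qed.

End Sections.

(** * Holomorphy of vertical fields along a section *)

Section HolomorphicAlong.
Variables (R : realType) (n : nat) (M : charted R n).
Hypothesis hM : is_manifold M.
Variables (I J K : M -> {linear 'rV[R]_n -> 'rV[R]_n}).
Hypotheses (hI : smooth_endo (fun m => I m)) (hJ : smooth_endo (fun m => J m))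
  (hK : smooth_endo (fun m => K m)).
Local Notation P1 := (P1 R).
Variables (sg : P1 -> M) (p : P1).
Hypothesis hs : is_section I J K (graph_of sg).

Lemma diff_locE_JZ b w v :
  'D_(row_mx 0 v) (fun x => @locE R _ (Z M) (JZ I J K) (graph_of sg p) x (row_mx b w))
    (@chart R _ (Z M) (graph_of sg p) (graph_of sg p)) =
  row_mx 0 ('D_v (fun x => locE (Isphere I J K p) (sg p) x w) (chart (sg p) (sg p))).
Proof.
pose F x := @locE R _ (Z M) (JZ I J K) (graph_of sg p) (row_mx (chart p p) x) (row_mx b w).
have -> : 'D_(row_mx 0 v) (fun x => @locE R _ (Z M) (JZ I J K) (graph_of sg p) x (row_mx b w))
    (@chart R _ (Z M) (graph_of sg p) (graph_of sg p)) = 'D_v F (chart (sg p) (sg p)).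
  apply: derive_line => h.
  apply: (congr1 (fun z => @locE R _ (Z M) (JZ I J K) (graph_of sg p) z (row_mx b w))).
  by rewrite scale_row_mx add_row_mx scaler0 add0r.
have nF : \forall x \near chart (sg p) (sg p),
    F x = row_mx (stdJ b) (locE (Isphere I J K p) (sg p) x w).
  by apply: filterS (near_chart hM (mfd_mem hM (sg p))) => x [xd xc]; exact: locE_JZ.
apply: etrans (near_eq_derive v nF) _.
have d := @Ck_at_differentiable _ _ _ 0 _ _ (locE_Isphere_smooth hI hJ hK p (sg p) w 1).
have dc := @differentiable_cst R 'rV[R]_n 'rV[R]_(1 + 1) (stdJ b) (chart (sg p) (sg p)).
have [D E] := is_diff_row_mx dc d.
apply: etrans (deriveE v D) _; apply: etrans (E v) _.
by congr row_mx; [rewrite diff_cst|rewrite deriveE].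
Qed.

Lemma vloc_near V : (\forall y \near chart p p, lsubmx (V (cinv p y)) = 0) ->
  \forall y \near chart p p, row_mx 0 (vloc sg V p y) =
    @coframe R _ (Z M) (graph_of sg p) (graph_of sg (cinv p y)) (V (cinv p y)).
Proof.
have [sc _] := smooth_graph hs.1.1.
move=> Vv; near=> y.
have V0 : lsubmx (V (cinv p y)) = 0 by near: y.
have yd : cdom (sg p) (sg (cinv p y)) by near: y; exact: near_section.
rewrite -(hsubmxK (V (cinv p y))) V0 Z_coframe //=; last exact: P1_cdom_cinv.
Unshelve. all: by end_near. Qed.

(** For V vertical near p both sides of the linearized equation have zero P1-component, and [JZ] is
    differentiated with the point of P1 frozen at p. What remains is an equation in the tangent
    space of M at [sg p]. *)
Lemma holomorphic_alongE V : (\forall y \near chart p p, lsubmx (V (cinv p y)) = 0) ->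
  holomorphic_along_at I J K (graph_of sg) V p <->
  smooth_at (vloc sg V p) (chart p p) /\
  forall b, 'D_(stdJ b) (vloc sg V p) (chart p p) =
    Isphere I J K p (sg p) ('D_b (vloc sg V p) (chart p p))
    + 'D_(rsubmx (V p)) (fun x => locE (Isphere I J K p) (sg p) x
        ('d (sloc sg p) (chart p p) b)) (chart (sg p) (sg p)).
Proof.
move=> Vv; have nV := vloc_near Vv.
pose W y := @coframe R _ (Z M) (graph_of sg p) (graph_of sg (cinv p y)) (V (cinv p y)).
have V0 : lsubmx (V p) = 0.
  by have := nbhs_singleton Vv; rewrite (P1_cinvK (P1_mem p)).
have Vp : V p = row_mx 0 (rsubmx (V p)) by rewrite -{1}(hsubmxK (V p)) V0.
have sE : smooth_at W (chart p p) <-> smooth_at (vloc sg V p) (chart p p).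
  split=> sW k.
    apply: (@Ck_at_near _ _ _ _ (fun y => rsubmx (W y))).
      by apply: filterS nV => y e; rewrite /W -e row_mxKr.
    exact/Ck_at_rsubmx.
  apply: (Ck_at_near nV); apply: Ck_at_row_mx; last exact: sW.
  exact: Ck_at_cst.
have DW : smooth_at (vloc sg V p) (chart p p) -> forall b,
    'D_b W (chart p p) = row_mx 0 ('D_b (vloc sg V p) (chart p p)).
  move=> sV b; apply: etrans (esym (near_eq_derive b nV)) _.
  have d := @Ck_at_differentiable _ _ _ 0 _ _ (sV 1).
  have dc := @differentiable_cst R 'rV[R]_(1 + 1) 'rV[R]_(1 + 1) 0 (chart p p).
  have [D E] := is_diff_row_mx dc d.
  apply: etrans (deriveE b D) _; apply: etrans (E b) _.
  by congr row_mx; [rewrite diff_cst|rewrite deriveE].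
have RH (sV : smooth_at (vloc sg V p) (chart p p)) b :
    JZ I J K (graph_of sg p) ('D_b W (chart p p)) +
    'D_(V p) (fun x => @locE R _ (Z M) (JZ I J K) (graph_of sg p) x (tmap (graph_of sg) p b))
          (@chart R _ (Z M) (graph_of sg p) (graph_of sg p)) =
    row_mx 0 (Isphere I J K p (sg p) ('D_b (vloc sg V p) (chart p p))
    + 'D_(rsubmx (V p)) (fun x => locE (Isphere I J K p) (sg p) x
        ('d (sloc sg p) (chart p p) b)) (chart (sg p) (sg p))).
  rewrite (DW sV b) /JZ row_mxKl row_mxKr (tmap_graph p b hs.1.1).
  have D1 := diff_locE_JZ b ('d (sloc sg p) (chart p p) b) (rsubmx (V p)).
  rewrite -Vp in D1; apply: etrans (congr1 (+%R _) D1) _.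
  rewrite add_row_mx addr0; congr row_mx.
  by rewrite /stdJ !linear0 row_mx0.
split=> -[sV CR].
  have sV' := sE.1 sV; split=> // b.
  have := CR b; rewrite (RH sV' b) (DW sV' _).
  by move=> /eq_row_mx[].
split=> [|b]; first exact: sE.2.
by rewrite (RH sV b) (DW sV _) CR.
Qed.

End HolomorphicAlong.

(** * The hyperkaehler forms *)

Section HyperkaehlerAlgebra.
Variables (R : realType) (n : nat) (M : charted R n) (g : M -> 'M[R]_n).
Variables (I J K : M -> {linear 'rV[R]_n -> 'rV[R]_n}).
Hypothesis hk : is_hyperkaehler g I J K.
Local Notation C := (R[i]).
Local Notation P1 := (P1 R).
Local Notation T := ('rV[R]_n).
Implicit Types (m : M) (v w : T).

Lemma gform_linearl m w : linear (gform g m ^~ w : T -> R^o).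
Proof.
by move=> a u v; rewrite /gform mulmxDl mulmxDl -scalemxAl -scalemxAl !mxE.
Qed.

Lemma gform_linearr m v : linear (gform g m v : T -> R^o).
Proof.
by move=> a u w; rewrite /gform linearP /= mulmxDr -scalemxAr !mxE.
Qed.

Lemma gformC m v w : gform g m v w = gform g m w v.
Proof. by have [_ h _] := hk_metric hk. Qed.

Lemma gform_nondegenerate m v : (forall w, gform g m v w = 0) -> v = 0.
Proof.
have [_ _ h] := hk_metric hk.
move=> v0; apply/eqP; apply: contraT => /(h m).
by rewrite v0 ltxx.
Qed.

Lemma kform_linearl (L : M -> {linear T -> T}) m w : linear (kform g L m ^~ w : T -> R^o).
Proof. by move=> a u v; rewrite /kform linearP gform_linearl. Qed.

Lemma kform_linearr (L : M -> {linear T -> T}) m v : linear (kform g L m v : T -> R^o).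
Proof. exact: gform_linearr. Qed.

Lemma gformDl m u v w : gform g m (u + v) w = gform g m u w + gform g m v w.
Proof. by rewrite /gform !mulmxDl mxE. Qed.

Lemma gformNl m v w : gform g m (- v) w = - gform g m v w.
Proof. by rewrite /gform !mulNmx mxE. Qed.

Lemma gformZl m (c : R) v w : gform g m (c *: v) w = c * gform g m v w.
Proof. by rewrite /gform -!scalemxAl mxE. Qed.

Lemma kform_anti (L : M -> {linear T -> T}) m v w : is_kaehler g L ->
  kform g L m v w = - kform g L m w v.
Proof.
move=> hL; rewrite /kform (gformC _ (L m w)) -(kaehler_hermitian hL m v (L m w)).
by rewrite (kaehler_square hL) (gformC _ (L m v) (- w)) gformNl opprK gformC.
Qed.

Let II m v : I m (I m v) = - v. Proof. exact: kaehler_square (hk_I hk) _ _. Qed.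
Let JJ m v : J m (J m v) = - v. Proof. exact: kaehler_square (hk_J hk) _ _. Qed.
Let KK m v : K m (K m v) = - v. Proof. exact: kaehler_square (hk_K hk) _ _. Qed.
Let IJ m v : I m (J m v) = K m v. Proof. exact: hk_IJ hk _ _. Qed.
Let JI m v : J m (I m v) = - K m v. Proof. exact: hk_JI hk _ _. Qed.
Let IK m v : I m (K m v) = - J m v. Proof. by rewrite -IJ II. Qed.
Let KI m v : K m (I m v) = J m v. Proof. by rewrite -IJ JI linearN IK opprK. Qed.
Let KJ m v : K m (J m v) = - I m v. Proof. by rewrite -IJ JJ linearN. Qed.
Let JK m v : J m (K m v) = I m v. Proof. by rewrite -IJ JI KJ opprK. Qed.

Lemma sphere_norm (p : P1) :
  (sphere p).1.1 ^+ 2 + (sphere p).1.2 ^+ 2 + (sphere p).2 ^+ 2 = 1.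
Proof.
case: p => [[u v]|] /=; last by rewrite sqrrN expr1n !expr0n !addr0.
field.
by apply: lt0r_neq0; rewrite -addrA ltr_pwDl // addr_ge0 ?sqr_ge0.
Qed.

(** The quaternion relations cancel the mixed terms and leave minus the squared norm of the point of
    the sphere. *)
Lemma IsphereK p m v : Isphere I J K p m (Isphere I J K p m v) = - v.
Proof.
rewrite /Isphere !linearD !linearZ /= II JJ KK IJ JI IK KI KJ JK.
have := sphere_norm p; move: (sphere p) => [[x1 x2] x3] /= N.
apply/rowP => j; rewrite !mxE.
move: (I m v 0 j) (J m v 0 j) (K m v 0 j) (v 0 j) => a b c e.
transitivity (- (x1 ^+ 2 + x2 ^+ 2 + x3 ^+ 2) * e); first by ring.
by rewrite N mulN1r.
Qed.

Lemma kformJK_I m v w : kformJK g J K m (I m v) w = Ci R * kformJK g J K m v w.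
Proof.
rewrite /kformJK /kform JI KI gformNl; apply/eqP.
by rewrite eq_complex /= !(mul0r, mul1r, add0r, addr0, sub0r) !eqxx.
Qed.

Lemma twformE (z : C) m v w (u := complex.Re z) (t := complex.Im z) :
  twform g I J K z m v w =
    ((1 + u ^+ 2 - t ^+ 2) * kform g J m v w - 2 * t * kform g I m v w
       + 2 * u * t * kform g K m v w) +i*
    ((1 - u ^+ 2 + t ^+ 2) * kform g K m v w + 2 * u * kform g I m v w
       + 2 * u * t * kform g J m v w).
Proof.
rewrite /twform /kformJK {}/u {}/t; case: z => u t /=.
apply/eqP; rewrite eq_complex /= expr2 /=.
by apply/andP; split; apply/eqP; ring.
Qed.

Lemma kformDl (L : M -> {linear T -> T}) m u v w :
  kform g L m (u + v) w = kform g L m u w + kform g L m v w.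
Proof. by rewrite /kform linearD gformDl. Qed.

Lemma kformZl (L : M -> {linear T -> T}) m (c : R) v w :
  kform g L m (c *: v) w = c * kform g L m v w.
Proof. by rewrite /kform linearZ gformZl. Qed.

(** Both sides expand over g(Iv, w), g(Jv, w), g(Kv, w), g(v, w) with coefficients rational in Re z
    and Im z, of denominator 1 + |z|^2, and these coefficients agree. So [twform z] has type (2,0)
    for the fibre over z. *)
Lemma twform_Isphere (z : C) m v w :
  twform g I J K z m (Isphere I J K (P1pt z) m v) w = Ci R * twform g I J K z m v w.
Proof.
rewrite !twformE; case: z => u t /=.
rewrite /Isphere /= !(kformDl, kformZl) /kform II JJ KK IJ JI IK KI KJ JK !gformNl.
move: (gform g m (I m v) w) (gform g m (J m v) w) (gform g m (K m v) w) (gform g m v w)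
  => a b c e.
have N0 : 1 + u ^+ 2 + t ^+ 2 != 0.
  by apply: lt0r_neq0; rewrite -addrA ltr_pwDl // addr_ge0 ?sqr_ge0.
apply/eqP; rewrite eq_complex /=; apply/andP; split; apply/eqP; field; exact: N0.
Qed.

Lemma twform_anti (z : C) m v w :
  twform g I J K z m v w = - twform g I J K z m w v.
Proof.
rewrite !twformE (kform_anti m v w (hk_I hk)) (kform_anti m v w (hk_J hk)).
rewrite (kform_anti m v w (hk_K hk)).
by apply/eqP; rewrite eq_complex /=; apply/andP; split; apply/eqP; ring.
Qed.

Lemma twformDl (z : C) m u v w :
  twform g I J K z m (u + v) w = twform g I J K z m u w + twform g I J K z m v w.
Proof.
rewrite !twformE !kformDl.
by apply/eqP; rewrite eq_complex /=; apply/andP; split; apply/eqP; ring.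
Qed.

Lemma twformZl (z : C) m (c : R) v w :
  twform g I J K z m (c *: v) w = c%:C * twform g I J K z m v w.
Proof.
rewrite !twformE !kformZl.
by apply/eqP; rewrite eq_complex /=; apply/andP; split; apply/eqP; ring.
Qed.

Lemma kformJK_twform m v w : kformJK g J K m v w = twform g I J K 0 m v w.
Proof. by rewrite /twform mulr0 !mul0r expr2 mul0r mul0r !addr0. Qed.

(** The real part alone is g(J v, .), which determines J v and hence v. *)
Lemma kformJK_nondegenerate m v : (forall w, kformJK g J K m v w = 0) -> v = 0.
Proof.
move=> h; have J0 : J m v = 0.
  by apply: (@gform_nondegenerate m) => w; have := congr1 (@complex.Re R) (h w).
by apply/eqP; rewrite -oppr_eq0 -(JJ m) J0 linear0.
Qed.

Variables (a : C -> M -> M) (z : C) (m : M).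
Hypotheses (ha : is_hk_circle_action g I J K a) (z1 : `|z| = 1).

Lemma unit_complexE : complex.Re z ^+ 2 + complex.Im z ^+ 2 = 1.
Proof. by apply: complexI; rewrite add_Re2_Im2 z1 expr1n. Qed.

(** An isometry has injective differential, and the dimensions agree. This lets vectors at [a z m]
    be tested against images [tmap (a z) m v]. *)
Lemma action_surjective w : exists v, tmap (a z) m v = w.
Proof.
pose A := lin1_mx (tmap (a z) m).
have AE v : v *m A = tmap (a z) m v by exact: mul_rV_lin1.
have uA : A \in unitmx.
  rewrite -row_free_unit -kermx_eq0; apply/eqP/row_matrixP => i; rewrite row0.
  set v := row i _.
  have v0 : tmap (a z) m v = 0 by rewrite -AE -row_mul mulmx_ker row0.
  apply: (@gform_nondegenerate m) => u.
  by rewrite -(hka_isometric ha m v u z1) v0 /gform !mul0mx mxE.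
by exists (w *m invmx A); rewrite -AE mulmxKV.
Qed.

(** The weight-one rule expresses g(J dv, dw) + i g(K dv, dw) at the image point as z (g(Jv, w) + i
    g(Kv, w)). Isometry moves the right side to the image point, and nondegeneracy of g strips off
    dw. *)
Lemma action_JK v :
  J (a z m) (tmap (a z) m v) =
    tmap (a z) m (complex.Re z *: J m v - complex.Im z *: K m v) /\
  K (a z m) (tmap (a z) m v) =
    tmap (a z) m (complex.Im z *: J m v + complex.Re z *: K m v).
Proof.
split; apply/eqP; rewrite -subr_eq0; apply/eqP; apply: (@gform_nondegenerate (a z m)) => u;
  have [w <-] := action_surjective u; rewrite gformDl gformNl (hka_isometric ha _ _ _ z1);
  have := hka_weight ha m v w z1; rewrite /kformJK /kform; case: (z) => x y /= [e1 e2].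
  rewrite e1 gformDl gformNl !gformZl. exact: subrr.
rewrite e2 gformDl !gformZl addrC; ring.
Qed.

(** Since x_2 + i x_3 is -2i times the affine coordinate over 1 + its squared modulus, a rotation of
    the coordinate rotates (x_2, x_3) and leaves x_1 alone. *)
Lemma sphere_actP1 (p : P1) :
  [/\ (sphere (actP1 z p)).1.1 = (sphere p).1.1,
      (sphere (actP1 z p)).1.2 =
        complex.Re z * (sphere p).1.2 - complex.Im z * (sphere p).2 &
      (sphere (actP1 z p)).2 =
        complex.Im z * (sphere p).1.2 + complex.Re z * (sphere p).2].
Proof.
have := unit_complexE; case: p => [[u t]|] /=; last by rewrite !mulr0 subrr addr0.
case: (z) => x y /= N.
have -> : 1 + (x * u - y * t) ^+ 2 + (x * t + y * u) ^+ 2 = 1 + u ^+ 2 + t ^+ 2.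
  transitivity (1 + (x ^+ 2 + y ^+ 2) * (u ^+ 2 + t ^+ 2)); first by ring.
  by rewrite N mul1r addrA.
have -> : 1 - (x * u - y * t) ^+ 2 - (x * t + y * u) ^+ 2 = 1 - u ^+ 2 - t ^+ 2.
  transitivity (1 - (x ^+ 2 + y ^+ 2) * (u ^+ 2 + t ^+ 2)); first by ring.
  by rewrite N mul1r opprD addrA.
split=> //; ring.
Qed.

(** The rotation of (J, K) by the action and the rotation of the coefficients (x_2, x_3) cancel
    because |z| = 1. This is holomorphy of the induced action along the fibres of Z. *)
Lemma action_Isphere p v :
  tmap (a z) m (Isphere I J K p m v) =
  Isphere I J K (actP1 z p) (a z m) (tmap (a z) m v).
Proof.
have [E1 E2 E3] := sphere_actP1 p; have [EJ EK] := action_JK v.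
have N := unit_complexE.
have tD u w : tmap (a z) m (u + w) = tmap (a z) m u + tmap (a z) m w by exact: linearD.
have tN u : tmap (a z) m (- u) = - tmap (a z) m u by exact: linearN.
have tZ c u : tmap (a z) m (c *: u) = c *: tmap (a z) m u by exact: linearZ.
rewrite /Isphere E1 E2 E3 EJ EK -(hka_I ha m v z1) !(tD, tN, tZ).
move: (tmap _ _ (I m v)) (tmap _ _ (J m v)) (tmap _ _ (K m v)) => A B D.
move: (sphere p) (complex.Re z) (complex.Im z) N => [[x1 x2] x3] x y /= N.
apply/rowP => j; rewrite !mxE; move: (A 0 j) (B 0 j) (D 0 j) => {}A {}B {}D.
transitivity (x1 * A + (x ^+ 2 + y ^+ 2) * (x2 * B + x3 * D)); last by ring.
by rewrite N mul1r addrA.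
Qed.

End HyperkaehlerAlgebra.

(** * The forms omega_L in the chart at a point *)

Section LocalForms.
Variables (R : realType) (n : nat) (M : charted R n) (g : M -> 'M[R]_n).
Variables (I J K : M -> {linear 'rV[R]_n -> 'rV[R]_n}).
Hypothesis hk : is_hyperkaehler g I J K.
Let hM : is_manifold M := hk_manifold hk.
Local Notation T := ('rV[R]_n).
Variable m0 : M.
Local Notation c0 := (chart m0 m0).
Local Notation B L := (loc2 (kform g L) m0).

Lemma loc2_linearl (L : M -> {linear T -> T}) y w : linear (B L y ^~ w : T -> R^o).
Proof. by move=> a u v; rewrite /loc2 frame_linear kform_linearl. Qed.

Lemma loc2_linearr (L : M -> {linear T -> T}) y u : linear (B L y u : T -> R^o).
Proof. by move=> a v w; rewrite /loc2 frame_linear kform_linearr. Qed.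

Lemma loc2_base (L : M -> {linear T -> T}) u v : B L c0 u v = kform g L m0 u v.
Proof. by rewrite /loc2 (mfd_inv hM (mfd_mem hM m0)) !frame_id. Qed.

Lemma loc2_smooth (L : M -> {linear T -> T}) u v : is_kaehler g L ->
  smooth_at (fun y => B L y u v) c0.
Proof.
move=> hL k; have [gs _ _] := hk_metric hk.
apply: (@Ck_at_near _ _ _ _
  (fun y => loc2 (gform g) m0 y (locE (fun m => L m) m0 y u) v)).
  apply: filterS (near_chart hM (mfd_mem hM m0)) => y [yd yc].
  rewrite /loc2 /kform /locE; congr gform.
  by rewrite -{1}yc frameK.
apply: (@Ck_at_family2 _ _ _ _ _ (fun y u v => loc2 (gform g) m0 y u v) (fun y => y)) => //.
- by move=> y w a p q; rewrite /loc2 frame_linear gform_linearr.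
- by move=> y w a p q; rewrite /loc2 frame_linear gform_linearl.
- by move=> i j; exact: gs.
- exact: Ck_at_id.
- exact: (kaehler_smooth hL m0 u k).
- exact: Ck_at_cst.
Qed.

Lemma loc2_differentiable (L : M -> {linear T -> T}) u v : is_kaehler g L ->
  differentiable (fun y => B L y u v) c0.
Proof. by move=> hL; exact: (@Ck_at_differentiable _ _ _ 0 _ _ (loc2_smooth u v hL 1)). Qed.

Lemma loc2_closed (L : M -> {linear T -> T}) t u v : is_kaehler g L ->
  'D_t (fun y => B L y u v) c0 =
  'D_u (fun y => B L y t v) c0 - 'D_v (fun y => B L y t u) c0.
Proof.
move=> hL; have := kaehler_closed hL m0 t u v; rewrite /d2 => h.
by apply/eqP; rewrite -subr_eq0 opprB addrA addrAC; apply/eqP; rewrite -[RHS]h addrAC.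
Qed.

Local Notation Il := (locE (fun m => I m) m0).

Lemma locE_base v : Il c0 v = I m0 v.
Proof.
by rewrite /locE (mfd_inv hM (mfd_mem hM m0)) frame_id // coframe_id.
Qed.

Lemma locE_differentiable v : differentiable (fun y => Il y v) c0.
Proof.
exact: (@Ck_at_differentiable _ _ _ 0 _ _ (kaehler_smooth (hk_I hk) m0 v 1)).
Qed.

(* The identity omega_L(I., .) = e omega_L' differentiated in coordinates. *)
Lemma derive_type (L L' : M -> {linear T -> T}) (e : R) v u w :
  is_kaehler g L -> is_kaehler g L' ->
  (forall m u w, kform g L m (I m u) w = e * kform g L' m u w) ->
  'D_v (fun y => B L y (I m0 u) w) c0 + kform g L m0 ('D_v (fun y => Il y u) c0) w =
  e * 'D_v (fun y => B L' y u w) c0.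
Proof.
move=> hL hL' E.
have nE : \forall y \near c0, B L y (Il y u) w = e * B L' y u w.
  apply: filterS (near_chart hM (mfd_mem hM m0)) => y [yd yc].
  rewrite /loc2 -E /locE; congr kform.
  by rewrite -{1}yc frameK.
have di := @is_diff_id _ _ c0.
have [_ D] := @derive_family2 _ _ _ _ (B L) (fun y => y) (fun y => Il y u) (fun=> w) c0 v
  (loc2_linearr L) (loc2_linearl L) (fun p q => loc2_differentiable p q hL)
  (@ex_diff _ _ _ _ _ _ _ di) (locE_differentiable u) (differentiable_cst _ _).
have := near_eq_derive v nE.
rewrite -[X in X = _]/('D_v (fun y => B L y (Il y u) w) c0) D.
rewrite locE_base loc2_base derive_id.
have -> : B L c0 (I m0 u) ('D_v (fun=> w) c0) = 0.
  by rewrite loc2_base derive_cst /kform /gform trmx0 mulmx0 mxE.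
rewrite addr0 => ->.
have D2 := loc2_differentiable u w hL'.
have sl : linear (fun x : R => e * x : R^o).
  by move=> a x y; rewrite mulrDr /GRing.scale /= mulrCA.
rewrite (@derive_linear_comp _ _ _ _ (fun x : R => e * x : R^o) (fun y => B L' y u w)) //.
by apply: mulrl_continuous.
Qed.

End LocalForms.

(** * The symplectic form along a section *)

Section OmegaAlongSection.
Variables (R : realType) (n : nat) (M : charted R n) (g : M -> 'M[R]_n).
Variables (I J K : M -> {linear 'rV[R]_n -> 'rV[R]_n}).
Hypothesis hk : is_hyperkaehler g I J K.
Let hM : is_manifold M := hk_manifold hk.
Local Notation C := (R[i]).
Local Notation P1 := (P1 R).
Local Notation T := ('rV[R]_n).
Variable sg : P1 -> M.
Hypothesis hs : is_section I J K (graph_of sg).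
Local Notation p0 := (P1pt (0 : C)).
Local Notation m0 := (sg p0).
Local Notation c0 := (chart m0 m0).
Local Notation B L := (loc2 (kform g L) m0).
Local Notation Phi := (sloc sg p0).

Lemma chart_P1pt0 : @chart _ _ P1 p0 p0 = 0.
Proof.
by rewrite -(toR0 R 1) /=; congr toR; apply/rowP => j; rewrite !mxE.
Qed.

Lemma sloc_base : Phi 0 = c0.
Proof.
rewrite -chart_P1pt0.
exact: (congr1 (fun q => chart m0 (sg q)) (P1_cinvK (P1_mem p0))).
Qed.

Lemma Isphere_P1pt0 : Isphere I J K p0 = fun m => I m.
Proof.
apply/funext => m; apply/funext => v; rewrite /Isphere /=.
by rewrite !expr0n /= !mulr0 !subr0 !addr0 divr1 !mul0r oppr0 scale1r !scale0r !addr0.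
Qed.

Lemma sloc_smooth p : smooth_at (sloc sg p) (chart p p).
Proof. by have [_] := smooth_graph hs.1.1; apply. Qed.

Lemma sloc_differentiable0 : differentiable Phi 0.
Proof.
by have := @Ck_at_differentiable _ _ _ 0 _ _ (sloc_smooth p0 1); rewrite chart_P1pt0.
Qed.

Lemma sloc_holomorphic0 b : 'D_(stdJ b) Phi 0 = I m0 ('D_b Phi 0).
Proof.
have := holomorphic_graph p0 b hs; rewrite chart_P1pt0 Isphere_P1pt0.
by rewrite -!(deriveE _ sloc_differentiable0).
Qed.

(** The first-order content of holomorphy at z = 0, where the fibre carries the complex structure I;
    the computation of [Omega0] uses nothing else of V and W. *)
Definition holomorphic_at0 (V : P1 -> 'rV[R]_(1 + 1 + n)) :=
  differentiable (vloc sg V p0) 0 /\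
  forall b, 'D_(stdJ b) (vloc sg V p0) 0 = I m0 ('D_b (vloc sg V p0) 0) +
    'D_(rsubmx (V p0)) (fun x => locE (fun m => I m) m0 x ('D_b Phi 0)) c0.

Lemma holomorphic_along_at0 V :
  (\forall y \near (0 : 'rV[R]_(1 + 1)), lsubmx (V (cinv p0 y)) = 0) ->
  holomorphic_along_at I J K (graph_of sg) V p0 -> holomorphic_at0 V.
Proof.
rewrite -{1}chart_P1pt0 => Vv.
move=> /(holomorphic_alongE hM (kaehler_smooth (hk_I hk)) (kaehler_smooth (hk_J hk))
  (kaehler_smooth (hk_K hk)) hs Vv); rewrite chart_P1pt0 Isphere_P1pt0 => -[sV CR].
split=> [|b]; first exact: (@Ck_at_differentiable _ _ _ 0 _ _ (sV 1)).
by rewrite (deriveE b sloc_differentiable0); exact: CR.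
Qed.

Lemma vloc_base V : vloc sg V p0 0 = rsubmx (V p0).
Proof.
by rewrite /vloc -chart_P1pt0 (P1_cinvK (P1_mem p0)) coframe_id.
Qed.

Variables V W : P1 -> 'rV[R]_(1 + 1 + n).
Hypotheses (hV : holomorphic_at0 V) (hW : holomorphic_at0 W).
Local Notation vl := (vloc sg V p0).
Local Notation wl := (vloc sg W p0).
Local Notation v0 := (rsubmx (V p0)).
Local Notation w0 := (rsubmx (W p0)).

Definition pairing (L : M -> {linear T -> T}) (y : 'rV[R]_(1 + 1)) : R :=
  loc2 (kform g L) m0 (Phi y) (vl y) (wl y).

Lemma pairing_base L : pairing L 0 = kform g L m0 v0 w0.
Proof. by rewrite /pairing sloc_base !vloc_base (loc2_base hk). Qed.

Lemma derive_pairing L b : is_kaehler g L ->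
  differentiable (pairing L) 0 /\
  'D_b (pairing L) 0 = 'D_('D_b Phi 0) (fun y => B L y v0 w0) c0 +
    kform g L m0 ('D_b vl 0) w0 + kform g L m0 v0 ('D_b wl 0).
Proof.
move=> hL.
have dB u v : differentiable (fun y => B L y u v) (Phi 0).
  by rewrite sloc_base; exact: (loc2_differentiable hk).
have [D E] := @derive_family2 _ _ _ _ (B L) Phi vl wl 0 b
  (loc2_linearr g m0 L) (loc2_linearl g m0 L) dB sloc_differentiable0 hV.1 hW.1.
split; first exact: D.
by apply: etrans E _; rewrite sloc_base !vloc_base !(loc2_base hk).
Qed.

(** Along i b the base point moves in the direction I u, with u = ds(b). Closedness trades the
    derivative of omega_L in that direction for derivatives along V and W with I u in a slot, and
    [derive_type] turns those into derivatives of omega_L'. *)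
Lemma pairing_type (L L' : M -> {linear T -> T}) (e : R) b :
  is_kaehler g L -> is_kaehler g L' ->
  (forall m u w, kform g L m (I m u) w = e * kform g L' m u w) ->
  'D_(stdJ b) (pairing L) 0 = e * 'D_b (pairing L') 0.
Proof.
move=> hL hL' E.
rewrite (derive_pairing (stdJ b) hL).2 (derive_pairing b hL').2.
rewrite sloc_holomorphic0 hV.2 hW.2.
move: ('D_b Phi 0 : T) ('D_b vl 0 : T) ('D_b wl 0 : T) => u vb wb.
have An : forall x y, kform g L m0 x y = - kform g L m0 y x.
  by move=> x y; exact: (kform_anti hk m0 x y hL).
have Bn : forall x y, kform g L' m0 x y = - kform g L' m0 y x.
  by move=> x y; exact: (kform_anti hk m0 x y hL').
rewrite (loc2_closed m0 (I m0 u) v0 w0 hL) (loc2_closed m0 u v0 w0 hL').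
have Dv := derive_type hk m0 v0 u w0 hL hL' E.
have Dw := derive_type hk m0 w0 u v0 hL hL' E.
(* X and Y are the terms containing the derivative of I. They enter once through [derive_type] and
   once through the linearized holomorphy of V and W, and cancel. *)
have alg (P Q X Y P' Q' k k1 k2 k3 k4 : R) : P + X = e * P' -> Q + Y = e * Q' ->
    k1 = e * k + X -> k2 = - (e * k3 + Y) -> k4 = - k3 ->
    P - Q + k1 + k2 = e * (P' - Q' + k + k4).
  move=> h1 h2 -> -> ->; rewrite !mulrDr !mulrN -h1 -h2; ring.
apply: (alg _ _ _ _ _ _ _ _ _ _ _ Dv Dw _ _ (Bn _ _)).
  by rewrite kformDl E.
by rewrite (An v0) kformDl E.
Qed.

Lemma twform_section y : cdom m0 (sg (cinv p0 y)) ->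
  twform g I J K (ofR y 0 0) (sg (cinv p0 y)) (rsubmx (V (cinv p0 y))) (rsubmx (W (cinv p0 y)))
  = ((1 + (lsubmx y 0 0) ^+ 2 - (rsubmx y 0 0) ^+ 2) * pairing J y
        - 2 * (rsubmx y 0 0) * pairing I y + 2 * (lsubmx y 0 0) * (rsubmx y 0 0) * pairing K y) +i*
    ((1 - (lsubmx y 0 0) ^+ 2 + (rsubmx y 0 0) ^+ 2) * pairing K y
        + 2 * (lsubmx y 0 0) * pairing I y + 2 * (lsubmx y 0 0) * (rsubmx y 0 0) * pairing J y).
Proof.
move=> yd.
have E (L : M -> {linear T -> T}) : pairing L y =
    kform g L (sg (cinv p0 y)) (rsubmx (V (cinv p0 y))) (rsubmx (W (cinv p0 y))).
  have Es : cinv m0 (Phi y) = sg (cinv p0 y) := mfd_inv hM yd.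
  have fv : frame m0 (Phi y) (vl y) = rsubmx (V (cinv p0 y)) := frameK hM _ yd.
  have fw : frame m0 (Phi y) (wl y) = rsubmx (W (cinv p0 y)) := frameK hM _ yd.
  by rewrite /pairing /loc2 fv fw Es.
by rewrite !E twformE !mxE.
Qed.

Definition twform_along (z : C^o) : C^o :=
  twform g I J K z (sg (P1pt z)) (rsubmx (V (P1pt z))) (rsubmx (W (P1pt z))).

(** At z = 0 the terms quadratic in z contribute nothing to first order. The parts from omega_J and
    omega_K satisfy the Cauchy-Riemann equations by [pairing_type], and 2 i z omega_I contributes a
    linear term, so the complex derivative in [Omega0] exists. *)
Lemma twform_along_derive :
  is_derive (0 : C^o) (1 : C^o) twform_along
    ('D_(row_mx 1%:M 0) (pairing J) 0 +i*
     ('D_(row_mx 1%:M 0) (pairing K) 0 + 2 * kform g I m0 v0 w0)).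
Proof.
pose l (y : 'rV[R]_(1 + 1)) : R := lsubmx y 0 0.
pose r (y : 'rV[R]_(1 + 1)) : R := rsubmx y 0 0.
pose u (y : 'rV[R]_(1 + 1)) : R := complex.Re (twform_along (ofR y 0 0)).
pose v (y : 'rV[R]_(1 + 1)) : R := complex.Im (twform_along (ofR y 0 0)).
have l0 : l 0 = 0 by rewrite /l !mxE.
have r0 : r 0 = 0 by rewrite /r !mxE.
have ll : linear (l : _ -> R^o) by move=> x p q; rewrite /l !mxE.
have rl : linear (r : _ -> R^o) by move=> x p q; rewrite /r !mxE.
have dl : has_diff l 0 l := has_diff_linear 0 ll (rV_linear_continuous ll).
have dr : has_diff r 0 r := has_diff_linear 0 rl (rV_linear_continuous rl).
have dA L : is_kaehler g L -> has_diff (pairing L) 0 (fun b => 'D_b (pairing L) 0).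
  by move=> hL; split=> //; exact: (derive_pairing 0 hL).1.
have near0 : \forall y \near (0 : 'rV[R]_(1 + 1)), cdom m0 (sg (cinv p0 y)).
  have [sc _] := smooth_graph hs.1.1.
  by have := @near_section _ _ _ hM sg p0 sc; rewrite chart_P1pt0.
have hu : has_diff u 0 (fun b => 'D_b (pairing J) 0 - 2 * r b * pairing I 0).
  (* The term mirrors the polynomial in [twform_section]; differences are written with factors -1
     and -2 because the available rules are those for sums and products. *)
  have H := has_diff_add (has_diff_add (has_diff_mul
    (has_diff_add (has_diff_add (has_diff_cst 1 0) (has_diff_mul dl dl))
      (has_diff_mul (has_diff_cst (-1) 0) (has_diff_mul dr dr))) (dA J (hk_J hk)))
    (has_diff_mul (has_diff_mul (has_diff_cst (-2) 0) dr) (dA I (hk_I hk))))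
    (has_diff_mul (has_diff_mul (has_diff_mul (has_diff_cst 2 0) dl) dr) (dA K (hk_K hk))).
  apply: has_diff_near H _ _ => [|b].
    apply: filterS near0 => y yd; rewrite /u /twform_along (twform_section yd) /= /l /r.
    ring.
  rewrite l0 r0; ring.
have hv : has_diff v 0 (fun b => 'D_b (pairing K) 0 + 2 * l b * pairing I 0).
  have H := has_diff_add (has_diff_add (has_diff_mul
    (has_diff_add (has_diff_add (has_diff_cst 1 0) (has_diff_mul dr dr))
      (has_diff_mul (has_diff_cst (-1) 0) (has_diff_mul dl dl))) (dA K (hk_K hk)))
    (has_diff_mul (has_diff_mul (has_diff_cst 2 0) dl) (dA I (hk_I hk))))
    (has_diff_mul (has_diff_mul (has_diff_mul (has_diff_cst 2 0) dl) dr) (dA J (hk_J hk))).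
  apply: has_diff_near H _ _ => [|b].
    apply: filterS near0 => y yd; rewrite /v /twform_along (twform_section yd) /= /l /r.
    ring.
  rewrite l0 r0; ring.
have tJ b : 'D_(stdJ b) (pairing J) 0 = -1 * 'D_b (pairing K) 0.
  apply: (pairing_type _ (hk_J hk) (hk_K hk)) => m p q.
  have := congr1 (@complex.Re R) (kformJK_I hk m p q).
  by rewrite /= mul0r mul1r sub0r mulN1r.
have tK b : 'D_(stdJ b) (pairing K) 0 = 1 * 'D_b (pairing J) 0.
  apply: (pairing_type _ (hk_K hk) (hk_J hk)) => m p q.
  have := congr1 (@complex.Im R) (kformJK_I hk m p q).
  by rewrite /= mul0r add0r.
have lJ b : l (stdJ b) = - r b by rewrite /l /stdJ row_mxKl mxE.
have rJ b : r (stdJ b) = l b by rewrite /r /stdJ row_mxKr.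
have e1 : l (row_mx 1%:M 0) = 1 by rewrite /l row_mxKl mxE.
have e2 : r (row_mx 1%:M 0) = 0 by rewrite /r row_mxKr mxE.
have D := @complex_derivative0 R twform_along hu.1 hv.1.
rewrite -pairing_base.
have -> : 'D_(row_mx 1%:M 0) (pairing J) 0 = 'D_(row_mx 1%:M 0) u 0.
  by rewrite hu.2 e2 mulr0 mul0r subr0.
have -> : 'D_(row_mx 1%:M 0) (pairing K) 0 + 2 * pairing I 0 = 'D_(row_mx 1%:M 0) v 0.
  by rewrite hv.2 e1 mulr1.
apply: D => w.
  by rewrite hu.2 [in RHS]hv.2 tJ rJ mulN1r opprD.
by rewrite hv.2 [in RHS]hu.2 tK lJ mul1r mulrN mulNr.
Qed.

End OmegaAlongSection.

(** * The circle action *)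

Section UnitCircle.
Variable R : realType.
Local Notation C := (R[i]).
Implicit Types (s t : R) (z : C).

Lemma expi0 : expi (0 : R) = 1.
Proof. by rewrite /expi cos0 sin0. Qed.

Lemma expiD s t : expi (s + t) = expi s * expi t.
Proof.
rewrite /expi cosD sinD; apply/eqP; rewrite eq_complex /= eqxx /=.
by rewrite addrC (mulrC (sin s)) (mulrC (cos s)).
Qed.

Lemma expi_norm t : `|expi t| = 1.
Proof. by rewrite normc_def /= cos2Dsin2 sqrtr1. Qed.

Lemma expi_neq0 t : expi t != 0.
Proof. by rewrite -normr_eq0 expi_norm oner_eq0. Qed.

Lemma expiN t : expi (- t) = (expi t)^-1.
Proof.
by apply: (mulfI (expi_neq0 t)); rewrite divff ?expi_neq0 // -expiD subrr expi0.
Qed.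

Lemma expi_surjective z : `|z| = 1 -> exists t, z = expi t.
Proof.
move=> z1; have := unit_complexE z1; case: z z1 => x y z1 /= N.
have x1 : -1 <= x <= 1.
  have y2 := sqr_ge0 y; apply/andP; split; nra.
have Es : sin (acos x) = `|y|.
  by rewrite sin_acos // -sqrtr_sqr -N addrAC subrr add0r.
have [y0|y0] := leP 0 y.
  by exists (acos x); rewrite /expi acosK // Es ger0_norm.
by exists (- acos x); rewrite /expi cosN sinN acosK // Es ltr0_norm // opprK.
Qed.

(** Both functions share one induction, each being up to sign the derivative of the other. *)
Lemma Ck_at_cos_sin (V : normedModType R) k (tau : V -> R) x : Ck_at k tau x ->
  Ck_at k (fun v => cos (tau v)) x /\ Ck_at k (fun v => sin (tau v)) x.
Proof.
have dc u : differentiable (@cos R) u by apply/derivable1_diffP; exact: ex_derive.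
have ds u : differentiable (@sin R) u by apply/derivable1_diffP; exact: ex_derive.
have dcomp (f : R -> R) (D : R) v y : differentiable tau y -> differentiable f (tau y) ->
    is_derive (tau y) (1 : R) f D -> 'D_v (fun v => f (tau v)) y = D * 'D_v tau y.
  move=> dt df Df; apply: etrans (deriveE v (differentiable_comp dt df)) _.
  apply: etrans (diff_compE v dt df) _.
  by rewrite (diff1E df) derive1E derive_val (deriveE v dt) /GRing.scale /= mulrC.
elim: k => [|k IH] tC.
  split; [apply: (@continuous_comp _ _ _ tau (@cos R))|apply: (@continuous_comp _ _ _ tau (@sin R))];
    by [exact: tC|exact/differentiable_continuous].
have [IHc IHs] := IH (Ck_at_S tC); have [dt Dt] := tC.
split; split.
- by apply: filterS dt => y dy; apply: (@differentiable_comp _ _ _ _ tau (@cos R)).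
- move=> v; apply: (@Ck_at_near _ _ _ _ (fun y => - 1 * sin (tau y) * 'D_v tau y)).
    by apply: filterS dt => y dy; rewrite (dcomp (@cos R) (- sin (tau y))) // mulN1r.
  apply: Ck_at_mul; last exact: Dt.
  by apply: Ck_at_mul; [exact: Ck_at_cst|exact: IHs].
- by apply: filterS dt => y dy; apply: (@differentiable_comp _ _ _ _ tau (@sin R)).
- move=> v; apply: (@Ck_at_near _ _ _ _ (fun y => cos (tau y) * 'D_v tau y)).
    by apply: filterS dt => y dy; rewrite (dcomp (@sin R) (cos (tau y))).
  by apply: Ck_at_mul; [exact: IHc|exact: Dt].
Qed.

End UnitCircle.

Section TimeSpace.
Variables (R : realType) (k : nat).
Local Notation T := ('rV[R]_k).

(** Time and position form one row vector, so that joint smoothness is plain [Ck_at], partial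
    derivatives are directional ones, and [schwarz] exchanges time with space. *)
Definition tl (t : R) (y : T) : 'rV[R]_(1 + k) := row_mx (t *: 1%:M) y.
Definition time (x : 'rV[R]_(1 + k)) : R := lsubmx x 0 0.

Lemma time_tl t y : time (tl t y) = t.
Proof. by rewrite /time /tl row_mxKl !mxE eqxx mulr1. Qed.

Lemma rsubmx_tl t y : rsubmx (tl t y) = y.
Proof. by rewrite /tl row_mxKr. Qed.

Lemma tl_line (h t s : R) (u y : T) : h *: tl t u + tl s y = tl (h * t + s) (h *: u + y).
Proof. by rewrite /tl scale_row_mx add_row_mx scalerA scalerDl. Qed.

Lemma Ck_at_time j x : Ck_at j time x.
Proof.
exact: ((Ck_at_coord j (fun y : 'rV[R]_(1 + k) => lsubmx y) x).1
  (Ck_at_lsubmx (Ck_at_id j x)) 0).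
Qed.

Lemma Ck_at_tl_space j t (y : T) : Ck_at j (tl t) y.
Proof. by apply: Ck_at_row_mx; [exact: Ck_at_cst|exact: Ck_at_id]. Qed.

Lemma Ck_at_tl_time j (y : T) t : Ck_at j (fun t : R => tl t y) t.
Proof.
by apply: Ck_at_row_mx; [exact: (Ck_at_scalel _ (Ck_at_id j t))|exact: Ck_at_cst].
Qed.

Lemma derive_tl_space (W : normedModType R) (F : 'rV[R]_(1 + k) -> W) t y u :
  'D_u (fun y => F (tl t y)) y = 'D_(tl 0 u) F (tl t y).
Proof. by apply: derive_line => h; rewrite tl_line mulr0 add0r. Qed.

Lemma derive_tl_time (W : normedModType R) (F : 'rV[R]_(1 + k) -> W) t y :
  'D_1 (fun t : R => F (tl t y)) t = 'D_(tl 1 0) F (tl t y).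
Proof. by apply: derive_line => h; rewrite tl_line scaler0 add0r. Qed.

Lemma near_tl_time (P : 'rV[R]_(1 + k) -> Prop) t y :
  (\forall x \near tl t y, P x) -> \forall s \near t, P (tl s y).
Proof. by move=> h; exact: (Ck_at_continuous (Ck_at_tl_time 0 y t) h). Qed.

Lemma near_tl_space (P : 'rV[R]_(1 + k) -> Prop) t y :
  (\forall x \near tl t y, P x) -> \forall z \near y, P (tl t z).
Proof. by move=> h; exact: (Ck_at_continuous (Ck_at_tl_space 0 t y) h). Qed.

End TimeSpace.

(** * The local flow of a circle action *)

Section CircleAction.
Variables (R : realType) (n : nat) (M : charted R n).
Hypothesis hM : is_manifold M.
Local Notation C := (R[i]).
Local Notation T := ('rV[R]_n).
Variable a : C -> M -> M.
Hypothesis ha : is_circle_action a.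
Implicit Types (m p : M) (t : R).

Lemma act_path_continuous (V : topologicalType) (tau : V -> R) (c : V -> M) x :
  {for x, continuous tau} -> {for x, continuous c} ->
  {for x, continuous (fun v => a (expi (tau v)) (c v))}.
Proof.
move=> tc cc; have [fc _] := act_smooth ha.
have E : (fun v => a (expi (tau v)) (c v)) =
  (fun q : 'rV[R]_1 * M => a (expi (q.1 0 0)) q.2) \o (fun v => (tau v *: 1%:M, c v)).
  by apply/funext => v /=; rewrite !mxE eqxx mulr1.
rewrite E; apply: continuous_comp; last exact: fc.
have tc1 : {for x, continuous ((fun r : R => r *: (1%:M : 'rV[R]_1)) \o tau)}.
  by apply: continuous_comp; [exact: tc|exact: scalel_continuous].
exact: (cvg_pair tc1 cc).
Qed.

Lemma act_smooth_at t m : smooth_at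
  (fun x : 'rV[R]_(1 + n) => chart (a (expi t) m) (a (expi (time x)) (cinv m (rsubmx x))))
  (tl t (chart m m)).
Proof.
have [_ fs] := act_smooth ha.
have := fs (t *: 1%:M : 'rV[R]_1, m); rewrite /=.
have -> : (t *: 1%:M : 'rV[R]_1) 0 0 = t by rewrite !mxE eqxx mulr1.
exact.
Qed.

Lemma act_space_smooth t m :
  smooth_at (chart (a (expi t) m) \o a (expi t) \o cinv m) (chart m m).
Proof.
move=> j.
have := @Ck_at_comp _ _ _ _ j _ (tl t) (chart m m) (@act_smooth_at t m j) (Ck_at_tl_space j t _).
congr Ck_at; apply/funext => y /=.
by rewrite time_tl rsubmx_tl.
Qed.

Variable m0 : M.
Local Notation c0 := (chart m0 m0).

Definition actl (x : 'rV[R]_(1 + n)) : T :=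
  chart m0 (a (expi (time x)) (cinv m0 (rsubmx x))).

Lemma actl_smooth : smooth_at actl (tl 0 c0).
Proof. by have := @act_smooth_at 0 m0; rewrite expi0 (act_one ha). Qed.

Lemma near_actl0 : \forall y \near c0, actl (tl 0 y) = y.
Proof.
apply: filterS (near_chart hM (mfd_mem hM m0)) => y [_ yc].
by rewrite /actl time_tl rsubmx_tl expi0 (act_one ha).
Qed.

(** The vector field of the action in one chart. [generator] changes chart from point to point, so
    smoothness is stated for this version. *)
Definition genl (y : T) : T := 'D_(tl 1 0) actl (tl 0 y).

Lemma genl_smooth : smooth_at genl c0.
Proof.
move=> j; have [_ D] := actl_smooth j.+1.
exact: (@Ck_at_comp _ _ _ _ j _ (tl 0) c0 (D (tl 1 0)) (Ck_at_tl_space j 0 c0)).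
Qed.

Lemma derive1_curve (c : R -> M) p : {for 0, continuous c} -> cdom p (c 0) ->
  differentiable (chart p \o c) 0 ->
  differentiable (chart (c 0) \o c) 0 /\
  derive1 (fun t => chart (c 0) (c t)) 0 =
    frame p (chart p (c 0)) ('D_1 (chart p \o c) 0).
Proof.
move=> cc cd dc; have [D E] := diff_to_frame hM cc cd dc.
split; first exact: D.
rewrite derive1E -[LHS]/('D_1 (chart (c 0) \o c) 0).
rewrite (deriveE (1 : R) D) (deriveE (1 : R) dc).
exact: E.
Qed.

Lemma actl_differentiable_near : \forall y \near c0, differentiable actl (tl 0 y).
Proof. by have [D _] := actl_smooth 1; exact: near_tl_space D. Qed.

Lemma generator_genl : \forall y \near c0,
  generator a (cinv m0 y) = frame m0 y (genl y).
Proof.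
apply: filterS2 (near_chart hM (mfd_mem hM m0)) actl_differentiable_near => y [yd yc] D.
pose c t := a (expi t) (cinv m0 y).
have c0E : c 0 = cinv m0 y by rewrite /c expi0 (act_one ha).
have cc : {for 0, continuous c}.
  by apply: act_path_continuous; [exact: cvg_id|exact: cst_continuous].
have cE : chart m0 \o c = actl \o (fun t : R => tl t y).
  by apply/funext => t; rewrite /= /actl time_tl rsubmx_tl.
have dc : differentiable (chart m0 \o c) 0.
  rewrite cE; apply: differentiable_comp; last exact: D.
  exact: (@Ck_at_differentiable _ _ _ 0 _ _ (Ck_at_tl_time 1 y 0)).
have [|_ E] := @derive1_curve c m0 cc _ dc; first by rewrite c0E.
rewrite c0E in E; rewrite /generator; apply: etrans E _.
by rewrite yc cE; congr frame; exact: derive_tl_time.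
Qed.

Lemma generator_base : generator a m0 = genl c0.
Proof.
have := nbhs_singleton generator_genl.
by rewrite (mfd_inv hM (mfd_mem hM m0)) frame_id.
Qed.

(** Stated for every t that keeps m0 in the chart, because [derive_weight] differentiates the result
    in t. *)
Lemma derive_actl_space t u : cdom m0 (a (expi t) m0) ->
  'D_(tl 0 u) actl (tl t c0) = coframe m0 (a (expi t) m0) (tmap (a (expi t)) m0 u).
Proof.
move=> td; rewrite -derive_tl_space.
have Ei := mfd_inv hM (mfd_mem hM m0).
have -> : (fun y => actl (tl t y)) = chart m0 \o (a (expi t) \o cinv m0).
  by apply/funext => y; rewrite /actl time_tl rsubmx_tl.
have fc : {for c0, continuous (a (expi t) \o cinv m0)}.
  apply: (@act_path_continuous _ (fun=> t) (cinv m0)); first exact: cst_continuous.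
  exact: (mfd_inv_cont hM (mfd_mem hM m0)).
have D := @Ck_at_differentiable _ _ _ 0 _ _ (act_space_smooth t m0 1).
have fx : (a (expi t) \o cinv m0) c0 = a (expi t) m0 by rewrite /= Ei.
have := @diff_to_coframe _ _ _ hM _ (a (expi t) \o cinv m0) m0 c0 fc.
rewrite fx => /(_ td D)[D2 E2].
exact: etrans (deriveE u D2) (E2 u).
Qed.

End CircleAction.

(** * Lie derivative of the forms along the action *)

Section InfinitesimalWeight.
Variables (R : realType) (n : nat) (M : charted R n) (g : M -> 'M[R]_n).
Variables (I J K : M -> {linear 'rV[R]_n -> 'rV[R]_n}).
Hypothesis hk : is_hyperkaehler g I J K.
Let hM : is_manifold M := hk_manifold hk.
Local Notation C := (R[i]).
Local Notation T := ('rV[R]_n).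
Variable a : C -> M -> M.
Hypothesis hka : is_hk_circle_action g I J K a.
Let ha : is_circle_action a := hka_action hka.
Variable m0 : M.
Local Notation c0 := (chart m0 m0).
Local Notation A := (actl a m0).
Local Notation X := (genl a m0).
Local Notation B L := (loc2 (kform g L) m0).

Lemma near_act_cdom : \forall t \near (0 : R), cdom m0 (a (expi t) m0).
Proof.
apply: (@chart_comp_near _ _ _ hM R (fun t : R => a (expi t) m0)).
  by apply: (act_path_continuous ha); [exact: cvg_id|exact: cst_continuous].
by rewrite expi0 (act_one ha); exact: (mfd_mem hM).
Qed.

Lemma derive_actl0 u : 'D_(tl 0 u) A (tl 0 c0) = u.
Proof.
rewrite -derive_tl_space; apply: etrans (near_eq_derive u (near_actl0 hM ha m0)) _.
exact: derive_id.
Qed.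

(** Exchanging time and space derivatives, the linearized flow starts off with the derivative of the
    vector field. *)
Lemma derive_actl_mixed u : 'D_1 (fun t => 'D_(tl 0 u) A (tl t c0)) (0 : R) = 'D_u X c0.
Proof.
apply: etrans (derive_tl_time ('D_(tl 0 u) A) 0 c0) _.
apply: etrans (schwarz (tl 1 0) (tl 0 u) (actl_smooth ha m0 2)) _.
exact: esym (derive_tl_space ('D_(tl 1 0) A) 0 c0 u).
Qed.

(** The left side is (L_X omega_L)(u, v) in coordinates: it is the derivative at t = 0 of the
    pullback of omega_L by the flow, computed with the three-term product rule. *)
Lemma derive_weight (L : M -> {linear T -> T}) u v (phi : R -> R) : is_kaehler g L ->
  (forall t, kform g L (a (expi t) m0) (tmap (a (expi t)) m0 u) (tmap (a (expi t)) m0 v)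
    = phi t) ->
  'D_(X c0) (fun y => B L y u v) c0 + kform g L m0 ('D_u X c0) v
    + kform g L m0 u ('D_v X c0) = 'D_1 phi 0.
Proof.
move=> hL E.
pose U w (t : R) := 'D_(tl 0 w) A (tl t c0).
have A0 : A (tl 0 c0) = c0 := nbhs_singleton (near_actl0 hM ha m0).
have dA : differentiable (fun t : R => A (tl t c0)) 0.
  apply: (@Ck_at_differentiable _ _ _ 0).
  exact: (@Ck_at_comp _ _ _ _ 1 A (fun t : R => tl t c0) 0 (actl_smooth ha m0 1)
    (Ck_at_tl_time 1 c0 0)).
have dU w : differentiable (U w) 0.
  apply: (@Ck_at_differentiable _ _ _ 0).
  exact: (@Ck_at_comp _ _ _ _ 1 ('D_(tl 0 w) A) (fun t : R => tl t c0) 0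
    ((actl_smooth ha m0 2).2 (tl 0 w)) (Ck_at_tl_time 1 c0 0)).
have dB p q : differentiable (fun y => B L y p q) (A (tl 0 c0)).
  by rewrite A0; exact: (loc2_differentiable hk).
have [_ D] := @derive_family2 _ _ _ _ (B L) (fun t : R => A (tl t c0)) (U u) (U v) 0 1
  (loc2_linearr g m0 L) (loc2_linearl g m0 L) dB dA (dU u) (dU v).
have nE : \forall t \near (0 : R), B L (A (tl t c0)) (U u t) (U v t) = phi t.
  apply: filterS near_act_cdom => t td.
  rewrite /U !(derive_actl_space hM ha _ td) -E /loc2.
  have -> : A (tl t c0) = chart m0 (a (expi t) m0).
    by rewrite /actl time_tl rsubmx_tl (mfd_inv hM (mfd_mem hM m0)).
  by rewrite (mfd_inv hM td) !(frameK hM _ td).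
have D2 := near_eq_derive (1 : R) nE.
have U0 w : U w 0 = w := derive_actl0 w.
have DU w : 'D_1 (U w) 0 = 'D_w X c0 := derive_actl_mixed w.
have DA : 'D_1 (fun t : R => A (tl t c0)) 0 = X c0 := derive_tl_time A 0 c0.
rewrite D !U0 !DU DA A0 !(loc2_base hk) in D2.
exact: D2.
Qed.

Lemma derive_cos_sin (p q : R) :
  'D_1 (fun t : R => cos t * p - sin t * q) 0 = - q /\
  'D_1 (fun t : R => cos t * p + sin t * q) 0 = q.
Proof.
have dc : has_diff (@cos R) 0 (fun v => 0).
  split=> [|v]; first exact: (Ck_at_differentiable (Ck_at_cos_sin (Ck_at_id 1 (0 : R))).1).
  rewrite deriveE ?diff1E ?derive1E ?derive_val ?sin0 ?oppr0 ?scaler0 //;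
    exact: (Ck_at_differentiable (Ck_at_cos_sin (Ck_at_id 1 (0 : R))).1).
have ds : has_diff (@sin R) 0 (fun v => v).
  split=> [|v]; first exact: (Ck_at_differentiable (Ck_at_cos_sin (Ck_at_id 1 (0 : R))).2).
  rewrite deriveE ?diff1E ?derive1E ?derive_val ?cos0 //;
    try exact: (Ck_at_differentiable (Ck_at_cos_sin (Ck_at_id 1 (0 : R))).2).
  by rewrite /GRing.scale /= mulr1.
have H s := has_diff_add (has_diff_mul dc (has_diff_cst p 0))
   (has_diff_mul (has_diff_cst s 0) (has_diff_mul ds (has_diff_cst q 0))).
split.
  have -> : (fun t : R => cos t * p - sin t * q) =
      (fun t => cos t * p + -1 * (sin t * q)) by apply/funext => t; ring.
  rewrite (H _).2; ring.
have -> : (fun t : R => cos t * p + sin t * q) =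
    (fun t => cos t * p + 1 * (sin t * q)) by apply/funext => t; ring.
rewrite (H _).2; ring.
Qed.

(* Cartan's formula [L_X (omega_J + i omega_K) = i (omega_J + i omega_K)],
   written in coordinates. *)
Lemma infinitesimal_weight u v :
  'D_(X c0) (fun y => B J y u v) c0 + kform g J m0 ('D_u X c0) v
    + kform g J m0 u ('D_v X c0) = - kform g K m0 u v /\
  'D_(X c0) (fun y => B K y u v) c0 + kform g K m0 ('D_u X c0) v
    + kform g K m0 u ('D_v X c0) = kform g J m0 u v.
Proof.
have W t := hka_weight hka m0 u v (expi_norm t).
have [D1 D2] := derive_cos_sin (kform g J m0 u v) (kform g K m0 u v).
have [_ D3] := derive_cos_sin (kform g K m0 u v) (kform g J m0 u v).
split.
  rewrite -D1; apply: derive_weight; first exact: hk_J hk.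
  by move=> t; have := congr1 (@complex.Re R) (W t).
rewrite -D3; apply: derive_weight; first exact: hk_K hk.
by move=> t; have := congr1 (@complex.Im R) (W t).
Qed.

End InfinitesimalWeight.

(** * Rotations in the charts of the projective line *)

Section Rotation.
Variable R : realType.
Local Notation C := (R[i]).
Local Notation P1 := (P1 R).
Local Notation E2 := ('rV[R]_(1 + 1)).
Implicit Types (p q : P1) (t : R) (y : E2).

(* The rotation by [expi t]^-1 in the preferred coordinate at p: it is
   multiplication by [expi (- t)] in the coordinate z, by [expi t] in 1/z. *)
Definition rot_sign p : R := if p is Some _ then -1 else 1.
Definition rot p t y : E2 := cos t *: y + (rot_sign p * sin t) *: stdJ y.

Lemma rot0 p y : rot p 0 y = y.
Proof. by rewrite /rot cos0 sin0 mulr0 scale0r addr0 scale1r. Qed.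

Lemma rot_linear p t : linear (rot p t).
Proof.
move=> a u v; rewrite /rot stdJ_linear; apply/rowP => j; rewrite !mxE; ring.
Qed.

Lemma rot_stdJ p t y : rot p t (stdJ y) = stdJ (rot p t y).
Proof.
rewrite /rot stdJK; have L := @stdJ_linear R 1.
have -> : stdJ (cos t *: y + (rot_sign p * sin t) *: stdJ y) =
    cos t *: stdJ y + (rot_sign p * sin t) *: stdJ (stdJ y).
  have L0 : stdJ (0 : E2) = 0.
    by have := L (-1) 0 0; rewrite scaleN1r oppr0 addr0 scaleN1r addNr.
  have := L (rot_sign p * sin t) (stdJ y) 0; rewrite L0 !addr0 => <-.
  by rewrite L.
by rewrite stdJK.
Qed.

Lemma ofR_rot p t y : ofR (rot p t y) 0 0 = expi (rot_sign p * t) * ofR y 0 0.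
Proof.
have -> : expi (rot_sign p * t) = cos t +i* (rot_sign p * sin t).
  by rewrite /expi /rot_sign; case: p => [_|]; rewrite ?mul1r // !mulN1r cosN sinN.
have El : lsubmx (rot p t y) = cos t *: lsubmx y - (rot_sign p * sin t) *: rsubmx y.
  by rewrite /rot linearD !linearZ /= row_mxKl scalerN.
have Er : rsubmx (rot p t y) = cos t *: rsubmx y + (rot_sign p * sin t) *: lsubmx y.
  by rewrite /rot linearD !linearZ /= row_mxKr.
have E (w : E2) : ofR w 0 0 = lsubmx w 0 0 +i* rsubmx w 0 0 by rewrite mxE.
rewrite (E y) (E (rot p t y)) El Er mxE [X in _ +i* X]mxE.
rewrite [X in X + _]mxE [X in _ + X]mxE [X in - X]mxE.
rewrite [X in _ +i* (X + _)]mxE [X in _ +i* (_ + X)]mxE.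
by [].
Qed.

Lemma actP1_rot p t y : actP1 (expi t)^-1 (cinv p y) = cinv p (rot p t y).
Proof.
rewrite /= ; have := ofR_rot p t y; case: p => [z|] /= ->.
  by rewrite mulN1r expiN.
rewrite mul1r mulf_eq0 (negbTE (expi_neq0 t)) /=.
by case: eqP => //= _; rewrite invfM.
Qed.

Lemma actP1_rot_chart q t : actP1 (expi t)^-1 q = cinv q (rot q t (chart q q)).
Proof. by rewrite -actP1_rot (P1_cinvK (P1_mem q)). Qed.

Lemma actP1K (z : C) q : z != 0 -> actP1 z (actP1 z^-1 q) = q.
Proof. by case: q => [l|] //= z0; rewrite /P1pt mulrA divff // mul1r. Qed.

Lemma Ck_at_rot p k (V : normedModType R) (tau : V -> R) (f : V -> E2) x :
  Ck_at k tau x -> Ck_at k f x -> Ck_at k (fun v => rot p (tau v) (f v)) x.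
Proof.
move=> tC /Ck_at_coord fC; have [cC sC] := Ck_at_cos_sin tC.
apply/Ck_at_coord => j.
have [i Ei] : exists c : 'rV[R]_(1 + 1), forall y : E2, (stdJ y) 0 j = \sum_i y 0 i * c 0 i.
  exists (\row_i stdJ (delta_mx 0 i) 0 j) => y.
  have sl : linear (fun y : E2 => (stdJ y) 0 j : R^o).
    by move=> a u v; rewrite stdJ_linear !mxE.
  by rewrite [LHS](rV_linear_sum y sl); apply: eq_bigr => k0 _; rewrite mxE.
rewrite (_ : (fun v => _) = fun v => cos (tau v) * f v 0 j
    + rot_sign p * sin (tau v) * \sum_k f v 0 k * i 0 k); last first.
  by apply/funext => v; rewrite /rot mxE mxE [in X in _ + X]mxE Ei.
apply: Ck_at_add; apply: Ck_at_mul => //.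
  by apply: Ck_at_mul => //; exact: Ck_at_cst.
by apply: Ck_at_sum => k0; apply: Ck_at_mul => //; exact: Ck_at_cst.
Qed.

End Rotation.

(** * The generator of the action on sections *)

Section SectionFlow.
Variables (R : realType) (n : nat) (M : charted R n) (g : M -> 'M[R]_n).
Variables (I J K : M -> {linear 'rV[R]_n -> 'rV[R]_n}).
Hypothesis hk : is_hyperkaehler g I J K.
Let hM : is_manifold M := hk_manifold hk.
Local Notation C := (R[i]).
Local Notation T := ('rV[R]_n).
Local Notation P1 := (P1 R).
Local Notation E2 := ('rV[R]_(1 + 1)).
Variable a : C -> M -> M.
Hypothesis hka : is_hk_circle_action g I J K a.
Let ha : is_circle_action a := hka_action hka.
Variable sg : P1 -> M.
Hypothesis hs : is_section I J K (graph_of sg).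
Let sc : continuous sg := (smooth_graph hs.1.1).1.
Let sC p : smooth_at (sloc sg p) (chart p p) := (smooth_graph hs.1.1).2 p.
Implicit Types (p q : P1) (t : R) (y b : E2).

Definition flow q t : M := a (expi t) (sg (actP1 (expi t)^-1 q)).

(** The orbit of s near p, in time and P1-coordinate jointly; the point of evaluation is rotated
    backwards, as in [actS]. *)
Definition flowl p (x : 'rV[R]_(1 + (1 + 1))) : T :=
  chart (sg p) (a (expi (time x)) (sg (cinv p (rot p (time x) (rsubmx x))))).

Lemma flowlE p t y : flowl p (tl t y) = chart (sg p) (flow (cinv p y) t).
Proof. by rewrite /flowl time_tl rsubmx_tl /flow actP1_rot. Qed.

Lemma flow0 q : flow q 0 = sg q.
Proof. by rewrite /flow expi0 invr1 (act_one ha); case: q => [l|] //=; rewrite mul1r. Qed.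

Definition flow_arg p (x : 'rV[R]_(1 + (1 + 1))) : 'rV[R]_(1 + n) :=
  tl (time x) (sloc sg p (rot p (time x) (rsubmx x))).

Lemma Ck_at_rot_time p k x : Ck_at k
  (fun x : 'rV[R]_(1 + (1 + 1)) => rot p (time x) (rsubmx x)) x.
Proof. exact: (Ck_at_rot p (Ck_at_time k x) (Ck_at_rsubmx (Ck_at_id k x))). Qed.

(** As long as s at the rotated point stays in the chart at [sg p], the orbit factors through the
    local action [actl]; smoothness of [flowl] follows from this. *)
Lemma near_flow_arg p : \forall x \near tl 0 (chart p p),
  flowl p x = actl a (sg p) (flow_arg p x).
Proof.
pose r (x : 'rV[R]_(1 + (1 + 1))) := rot p (time x) (rsubmx x).
have rc : {for tl 0 (chart p p), continuous r}.
  exact: (@Ck_at_continuous _ _ _ 0 _ _ (Ck_at_rot_time p 0 _)).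
have r0 : r (tl 0 (chart p p)) = chart p p by rewrite /r time_tl rsubmx_tl rot0.
have N := @near_section _ _ _ hM sg p sc; rewrite -r0 in N.
have N2 : \forall x \near tl 0 (chart p p), cdom (sg p) (sg (cinv p (r x))) := rc _ N.
apply: filterS N2 => x xd; rewrite /actl /flow_arg time_tl rsubmx_tl /flowl.
by rewrite /sloc /= (mfd_inv hM xd).
Qed.

Lemma flow_arg_base p : flow_arg p (tl 0 (chart p p)) = tl 0 (chart (sg p) (sg p)).
Proof.
rewrite /flow_arg time_tl rsubmx_tl rot0; congr tl.
exact: (congr1 (fun q => chart (sg p) (sg q)) (P1_cinvK (P1_mem p))).
Qed.

Lemma flow_arg_smooth p : smooth_at (flow_arg p) (tl 0 (chart p p)).
Proof.
move=> k; apply: Ck_at_row_mx.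
  exact: (Ck_at_scalel _ (Ck_at_time k _)).
apply: (@Ck_at_comp _ _ _ _ k (sloc sg p)); last exact: Ck_at_rot_time.
by rewrite time_tl rsubmx_tl rot0; exact: sC.
Qed.

Lemma flowl_smooth p : smooth_at (flowl p) (tl 0 (chart p p)).
Proof.
move=> k; apply: (@Ck_at_near _ _ _ _ (actl a (sg p) \o flow_arg p)).
  by apply: filterS (near_flow_arg p) => x ->.
apply: Ck_at_comp; last exact: flow_arg_smooth.
by rewrite flow_arg_base; exact: (actl_smooth ha).
Qed.

Lemma flow_continuous q : {for 0, continuous (flow q)}.
Proof.
apply: (act_path_continuous ha (tau := fun t => t)); first exact: cvg_id.
have -> : (fun t => sg (actP1 (expi t)^-1 q)) =
    sg \o (cinv q \o (fun t : R => rot q t (chart q q))).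
  by apply/funext => t /=; rewrite actP1_rot_chart.
apply: continuous_comp; last exact: sc.
apply: continuous_comp; last exact: P1_cinv_continuous.
exact: (@Ck_at_continuous _ _ _ 0 _ _
  (Ck_at_rot q (Ck_at_id 0 (0 : R)) (Ck_at_cst 0 (chart q q) (0 : R)))).
Qed.

Lemma flowl_time p y : chart (sg p) \o flow (cinv p y) = (fun t => flowl p (tl t y)).
Proof. by apply/funext => t; rewrite flowlE. Qed.

Lemma flow_differentiable p y : differentiable (flowl p) (tl 0 y) ->
  differentiable (chart (sg p) \o flow (cinv p y)) 0 /\
  'D_1 (chart (sg p) \o flow (cinv p y)) 0 = 'D_(tl 1 0) (flowl p) (tl 0 y).
Proof.
move=> D; rewrite flowl_time; split; last exact: derive_tl_time.
apply: (@differentiable_comp _ _ _ _ (fun t : R => tl t y) (flowl p)); last exact: D.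
exact: (@Ck_at_differentiable _ _ _ 0 _ _ (Ck_at_tl_time 1 y 0)).
Qed.

(** The rotation applied after s and the inverse rotation applied before it cancel on P1, so the
    orbit of s stays in the fibre over q. *)
Lemma generatorS_graph q : generatorS a (graph_of sg) q =
  row_mx 0 (derive1 (fun t => chart (sg q) (flow q t)) 0).
Proof.
rewrite /generatorS.
have -> : (fun t : R => @chart R _ (Z M) (graph_of sg q) (actS a (expi t) (graph_of sg) q)) =
    (fun t => row_mx (chart q q) (chart (sg q) (flow q t))).
  apply/funext => t; rewrite /actS /actZ /flow.
  apply: (congr1 (fun p => row_mx (chart q p) _)).
  exact: actP1K (expi_neq0 t).
have D := @Ck_at_differentiable _ _ _ 0 _ _ (flowl_smooth q 1).
have [D1 _] := flow_differentiable D.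
rewrite (P1_cinvK (P1_mem q)) in D1.
have dc : differentiable (fun _ : R => chart q q : E2) 0 by exact: differentiable_cst.
have [D2 E] := is_diff_row_mx dc D1.
rewrite !derive1E; apply: etrans (deriveE (1 : R) D2) _; apply: etrans (E 1) _.
by congr row_mx; [rewrite (diff_cst (chart q q : E2))|apply: esym; exact: deriveE].
Qed.

Definition genS := generatorS a (graph_of sg).

Lemma vloc_genS p : \forall y \near chart p p,
  vloc sg genS p y = 'D_(tl 1 0) (flowl p) (tl 0 y).
Proof.
have [dN _] := flowl_smooth p 1.
apply: filterS2 (near_tl_space dN) (@near_section _ _ _ hM sg p sc) => y dy yd.
have [D1 D2] := flow_differentiable dy.
have f0 := flow0 (cinv p y).
have [|_ E] := derive1_curve hM (@flow_continuous (cinv p y)) _ D1; first by rewrite f0.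
rewrite /vloc /genS generatorS_graph row_mxKr -D2.
rewrite f0 in E; rewrite E coframeK //.
Qed.

Lemma vloc_genS_smooth p : smooth_at (vloc sg genS p) (chart p p).
Proof.
move=> k; apply: (@Ck_at_near _ _ _ _ (fun y => 'D_(tl 1 0) (flowl p) (tl 0 y))).
  by apply: filterS (vloc_genS p) => y ->.
exact: (@Ck_at_comp _ _ _ _ k ('D_(tl 1 0) (flowl p)) (tl 0) (chart p p)
  ((flowl_smooth p k.+1).2 _) (Ck_at_tl_space k 0 _)).
Qed.

Lemma cinv_actP1 (z : C) p : @cinv _ _ P1 (actP1 z p) = cinv p.
Proof. by case: p. Qed.

Lemma chart_actP1_rot p t :
  let q := actP1 (expi t)^-1 p in chart q q = rot p t (chart p p).
Proof.
move=> q; have -> : chart q q = chart p q by rewrite /q; case: (p).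
by rewrite /q actP1_rot_chart P1_chartK.
Qed.

Lemma near_flow_cdom p : \forall t \near (0 : R), cdom (sg p) (flow p t).
Proof.
apply: (chart_comp_near hM (@flow_continuous p)).
by rewrite flow0; exact: (mfd_mem hM).
Qed.

(** Chain rule through the rotation, s and the action. The natural chart for s is the one at the
    rotated point q, and [cinv q] equals [cinv p] because p and q are both finite or both
    infinite. *)
Lemma derive_flowl_space p t b (q := actP1 (expi t)^-1 p) : cdom (sg p) (flow p t) ->
  'D_(tl 0 b) (flowl p) (tl t (chart p p)) =
  coframe (sg p) (flow p t)
    (tmap (a (expi t)) (sg q) ('d (sloc sg q) (chart q q) (rot p t b))).
Proof.
move=> td; set z := expi t.
have xE : chart q q = rot p t (chart p p) := chart_actP1_rot p t.
pose f := a z \o (sg \o cinv q).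
have qE : cinv q (chart q q) = q := P1_cinvK (P1_mem q).
have fx : f (chart q q) = flow p t by rewrite /f /comp qE.
have sqc : {for chart q q, continuous (sg \o cinv q)}.
  by apply: continuous_comp; [exact: P1_cinv_continuous|exact: sc].
have fc : {for chart q q, continuous f}.
  by apply: (act_path_continuous ha (tau := fun=> t)); [exact: cst_continuous|exact: sqc].
have ds : differentiable (sloc sg q) (chart q q).
  exact: (@Ck_at_differentiable _ _ _ 0 _ _ (sC q 1)).
have sqE : sloc sg q (chart q q) = chart (sg q) (sg q).
  exact: (congr1 (fun q' => chart (sg q) (sg q')) qE).
have dact : differentiable (chart (flow p t) \o a z \o cinv (sg q)) (sloc sg q (chart q q)).
  by rewrite sqE; exact: (@Ck_at_differentiable _ _ _ 0 _ _ (act_space_smooth ha t (sg q) 1)).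
have nE : \forall y \near chart q q,
    ((chart (flow p t) \o a z \o cinv (sg q)) \o sloc sg q) y = (chart (flow p t) \o f) y.
  apply: filterS (@near_section _ _ _ hM sg q sc) => y yd.
  by rewrite /f /comp /sloc /comp (mfd_inv hM yd).
have D1 := differentiable_comp ds dact.
have D2 : differentiable (chart (f (chart q q)) \o f) (chart q q).
  by rewrite fx; exact: near_eq_differentiable nE D1.
have fd : cdom (sg p) (f (chart q q)) by rewrite fx.
have [D3 E3] := diff_to_coframe hM fc fd D2.
have rl := rot_linear p t.
have [drot Erot] := linear_is_diff (chart p p) rl (rV_linear_continuous rl).
rewrite -derive_tl_space.
have -> : (fun y => flowl p (tl t y)) = (chart (sg p) \o f) \o rot p t.
  apply/funext => y; rewrite /flowl time_tl rsubmx_tl /f /comp.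
  by rewrite /q cinv_actP1.
have D3' : differentiable (chart (sg p) \o f) (rot p t (chart p p)) by rewrite -xE.
apply: etrans (deriveE b (differentiable_comp drot D3')) _.
apply: etrans (diff_compE b drot D3') _.
rewrite Erot -xE; apply: etrans (E3 _) _; rewrite fx; congr coframe.
apply: etrans (near_eq_diff _ nE D1) _.
by apply: etrans (diff_compE _ ds dact) _; rewrite sqE.
Qed.

(** The rotation commutes with i, s is holomorphic, and the action intertwines the fibre structures
    ([action_Isphere]); hence the translated section satisfies the Cauchy-Riemann equation at p. *)
Lemma flowl_holomorphic p t b : cdom (sg p) (flow p t) ->
  'D_(tl 0 (stdJ b)) (flowl p) (tl t (chart p p)) =
  locE (Isphere I J K p) (sg p) (flowl p (tl t (chart p p)))
    ('D_(tl 0 b) (flowl p) (tl t (chart p p))).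
Proof.
move=> td; rewrite !(derive_flowl_space _ td) rot_stdJ (holomorphic_graph _ _ hs).
rewrite (action_Isphere hk (sg _) hka (expi_norm t)) actP1K ?expi_neq0 //.
rewrite flowlE (P1_cinvK (P1_mem p)) /locE (mfd_inv hM td).
by rewrite (frameK hM _ td).
Qed.

Lemma derive_flowl_mixed p w :
  'D_w (vloc sg genS p) (chart p p) =
  'D_1 (fun t : R => 'D_(tl 0 w) (flowl p) (tl t (chart p p))) 0.
Proof.
apply: etrans (near_eq_derive w (vloc_genS p)) _.
apply: etrans (derive_tl_space ('D_(tl 1 0) (flowl p)) 0 (chart p p) w) _.
apply: etrans (schwarz (tl 0 w) (tl 1 0) (flowl_smooth p 2)) _.
exact: esym (derive_tl_time ('D_(tl 0 w) (flowl p)) 0 (chart p p)).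
Qed.

Lemma genS_vertical q : lsubmx (genS q) = 0.
Proof. by rewrite /genS generatorS_graph row_mxKl. Qed.

(** The derivative at t = 0 of the Cauchy-Riemann equation of e^{it}.s, with time and space
    derivatives exchanged, is exactly the linearized equation. *)
Lemma genS_holomorphic p : holomorphic_along_at I J K (graph_of sg) genS p.
Proof.
have sI := kaehler_smooth (hk_I hk); have sJ := kaehler_smooth (hk_J hk).
have sK := kaehler_smooth (hk_K hk).
apply/(holomorphic_alongE hM sI sJ sK hs).
  by apply: filterE => y; exact: genS_vertical.
split=> [|b]; first exact: vloc_genS_smooth.
set y0 := chart p p.
have mp := mfd_mem hM (sg p).
have g0 : flowl p (tl 0 y0) = chart (sg p) (sg p).
  by rewrite flowlE (P1_cinvK (P1_mem p)) flow0.
have dg : differentiable (fun t : R => flowl p (tl t y0)) 0.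
  apply: (@Ck_at_differentiable _ _ _ 0).
  exact: (@Ck_at_comp _ _ _ _ 1 (flowl p) (fun t : R => tl t y0) 0 (flowl_smooth p 1)
    (Ck_at_tl_time 1 y0 0)).
pose U (t : R) := 'D_(tl 0 b) (flowl p) (tl t y0).
have dU : differentiable U 0.
  apply: (@Ck_at_differentiable _ _ _ 0).
  exact: (@Ck_at_comp _ _ _ _ 1 ('D_(tl 0 b) (flowl p)) (fun t : R => tl t y0) 0
    ((flowl_smooth p 2).2 (tl 0 b)) (Ck_at_tl_time 1 y0 0)).
have dL w : differentiable (fun x => locE (Isphere I J K p) (sg p) x w)
    (flowl p (tl 0 y0)).
  by rewrite g0; exact: (@Ck_at_differentiable _ _ _ 0 _ _
    (locE_Isphere_smooth sI sJ sK p (sg p) w 1)).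
have [_ E] := @derive_endo _ _ _ _ (locE (Isphere I J K p) (sg p))
  (fun t : R => flowl p (tl t y0)) U 0 1 (locE_Isphere_linear I J K p (sg p)) dL dg dU.
have nE : \forall t \near (0 : R), 'D_(tl 0 (stdJ b)) (flowl p) (tl t y0) =
    locE (Isphere I J K p) (sg p) (flowl p (tl t y0)) (U t).
  by apply: filterS (near_flow_cdom p) => t td; exact: flowl_holomorphic.
apply: etrans (derive_flowl_mixed p (stdJ b)) _.
apply: etrans (near_eq_derive (1 : R) nE) _.
apply: etrans E _; rewrite addrC g0; congr (_ + _).
  rewrite derive_flowl_mixed /locE (mfd_inv hM mp) (frame_id hM) coframe_id //.
have -> : U 0 = 'd (sloc sg p) y0 b.
  rewrite /U -derive_tl_space.
  have -> : (fun y => flowl p (tl 0 y)) = sloc sg p.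
    by apply/funext => y; rewrite flowlE flow0.
  by rewrite (deriveE b (@Ck_at_differentiable _ _ _ 0 _ _ (sC p 1))).
have -> : 'D_1 (fun t : R => flowl p (tl t y0)) 0 = rsubmx (genS p).
  apply: etrans (derive_tl_time (flowl p) 0 y0) _.
  have := nbhs_singleton (vloc_genS p); rewrite /vloc (P1_cinvK (P1_mem p)) coframe_id //.
by [].
Qed.

Lemma genS_H0 : H0 I J K (graph_of sg) genS.
Proof.
by move=> p _; split; [apply/verticalE; exact: genS_vertical|exact: genS_holomorphic].
Qed.

End SectionFlow.

(** * First-order behaviour of the generator at z = 0 *)

Section GeneratorNearZero.
Variables (R : realType) (n : nat) (M : charted R n) (g : M -> 'M[R]_n).
Variables (I J K : M -> {linear 'rV[R]_n -> 'rV[R]_n}).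
Hypothesis hk : is_hyperkaehler g I J K.
Let hM : is_manifold M := hk_manifold hk.
Local Notation C := (R[i]).
Local Notation T := ('rV[R]_n).
Local Notation P1 := (P1 R).
Local Notation E2 := ('rV[R]_(1 + 1)).
Variable a : C -> M -> M.
Hypothesis hka : is_hk_circle_action g I J K a.
Let ha : is_circle_action a := hka_action hka.
Variable sg : P1 -> M.
Hypothesis hs : is_section I J K (graph_of sg).
Local Notation p0 := (P1pt (0 : C)).
Local Notation m0 := (sg p0).
Local Notation c0 := (chart m0 m0).
Local Notation Phi := (sloc sg p0).
Local Notation A := (actl a m0).
Local Notation X := (genl a m0).
Local Notation gS := (genS a sg).
Local Notation B L := (loc2 (kform g L) m0).

Lemma rot_zero p t : rot p t (0 : E2) = 0.
Proof.
by have := rot_linear p t (-1) 0 0; rewrite scaleN1r oppr0 addr0 scaleN1r addNr.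
Qed.

Lemma cinv_zero : @cinv _ _ P1 p0 0 = p0.
Proof. by have := P1_cinvK (P1_mem p0); rewrite chart_P1pt0. Qed.

(** Rotations fix the point 0, so over it the flow is the orbit of s(0) in M. *)
Lemma genS_base : rsubmx (gS p0) = X c0.
Proof.
have := nbhs_singleton (vloc_genS hk hka hs p0); rewrite chart_P1pt0 (vloc_base hk) => E.
apply: etrans E _; apply: etrans (esym (derive_tl_time (flowl a sg p0) 0 0)) _.
apply: etrans _ (derive_tl_time A 0 c0).
apply: (congr1 (fun f : R -> T => 'D_1 f 0)); apply/funext => t.
rewrite /flowl /actl !time_tl !rsubmx_tl rot_zero cinv_zero.
by rewrite (mfd_inv hM (mfd_mem hM m0)).
Qed.

Lemma derive_scale_rV (V : normedModType R) k (c : V -> R) (f : V -> 'rV[R]_k) x v :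
  differentiable c x -> differentiable f x ->
  differentiable (fun y => c y *: f y) x /\
  'D_v (fun y => c y *: f y) x = c x *: 'D_v f x + 'D_v c x *: f x.
Proof.
move=> dc df.
pose L (y : 'rV[R]_1) (w : 'rV[R]_k) := y 0 0 *: w.
have Ll y : linear (L y) by move=> s p q; rewrite /L scalerDr !scalerA mulrC.
have dL w : differentiable (fun y => L y w) (c x *: 1%:M : 'rV[R]_1).
  by apply: differentiableZl; exact: differentiable_coord.
have dc1 : differentiable (fun y => c y *: (1%:M : 'rV[R]_1)) x by exact: differentiableZl.
have [D E] := @derive_endo _ _ _ _ L (fun y => c y *: 1%:M) f x v Ll dL dc1 df.
have EL : (fun y => L (c y *: 1%:M) (f y)) = (fun y => c y *: f y).
  by apply/funext => y; rewrite /L !mxE eqxx mulr1.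
rewrite -EL; split; first exact: D.
apply: etrans E _; rewrite addrC; congr (_ + _); first by rewrite /L !mxE eqxx mulr1.
have sl : linear (fun y => L y (f x)) by move=> s p q; rewrite /L !mxE scalerDl scalerA.
have [dS ES] := linear_is_diff (c x *: 1%:M : 'rV[R]_1) sl (rV_linear_continuous sl).
apply: etrans (deriveE _ dS) _; apply: etrans (congr1 (@^~ _) ES) _.
have -> : 'D_v (fun y => c y *: (1%:M : 'rV[R]_1)) x = 'D_v c x *: 1%:M.
  apply: etrans (deriveE v dc1) _; apply: etrans (congr1 (@^~ v) (diffZl (1%:M : 'rV[R]_1) dc)) _.
  by rewrite -(deriveE v dc).
by rewrite /L !mxE eqxx mulr1.
Qed.

(** The generator is X along s minus the derivative of s along the rotation field i z d/dz. That
    field vanishes at 0 with linear part multiplication by i, which holomorphy of s turns into - I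
    ds. *)
Lemma derive_genS b : 'D_b (vloc sg gS p0) 0 = 'D_('D_b Phi 0) X c0 - I m0 ('D_b Phi 0).
Proof.
set u := 'D_b Phi 0.
have := derive_flowl_mixed hk hka hs p0 b; rewrite chart_P1pt0 => ->.
have dPhi := sloc_differentiable0 hs.
have Phi0 := sloc_base sg.
(* The linearized action is applied to ds of the rotated vector b, and this is cos t u - sin t I u
   because ds(i b) = I u. *)
have nE : \forall t \near (0 : R), 'D_(tl 0 b) (flowl a sg p0) (tl t 0) =
    cos t *: 'D_(tl 0 u) A (tl t c0) + (- 1 * sin t) *: 'D_(tl 0 (I m0 u)) A (tl t c0).
  have N1 := near_join (near_flow_arg hk a hs p0); rewrite chart_P1pt0 in N1.
  have [dA _] := actl_smooth ha m0 1.
  apply: filterS2 (near_tl_time N1) (near_tl_time dA) => t Nt dt.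
  apply: etrans (near_eq_derive (tl 0 b) Nt) _.
  apply: etrans (esym (derive_tl_space (fun x => A (flow_arg sg p0 x)) t 0 b)) _.
  have dtA : forall w, 'D_(tl 0 w) A (tl t c0) = 'd A (tl t c0) (tl 0 w).
    by move=> w; exact: deriveE.
  have rl := rot_linear p0 t.
  have [drot Erot] := linear_is_diff (0 : E2) rl (rV_linear_continuous rl).
  have dPhi' : differentiable Phi (rot p0 t 0) by rewrite rot_zero.
  have dPr := differentiable_comp drot dPhi'.
  have dT (y : T) : differentiable (tl t : T -> _) y.
    exact: (@Ck_at_differentiable _ _ _ 0 _ _ (Ck_at_tl_space 1 t y)).
  have -> : (fun y => A (flow_arg sg p0 (tl t y))) = (fun y => A (tl t y)) \o (Phi \o rot p0 t).
    by apply/funext => y; rewrite /flow_arg time_tl rsubmx_tl.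
  have P0 : (Phi \o rot p0 t) 0 = c0 by rewrite /comp rot_zero Phi0.
  have dAt : differentiable (fun y => A (tl t y)) ((Phi \o rot p0 t) 0).
    by rewrite P0; apply: (@differentiable_comp _ _ _ _ (tl t) A) => //.
  apply: etrans (deriveE b (differentiable_comp dPr dAt)) _.
  apply: etrans (diff_compE b dPr dAt) _.
  apply: etrans (esym (deriveE _ dAt)) _.
  rewrite P0 derive_tl_space !dtA.
  have -> : 'd (Phi \o rot p0 t) 0 b = cos t *: u + (- 1 * sin t) *: I m0 u.
    apply: etrans (diff_compE b drot dPhi') _.
    rewrite Erot rot_zero -(deriveE _ dPhi) /rot (deriveE _ dPhi) linearD !linearZ /=.
    rewrite -!(deriveE _ dPhi) (sloc_holomorphic0 hs).
    by [].
  have -> : tl 0 (cos t *: u + (- 1 * sin t) *: I m0 u) =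
      cos t *: tl 0 u + (- 1 * sin t) *: tl 0 (I m0 u).
    by rewrite /tl !scale_row_mx add_row_mx !scale0r !scaler0 addr0.
  by rewrite linearD !linearZ.
apply: etrans (near_eq_derive (1 : R) nE) _.
have dcos : differentiable (@cos R) 0.
  exact: (Ck_at_differentiable (Ck_at_cos_sin (Ck_at_id 1 (0 : R))).1).
have dsin : differentiable (fun t : R => - 1 * sin t) 0.
  apply: (@Ck_at_differentiable _ _ _ 0); apply: Ck_at_mul; first exact: Ck_at_cst.
  exact: (Ck_at_cos_sin (Ck_at_id 1 (0 : R))).2.
have dU w : differentiable (fun t : R => 'D_(tl 0 w) A (tl t c0)) 0.
  apply: (@Ck_at_differentiable _ _ _ 0).
  exact: (@Ck_at_comp _ _ _ _ 1 ('D_(tl 0 w) A) (fun t : R => tl t c0) 0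
    ((actl_smooth ha m0 2).2 (tl 0 w)) (Ck_at_tl_time 1 c0 0)).
have [d1 E1] := derive_scale_rV (1 : R) dcos (dU u).
have [d2 E2] := derive_scale_rV (1 : R) dsin (dU (I m0 u)).
apply: etrans (deriveD (diff_derivable d1) (diff_derivable d2)) _.
apply: etrans (congr2 +%R E1 E2) _.
rewrite cos0 sin0 !(derive_actl_mixed hka) !(derive_actl0 hk hka).
have [Dc Ds] := derive_cos_sin (1 : R) 0; have [Ds1 _] := derive_cos_sin (0 : R) 1.
have -> : 'D_1 (@cos R) 0 = 0.
  rewrite -[RHS]oppr0 -[RHS]Dc; apply: (congr1 (fun f : R -> R => 'D_1 f 0)).
  by apply/funext => t; rewrite mulr1 mulr0 subr0.
have -> : 'D_1 (fun t : R => - 1 * sin t) 0 = - 1.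
  rewrite -[RHS]Ds1; apply: (congr1 (fun f : R -> R => 'D_1 f 0)).
  apply/funext => t; ring.
by rewrite scale1r scale0r addr0 mulr0 scale0r add0r scaleN1r.
Qed.

(* Cartan's formula once more: the two derivatives of [omega_L(X, .)] along
   v and u differ by [d(i_X omega_L)(v, u) = (L_X omega_L)(v, u)]. *)
Lemma moment_identity u v : forall L, L = J \/ L = K ->
  'D_v (fun y => B L y (X c0) u) c0 + kform g L m0 ('D_v X c0) u =
  'D_u (fun y => B L y (X c0) v) c0 + kform g L m0 ('D_u X c0 - I m0 u) v.
Proof.
have [WJ WK] := infinitesimal_weight hk hka m0 v u.
have NJ w : kform g J m0 (- w) v = - kform g J m0 w v.
  by rewrite /kform linearN gformNl.
have NK w : kform g K m0 (- w) v = - kform g K m0 w v.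
  by rewrite /kform linearN gformNl.
have IJ : kform g J m0 (I m0 u) v = - kform g K m0 u v.
  have := congr1 (@complex.Re R) (kformJK_I hk m0 u v).
  by rewrite /= mul0r mul1r sub0r.
have IK : kform g K m0 (I m0 u) v = kform g J m0 u v.
  have := congr1 (@complex.Im R) (kformJK_I hk m0 u v).
  by rewrite /= mul0r add0r mul1r.
move=> L [->|->]; rewrite kformDl ?NJ ?NK ?IJ ?IK.
  have := loc2_closed m0 (X c0) v u (hk_J hk) => cl.
  rewrite cl in WJ; have := kform_anti hk m0 v ('D_u X c0) (hk_J hk) => e1.
  have := kform_anti hk m0 v u (hk_K hk) => e2.
  rewrite e1 e2 in WJ; lra.
have := loc2_closed m0 (X c0) v u (hk_K hk) => cl.
rewrite cl in WK; have := kform_anti hk m0 v ('D_u X c0) (hk_K hk) => e1.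
have := kform_anti hk m0 v u (hk_J hk) => e2.
rewrite e1 e2 in WK; lra.
Qed.

End GeneratorNearZero.

(** * The space of sections *)

Section RowLines.
Variables (R : realType) (k l : nat).

Lemma Ck_at_row_mxl j x (y : 'rV[R]_k) : Ck_at j (fun y => row_mx y x : 'rV[R]_(k + l)) y.
Proof. by apply: Ck_at_row_mx; [exact: Ck_at_id|exact: Ck_at_cst]. Qed.

Lemma Ck_at_row_mxr j y (x : 'rV[R]_l) : Ck_at j (fun x => row_mx y x : 'rV[R]_(k + l)) x.
Proof. by apply: Ck_at_row_mx; [exact: Ck_at_cst|exact: Ck_at_id]. Qed.

Lemma derive_row_mxl (W : normedModType R) (F : 'rV[R]_(k + l) -> W) x y u :
  'D_u (fun y => F (row_mx y x)) y = 'D_(row_mx u 0) F (row_mx y x).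
Proof.
by apply: derive_line => h; rewrite scale_row_mx add_row_mx scaler0 add0r.
Qed.

Lemma derive_row_mxr (W : normedModType R) (F : 'rV[R]_(k + l) -> W) x y u :
  'D_u (fun x => F (row_mx y x)) x = 'D_(row_mx 0 u) F (row_mx y x).
Proof.
by apply: derive_line => h; rewrite scale_row_mx add_row_mx scaler0 add0r.
Qed.

End RowLines.

Section SectionSpace.
Variables (R : realType) (n : nat) (M : charted R n) (g : M -> 'M[R]_n).
Variables (I J K : M -> {linear 'rV[R]_n -> 'rV[R]_n}).
Hypothesis hk : is_hyperkaehler g I J K.
Let hM : is_manifold M := hk_manifold hk.
Local Notation C := (R[i]).
Local Notation T := ('rV[R]_n).
Local Notation P1 := (P1 R).
Local Notation E2 := ('rV[R]_(1 + 1)).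
Variables (r N : nat) (S : charted C N) (ev : S -> P1 -> Z M).
Hypothesis hS : is_section_space I J K r ev.
Local Notation p0 := (P1pt (0 : C)).
Implicit Types (s : S) (p : P1).

Definition sgm s p : M := (ev s p).2.

Lemma ev_is_section s : is_section I J K (ev s).
Proof.
have : range ev (ev s) by exists s.
by rewrite (ss_range hS) => -[].
Qed.

Lemma ev_pullback s : pullback_is_O1 I J K r (ev s).
Proof.
have : range ev (ev s) by exists s.
by rewrite (ss_range hS) => -[].
Qed.

Lemma ev_graph s : ev s = graph_of (sgm s).
Proof. exact: section_graph (ev_is_section s).2. Qed.

Lemma sgm_section s : is_section I J K (graph_of (sgm s)).
Proof. by rewrite -ev_graph; exact: ev_is_section. Qed.

Lemma sgm_continuous (V : topologicalType) (c : V -> S) (d : V -> P1) x :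
  {for x, continuous c} -> {for x, continuous d} ->
  {for x, continuous (fun v => sgm (c v) (d v))}.
Proof.
move=> cc dc; have [[ec _] _] := ss_holomorphic hS.
have E : (fun v => sgm (c v) (d v)) =
    ((snd : P1 * M -> M) \o (fun q : S * P1 => ev q.1 q.2)) \o (fun v => (c v, d v)) by [].
rewrite E; apply: continuous_comp; first exact: (cvg_pair cc dc).
by apply: continuous_comp; [exact: ec|exact: cvg_snd].
Qed.

Variable s0 : S.
Local Notation y0 := (toR (chart s0 s0)).
Local Notation m0 := (sgm s0 p0).

Definition sh (y : 'rV[R]_(N + N)) : S := cinv s0 (ofR y).

Lemma sh_base : sh y0 = s0.
Proof. by rewrite /sh toRK (mfd_inv (ss_manifold hS) (mfd_mem (ss_manifold hS) s0)). Qed.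

Lemma sh_continuous : {for y0, continuous sh}.
Proof.
apply: (@continuous_comp _ _ _ (@ofR R N : ('rV[R]_(N + N) : normedModType R) ->
  ('rV[C]_N : normedModType C)) (cinv s0)).
  exact: ofR_continuous.
rewrite toRK.
exact: (mfd_inv_cont (ss_manifold hS) (mfd_mem (ss_manifold hS) s0)).
Qed.

(** Evaluation in coordinates of S and P1 jointly: moving the section and moving along it become
    directional derivatives of one smooth map. *)
Definition evl p (X : 'rV[R]_(N + N + (1 + 1))) : T :=
  chart (sgm s0 p) (sgm (sh (lsubmx X)) (cinv p (rsubmx X))).

Lemma evlE p y x : evl p (row_mx y x) = chart (sgm s0 p) (sgm (sh y) (cinv p x)).
Proof. by rewrite /evl row_mxKl row_mxKr. Qed.

Lemma evl_smooth p : smooth_at (evl p) (row_mx y0 (chart p p)).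
Proof.
move=> k; have [[_ es] _] := ss_holomorphic hS.
have := Ck_at_rsubmx (es (s0, p) k); congr Ck_at.
by apply/funext => X /=; rewrite row_mxKr.
Qed.

Lemma near_evl p : \forall X \near (row_mx y0 (chart p p) : 'rV[R]_(N + N + (1 + 1))),
  cdom (sgm s0 p) (sgm (sh (lsubmx X)) (cinv p (rsubmx X))).
Proof.
pose X0 : 'rV[R]_(N + N + (1 + 1)) := row_mx y0 (chart p p).
have lX : lsubmx X0 = y0 by rewrite row_mxKl.
have rX : rsubmx X0 = chart p p by rewrite row_mxKr.
apply: (@chart_comp_near _ _ _ hM _
  (fun X : 'rV[R]_(N + N + (1 + 1)) => sgm (sh (lsubmx X)) (cinv p (rsubmx X)))).
  apply: sgm_continuous.
    apply: (@continuous_comp _ _ _ (fun X : 'rV[R]_(N + N + (1 + 1)) => lsubmx X) sh).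
      exact/rV_linear_continuous/lsubmx_linear.
    by rewrite -/X0 lX; exact: sh_continuous.
  apply: (@continuous_comp _ _ _ (fun X : 'rV[R]_(N + N + (1 + 1)) => rsubmx X) (cinv p : _ -> P1)).
    exact/rV_linear_continuous/rsubmx_linear.
  exact: P1_cinv_continuous.
by rewrite -/X0 lX rX sh_base (P1_cinvK (P1_mem p)); exact: (mfd_mem hM).
Qed.

Lemma slice_differentiable p x : differentiable (evl p) (row_mx y0 x) ->
  differentiable (chart (sgm s0 p) \o (fun y => sgm (sh y) (cinv p x))) y0 /\
  forall u, 'd (chart (sgm s0 p) \o (fun y => sgm (sh y) (cinv p x))) y0 u =
    'D_(row_mx u 0) (evl p) (row_mx y0 x).
Proof.
move=> D.
have E : chart (sgm s0 p) \o (fun y => sgm (sh y) (cinv p x)) =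
    (fun y => evl p (row_mx y x)) by apply/funext => y; rewrite evlE.
have D2 : differentiable (fun y => evl p (row_mx y x)) y0.
  apply: (@differentiable_comp _ _ _ _ (fun y => row_mx y x) (evl p)); last exact: D.
  exact: (@Ck_at_differentiable _ _ _ 0 _ _ (Ck_at_row_mxl 1 x y0)).
rewrite E; split=> [|u]; first exact: D2.
by rewrite -(deriveE u D2) derive_row_mxl.
Qed.

Lemma deformationE w p : deformation ev s0 w p =
  row_mx 0 ('d (chart (sgm s0 p) \o (fun y => sgm (sh y) p)) y0 (toR w)).
Proof.
have D := @Ck_at_differentiable _ _ _ 0 _ _ (evl_smooth p 1).
have [] := slice_differentiable D; rewrite (P1_cinvK (P1_mem p)) => D2 _.
have dc : differentiable (fun _ : 'rV[R]_(N + N) => chart p p : E2) y0.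
  exact: differentiable_cst.
have [_ E] := is_diff_row_mx dc D2.
rewrite /deformation /tmap.
have -> : @chart R _ (Z M) (ev s0 p) \o (fun s' => ev s' p) \o @cinv R _ (realify S) s0 =
    (fun y => row_mx (chart p p) ((chart (sgm s0 p) \o (fun y => sgm (sh y) p)) y)).
  apply/funext => y.
  exact: (congr2 (fun u v : P1 => row_mx (chart u v) (chart (sgm s0 p) (sgm (sh y) p)))
    ((ev_is_section s0).2 p) ((ev_is_section (sh y)).2 p)).
by apply: etrans (E _) _; congr row_mx; rewrite (diff_cst (chart p p : E2)).
Qed.

(** Holds on a neighbourhood of 0, so that it can be differentiated along s in
    [derive_energy_part]. *)
Lemma vloc_deformation w : \forall x \near (0 : E2),
  vloc (sgm s0) (deformation ev s0 w) p0 x = 'D_(row_mx (toR w) 0) (evl p0) (row_mx y0 x).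
Proof.
have [dN _] := evl_smooth p0 1.
have N1 := near_evl p0.
rewrite chart_P1pt0 in dN N1.
have rc : {for (0 : E2), continuous (fun x : E2 => row_mx y0 x : 'rV[R]_(N + N + (1 + 1)))}.
  exact: (Ck_at_continuous (Ck_at_row_mxr 0 y0 0)).
have dN' : \forall x \near (0 : E2), differentiable (evl p0) (row_mx y0 x) := rc _ dN.
have N1' : \forall x \near (0 : E2), cdom m0 (sgm s0 (cinv p0 x)).
  have N2 : \forall x \near (0 : E2), cdom m0 (sgm (sh (lsubmx (row_mx y0 x)))
    (cinv p0 (rsubmx (row_mx y0 x)))) := rc _ N1.
  by apply: filterS N2 => x; rewrite row_mxKl row_mxKr sh_base.
apply: filterS2 dN' N1' => x dx xd.
have [D E] := slice_differentiable dx.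
have cf : {for y0, continuous (fun y => sgm (sh y) (cinv p0 x))}.
  by apply: (@sgm_continuous _ sh (fun=> cinv p0 x)); [exact: sh_continuous|exact: cst_continuous].
have xd' : cdom m0 (sgm (sh y0) (cinv p0 x)) by rewrite sh_base.
have [_ E2] := diff_to_frame hM cf xd' D.
rewrite /vloc deformationE row_mxKr -E.
rewrite sh_base in E2.
by apply: etrans (congr1 (coframe _ _) (E2 _)) _; exact: coframeK.
Qed.

End SectionSpace.

(** * Real derivatives of the energy *)

Section EnergyDerivative.
Variables (R : realType) (n : nat) (M : charted R n) (g : M -> 'M[R]_n).
Variables (I J K : M -> {linear 'rV[R]_n -> 'rV[R]_n}).
Hypothesis hk : is_hyperkaehler g I J K.
Let hM : is_manifold M := hk_manifold hk.
Local Notation C := (R[i]).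
Local Notation T := ('rV[R]_n).
Local Notation P1 := (P1 R).
Local Notation E2 := ('rV[R]_(1 + 1)).
Variable a : C -> M -> M.
Hypothesis hka : is_hk_circle_action g I J K a.
Let ha : is_circle_action a := hka_action hka.
Variable mu : M -> C.
Variables (r N : nat) (S : charted C N) (ev : S -> P1 -> Z M).
Hypothesis hS : is_section_space I J K r ev.
Local Notation p0 := (P1pt (0 : C)).
Local Notation e1 := (row_mx 1%:M 0 : E2).
Local Notation sgm := (sgm ev).

Lemma generator_actZ m : rsubmx (@generator _ _ (Z M) (actZ a) (p0, m)) = generator a m.
Proof.
have D : differentiable (fun t : R => chart m (a (expi t) m)) 0.
  have -> : (fun t : R => chart m (a (expi t) m)) =
      actl a m \o (fun t : R => tl t (chart m m)).
    apply/funext => t; rewrite /actl /comp time_tl rsubmx_tl.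
    by rewrite (mfd_inv hM (mfd_mem hM m)).
  apply: (@Ck_at_differentiable _ _ _ 0).
  exact: (@Ck_at_comp _ _ _ _ 1 (actl a m) (fun t : R => tl t (chart m m)) 0
    (actl_smooth ha m 1) (Ck_at_tl_time 1 _ 0)).
rewrite /generator.
have -> : (fun t : R => @chart R _ (Z M) (p0, m) (actZ a (expi t) (p0, m))) =
    (fun t => row_mx (chart p0 p0) (chart m (a (expi t) m))).
  apply/funext => t; rewrite /actZ /= .
  by congr row_mx; congr toR; apply/rowP => j; rewrite !mxE mulr0.
have dc : differentiable (fun _ : R => chart p0 p0 : E2) 0 by exact: differentiable_cst.
have [D2 E] := is_diff_row_mx dc D.
rewrite !derive1E; apply: etrans (congr1 (fun z => rsubmx z) (deriveE (1 : R) D2)) _.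
apply: etrans (congr1 (fun z => rsubmx z) (E 1)) _; rewrite row_mxKr.
by apply: esym; exact: deriveE.
Qed.

(** The twistor line is constant in M, so subtracting its velocity in the energy leaves the
    M-component of ds unchanged. *)
Lemma dot0_twistor_line m : rsubmx (@dot0 R n M (twistor_line m)) = 0.
Proof.
rewrite /dot0 /tmap.
have -> : @chart R _ (Z M) (twistor_line m p0) \o @twistor_line R n M m \o cinv p0 =
    (fun y : E2 => row_mx ((fun y => y) y) (chart m m)).
  by apply/funext => y /=; congr row_mx; exact: (P1_chartK p0).
have di := @is_diff_id _ _ (chart p0 p0).
have dc : differentiable (fun _ : E2 => chart m m) (chart p0 p0).
  exact: differentiable_cst.
have [_ E] := is_diff_row_mx (@ex_diff _ _ _ _ _ _ _ di) dc.
apply: etrans (congr1 (fun z => rsubmx z) (E _)) _; rewrite row_mxKr.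
by rewrite (diff_cst (chart m m)).
Qed.

Lemma energyE s (m := sgm s p0) : energy g J K a mu (ev s) =
  2^-1 * kformJK g J K m (generator a m) ('d (sloc (sgm s) p0) 0 e1) + mu m.
Proof.
have e0 : ev s p0 = (p0, m) by rewrite (ev_graph hS s).
have E1 : rsubmx (@generator _ _ (Z M) (actZ a) (ev s p0)) = generator a m.
  by rewrite e0 generator_actZ.
have E2 : rsubmx (dot0 (ev s) - @dot0 R n M (twistor_line m)) =
    'd (sloc (sgm s) p0) 0 e1.
  have LB (A B : 'rV[R]_(1 + 1 + n)) : rsubmx (A - B) = rsubmx A - rsubmx B.
    exact: linearB.
  apply: etrans (LB (dot0 (ev s)) (@dot0 R n M (twistor_line m))) _.
  apply: etrans (congr1 (fun z => _ - z) (dot0_twistor_line m)) _.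
  apply: etrans (subr0 _) _.
  rewrite /dot0 (ev_graph hS s).
  apply: etrans (congr1 (fun z => rsubmx z) (tmap_graph p0 e1 (sgm_section hS s).1.1)) _.
  by rewrite row_mxKr chart_P1pt0.
by apply: (congr2 (fun v w => 2^-1 * kformJK g J K m v w + mu m) E1 E2).
Qed.

Lemma genS_at0 s : holomorphic_at0 I (sgm s) (genS a (sgm s)).
Proof.
apply: (holomorphic_along_at0 hk (sgm_section hS s)).
  by apply: filterE => y; exact: (genS_vertical hk hka (sgm_section hS s)).
exact: (genS_holomorphic hk hka (sgm_section hS s)).
Qed.

Lemma H0_at0 s V : H0 I J K (ev s) V -> holomorphic_at0 I (sgm s) V.
Proof.
rewrite (ev_graph hS s) => hV; apply: (holomorphic_along_at0 hk (sgm_section hS s)).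
  by apply: filterE => y; apply/verticalE; exact: (hV (cinv p0 y) Logic.I).1.
exact: (hV p0 Logic.I).2.
Qed.

Lemma deformation_at0 s w : holomorphic_at0 I (sgm s) (deformation ev s w).
Proof. exact/H0_at0/(ss_tangent hS). Qed.

Variable s0 : S.
Local Notation y0 := (toR (chart s0 s0)).
Local Notation m0 := (sgm s0 p0).
Local Notation c0 := (chart m0 m0).
Local Notation sh := (sh s0).
Local Notation F := (evl ev s0 p0).
Local Notation X := (genl a m0).
Local Notation B L := (loc2 (kform g L) m0).

Definition base_loc (y : 'rV[R]_(N + N)) : T := F (row_mx y 0).
Definition dot_loc (y : 'rV[R]_(N + N)) : T := 'D_(row_mx 0 e1) F (row_mx y 0).
Lemma F_smooth : smooth_at F (row_mx y0 0).
Proof. by have := evl_smooth hS s0 p0; rewrite chart_P1pt0. Qed.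

Lemma base_loc_base : base_loc y0 = c0.
Proof. by rewrite /base_loc evlE (sh_base hS) cinv_zero. Qed.

Lemma base_loc_smooth : smooth_at base_loc y0.
Proof.
move=> k; exact: (@Ck_at_comp _ _ _ _ k F (fun y => row_mx y 0) y0 (F_smooth k)
  (Ck_at_row_mxl k 0 y0)).
Qed.

Lemma dot_loc_smooth : smooth_at dot_loc y0.
Proof.
move=> k; exact: (@Ck_at_comp _ _ _ _ k ('D_(row_mx 0 e1) F) (fun y => row_mx y 0) y0
  ((F_smooth k.+1).2 _) (Ck_at_row_mxl k 0 y0)).
Qed.

(** The energy of a nearby section is formed in the preferred chart of its own value at 0. Moved to
    the one chart at m0, it becomes an explicit function of the coordinates of the section. *)
Lemma energy_near : \forall y \near y0, energy g J K a mu (ev (sh y)) =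
  2^-1 * (B J (base_loc y) (X (base_loc y)) (dot_loc y) +i*
          B K (base_loc y) (X (base_loc y)) (dot_loc y)) + mu (cinv m0 (base_loc y)).
Proof.
have rc : {for y0, continuous (fun y => row_mx y 0 : 'rV[R]_(N + N + (1 + 1)))}.
  exact: (Ck_at_continuous (Ck_at_row_mxl 0 0 y0)).
have N1 := near_evl hk hS s0 p0; rewrite chart_P1pt0 in N1.
have N2 : \forall y \near y0, cdom m0 (sgm (sh (lsubmx (row_mx y 0)))
    (cinv p0 (rsubmx (row_mx y 0 : 'rV[R]_(N + N + (1 + 1)))))) := rc _ N1.
have [dF _] := F_smooth 1.
have N3 : \forall y \near y0, differentiable F (row_mx y 0) := rc _ dF.
have bc : {for y0, continuous base_loc} := Ck_at_continuous (base_loc_smooth 0).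
have N4 : \forall y \near y0, generator a (cinv m0 (base_loc y)) =
    frame m0 (base_loc y) (X (base_loc y)).
  apply: (bc (fun z => generator a (cinv m0 z) = frame m0 z (X z))).
  by rewrite base_loc_base; exact: generator_genl.
apply: filterS3 N2 N3 N4 => y; rewrite row_mxKl row_mxKr cinv_zero => yd dFy yg.
have Em : cinv m0 (base_loc y) = sgm (sh y) p0.
  by rewrite /base_loc evlE cinv_zero (mfd_inv hM yd).
have Eb : base_loc y = chart m0 (sgm (sh y) p0) by rewrite /base_loc evlE cinv_zero.
rewrite energyE -Em yg; congr (_ * _ + _).
have cf : {for (0 : E2), continuous (sgm (sh y) \o cinv p0)}.
  apply: continuous_comp; first exact: P1_cinv_continuous.
  exact: (smooth_graph (sgm_section hS (sh y)).1.1).1.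
have EF : chart m0 \o (sgm (sh y) \o cinv p0) = (fun x => F (row_mx y x)).
  by apply/funext => x; rewrite evlE.
have D : differentiable (chart m0 \o (sgm (sh y) \o cinv p0)) 0.
  rewrite EF; apply: (@differentiable_comp _ _ _ _ (fun x => row_mx y x) F); last exact: dFy.
  exact: (@Ck_at_differentiable _ _ _ 0 _ _ (Ck_at_row_mxr 1 y 0)).
have fd : cdom m0 ((sgm (sh y) \o cinv p0) 0) by rewrite /comp cinv_zero.
have [_ E] := diff_to_frame hM cf fd D.
have Ew : 'd (sloc (sgm (sh y)) p0) 0 e1 = frame m0 (base_loc y) (dot_loc y).
  move: E; rewrite /comp cinv_zero -Eb => E.
  apply: etrans (E e1) _; congr frame.
  apply: etrans (esym (deriveE _ D)) _; rewrite EF; exact: derive_row_mxr.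
by rewrite Ew /kformJK /loc2.
Qed.

(** Both derivatives have three terms. Those with a second derivative of evaluation agree by
    Schwarz: the variation of ds_0(e1) along the deformation V is the derivative of V along s. The
    remaining two agree by [moment_identity] with u = ds_0(e1) and v = V(0). *)
Lemma derive_energy_part L w : L = J \/ L = K ->
  let f y := B L (base_loc y) (X (base_loc y)) (dot_loc y) in
  differentiable f y0 /\
  'D_(toR w) f y0 = 'D_e1 (pairing g (sgm s0) (genS a (sgm s0)) (deformation ev s0 w) L) 0.
Proof.
move=> LJK f.
have hL : is_kaehler g L by case: LJK => ->; [exact: hk_J hk|exact: hk_K hk].
have db := @Ck_at_differentiable _ _ _ 0 _ _ (base_loc_smooth 1).
have dd := @Ck_at_differentiable _ _ _ 0 _ _ (dot_loc_smooth 1).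
have dX : differentiable X (base_loc y0).
  by rewrite base_loc_base; exact: (@Ck_at_differentiable _ _ _ 0 _ _ (genl_smooth ha m0 1)).
have dXb : differentiable (fun y => X (base_loc y)) y0.
  exact: (@differentiable_comp _ _ _ _ base_loc X).
have dB p q : differentiable (fun y => B L y p q) (base_loc y0).
  by rewrite base_loc_base; exact: (loc2_differentiable hk).
have [D E] := @derive_family2 _ _ _ _ (B L) base_loc (fun y => X (base_loc y)) dot_loc y0 (toR w)
  (loc2_linearr g m0 L) (loc2_linearl g m0 L) dB db dXb dd.
split; first exact: D.
pose Phi := sloc (sgm s0) p0.
pose v := 'D_(row_mx (toR w) 0) F (row_mx y0 0).
have EPhi : Phi = (fun x => F (row_mx y0 x)).
  by apply/funext => x; rewrite evlE (sh_base hS).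
have Eu : dot_loc y0 = 'D_e1 Phi 0.
  by apply: etrans (esym (derive_row_mxr F 0 y0 e1)) _; rewrite -EPhi.
have Ev : 'D_(toR w) base_loc y0 = v := derive_row_mxl F 0 y0 (toR w).
have EX : 'D_(toR w) (fun y => X (base_loc y)) y0 = 'D_v X c0.
  apply: etrans (deriveE (toR w) dXb) _.
  apply: etrans (diff_compE (toR w) db dX) _.
  by apply: etrans (esym (deriveE _ dX)) _; rewrite -(deriveE (toR w) db) Ev base_loc_base.
have nV := vloc_deformation hk hS s0 w.
have Ed : 'D_(toR w) dot_loc y0 = 'D_e1 (vloc (sgm s0) (deformation ev s0 w) p0) 0.
  apply: etrans (derive_row_mxl ('D_(row_mx 0 e1) F) 0 y0 (toR w)) _.
  apply: etrans (schwarz (row_mx (toR w) 0) (row_mx 0 e1) (F_smooth 2)) _.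
  apply: etrans (esym (derive_row_mxr ('D_(row_mx (toR w) 0) F) 0 y0 e1)) _.
  exact: esym (near_eq_derive e1 nV).
have Ew : rsubmx (deformation ev s0 w p0) = v.
  by rewrite -(vloc_base hk (sgm s0)) (nbhs_singleton nV).
apply: etrans E _.
rewrite (derive_pairing hk (sgm_section hS s0) (genS_at0 s0) (deformation_at0 s0 w) e1 hL).2.
rewrite Ev EX Ed base_loc_base Eu !(loc2_base hk) Ew.
rewrite (genS_base hk hka (sgm_section hS s0)) (derive_genS hk hka (sgm_section hS s0)).
exact: (congr1 (fun z => z + _) (moment_identity hk hka (sgm s0) ('D_e1 Phi 0) v LJK)).
Qed.

End EnergyDerivative.

(** * Complex bilinearity of Omega_0 *)

Section OmegaLinear.
Variables (R : realType) (n : nat) (M : charted R n) (g : M -> 'M[R]_n).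
Variables (I J K : M -> {linear 'rV[R]_n -> 'rV[R]_n}).
Hypothesis hk : is_hyperkaehler g I J K.
Local Notation C := (R[i]).
Local Notation P1 := (P1 R).
Local Notation p0 := (P1pt (0 : C)).
Local Notation e1 := (row_mx 1%:M 0 : 'rV[R]_(1 + 1)).

Lemma twform_Zscalel (z c : C) m V w :
  twform g I J K z m (rsubmx (Zscale I J K (P1pt z, m) c V)) w =
  c * twform g I J K z m (rsubmx V) w.
Proof.
rewrite /Zscale linearD !linearZ /= /JZ row_mxKr /= twformDl !twformZl.
rewrite (twform_Isphere hk) [in RHS](complexE c) mulrDl mulrA.
by congr (_ + _ * _); rewrite mulrC.
Qed.

Lemma twform_Zscaler (z c : C) m v W :
  twform g I J K z m v (rsubmx (Zscale I J K (P1pt z, m) c W)) =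
  c * twform g I J K z m v (rsubmx W).
Proof.
by rewrite (twform_anti hk) twform_Zscalel (twform_anti hk z m v) mulrN.
Qed.

Variable sg : P1 -> M.
Hypothesis hs : is_section I J K (graph_of sg).
Implicit Types V W : P1 -> 'rV[R]_(1 + 1 + n).
Local Notation F V W := (twform_along g I J K sg V W).
Local Notation hol V := (holomorphic_at0 I sg V).

Lemma Omega0_graph V W : hol V -> hol W -> Omega0 g I J K (graph_of sg) V W =
  - (Ci R / 2) * ('D_e1 (pairing g sg V W J) 0 +i* ('D_e1 (pairing g sg V W K) 0 +
     2 * kform g I (sg p0) (rsubmx (V p0)) (rsubmx (W p0)))).
Proof.
move=> hV hW; have D := twform_along_derive hk hs hV hW.
rewrite /Omega0 derive1E; congr (_ * _); exact: (@derive_val _ _ _ _ _ _ _ D).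
Qed.

Lemma Omega0_derivable V W : hol V -> hol W -> derivable (F V W) (0 : C^o) (1 : C^o).
Proof. by move=> hV hW; have [] := twform_along_derive hk hs hV hW. Qed.

Lemma Omega0E V W : Omega0 g I J K (graph_of sg) V W =
  - (Ci R / 2) * 'D_(1 : C^o) (F V W) (0 : C^o).
Proof. by rewrite /Omega0 derive1E. Qed.

Lemma Omega0_scaler V W W' (c : C) : hol V -> hol W ->
  (forall z, W' (P1pt z) = Zscale I J K (graph_of sg (P1pt z)) c (W (P1pt z))) ->
  Omega0 g I J K (graph_of sg) V W' = c * Omega0 g I J K (graph_of sg) V W.
Proof.
move=> hV hW E; rewrite !Omega0E mulrCA; congr (_ * _).
have -> : F V W' = c \*: (F V W).
  by apply/funext => z; rewrite /twform_along E twform_Zscaler.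
exact: (deriveZ c (Omega0_derivable hV hW)).
Qed.

(** [Omega0] is a z-derivative at a point of the affine line, so an expansion of V over finite z is
    enough. *)
Lemma Omega0_suml (I0 : finType) (V' : I0 -> P1 -> 'rV[R]_(1 + 1 + n)) (c : I0 -> C) V W :
  hol W -> (forall i, hol (V' i)) ->
  (forall z, V (P1pt z) =
    \sum_i Zscale I J K (graph_of sg (P1pt z)) (c i) (V' i (P1pt z))) ->
  Omega0 g I J K (graph_of sg) V W =
    \sum_i c i * Omega0 g I J K (graph_of sg) (V' i) W.
Proof.
move=> hW hV' E; rewrite Omega0E.
have tw0 z m w : twform g I J K z m 0 w = 0.
  by have := twformZl g I J K z m 0 0 w; rewrite scale0r => ->; rewrite mul0r.
have EF : F V W = \sum_(i <- enum I0) (c i \*: F (V' i) W).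
  apply/funext => z; rewrite fct_sumE /twform_along E linear_sum /= -big_enum /=.
  elim: (enum I0) => [|i e IH]; first by rewrite !big_nil tw0.
  by rewrite !big_cons twformDl IH twform_Zscalel.
(* Derivability of the partial sums is carried through the induction together with the value. *)
have [D DE] : derivable (\sum_(i <- enum I0) (c i \*: F (V' i) W)) (0 : C^o) (1 : C^o) /\
    'D_(1 : C^o) (\sum_(i <- enum I0) (c i \*: F (V' i) W)) (0 : C^o) =
    \sum_(i <- enum I0) c i * 'D_(1 : C^o) (F (V' i) W) (0 : C^o).
  elim: (enum I0) => [|i e [D DE]].
    rewrite !big_nil; split; first exact: (@derivable_cst _ _ _ (0 : C^o)).
    exact: (@derive_cst _ _ _ (0 : C^o)).
  rewrite !big_cons; have Di := Omega0_derivable (hV' i) hW.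
  split; first exact: (derivableD (derivableZ Di) D).
  rewrite -DE; apply: etrans (deriveD (derivableZ Di) D) _.
  by congr (_ + _); exact: (deriveZ (c i) Di).
rewrite EF DE big_distrr /= big_enum /=; apply: eq_bigr => i _.
by rewrite Omega0E mulrCA.
Qed.

Lemma twform_along0 V W :
  F V W 0 = kformJK g J K (sg p0) (rsubmx (V p0)) (rsubmx (W p0)).
Proof. by rewrite (kformJK_twform g I J K). Qed.

(** The derivative of z F(z) at 0 is F(0), and the twisted form at z = 0 is omega_J + i omega_K. *)
Lemma Omega0_mul_coord V V' W : hol V -> hol W ->
  (forall z, V' (P1pt z) = Zscale I J K (graph_of sg (P1pt z)) z (V (P1pt z))) ->
  Omega0 g I J K (graph_of sg) V' W =
    - (Ci R / 2) * kformJK g J K (sg p0) (rsubmx (V p0)) (rsubmx (W p0)).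
Proof.
move=> hV hW E; rewrite Omega0E; congr (_ * _).
have -> : F V' W = (fun z : C^o => z) * F V W.
  by apply/funext => z; rewrite /twform_along E twform_Zscalel.
rewrite deriveM; [|exact: derivable_id|exact: Omega0_derivable].
rewrite derive_id scale0r add0r twform_along0.
by rewrite /GRing.scale /= mulr1.
Qed.

Lemma Omega0_anti V W : hol V -> hol W ->
  Omega0 g I J K (graph_of sg) V W = - Omega0 g I J K (graph_of sg) W V.
Proof.
move=> hV hW; rewrite !Omega0E -[RHS]mulrN; congr (_ * _).
have -> : F V W = - F W V.
  by apply/funext => z; rewrite /twform_along (twform_anti hk).
exact: (deriveN (Omega0_derivable hW hV)).
Qed.

End OmegaLinear.

(** * Holomorphy of the energy and the moment map equation *)

Section EnergyMomentMap.
Variables (R : realType) (n : nat) (M : charted R n) (g : M -> 'M[R]_n).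
Variables (I J K : M -> {linear 'rV[R]_n -> 'rV[R]_n}).
Hypothesis hk : is_hyperkaehler g I J K.
Let hM : is_manifold M := hk_manifold hk.
Local Notation C := (R[i]).
Local Notation P1 := (P1 R).
Local Notation E2 := ('rV[R]_(1 + 1)).
Variable a : C -> M -> M.
Hypothesis hka : is_hk_circle_action g I J K a.
Let ha : is_circle_action a := hka_action hka.
Variable mu : M -> C.
Hypothesis hmu : is_I_moment_map g I a mu.
Variables (r N : nat) (S : charted C N) (ev : S -> P1 -> Z M).
Hypothesis hS : is_section_space I J K r ev.
Local Notation p0 := (P1pt (0 : C)).
Local Notation e1 := (row_mx 1%:M 0 : E2).
Local Notation sgm := (sgm ev).
Variable s0 : S.
Local Notation y0 := (toR (chart s0 s0)).
Local Notation m0 := (sgm s0 p0).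
Local Notation gS := (genS a (sgm s0)).
Local Notation def := (deformation ev s0).
Local Notation Om := (Omega0 g I J K (graph_of (sgm s0))).

(** Evaluation is holomorphic, so its differential in the direction of S commutes with
    multiplication by i. *)
Lemma deformation_scale (c : C) w p :
  def (c *: w) p = Zscale I J K (ev s0 p) c (def w p).
Proof.
have [[_ es] eh] := ss_holomorphic hS.
pose G (X : 'rV[R]_(N + N + (1 + 1))) : 'rV[R]_(1 + 1 + n) :=
  @chart _ _ (Z M) (ev s0 p) (ev (sh s0 (lsubmx X)) (cinv p (rsubmx X))).
have dG : differentiable G (row_mx y0 (chart p p)).
  exact: (@Ck_at_differentiable _ _ _ 0 _ _ (es (s0, p) 1)).
pose G1 (y : 'rV[R]_(N + N)) : 'rV[R]_(1 + 1 + n) :=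
  @chart _ _ (Z M) (ev s0 p) (ev (sh s0 y) p).
have EG : G1 = G \o (fun y => row_mx y (chart p p)).
  by apply/funext => y; rewrite /G1 /G /comp row_mxKl row_mxKr (P1_cinvK (P1_mem p)).
have dl : differentiable (fun y => row_mx y (chart p p) : 'rV[R]_(N + N + (1 + 1))) y0.
  exact: (@Ck_at_differentiable _ _ _ 0 _ _ (Ck_at_row_mxl 1 (chart p p) y0)).
have dG1 : differentiable G1 y0 by rewrite EG; exact: differentiable_comp.
have E1 u : 'd G1 y0 u = 'd G (row_mx y0 (chart p p)) (row_mx u 0).
  apply: etrans (esym (deriveE u dG1)) _; apply: etrans _ (deriveE (row_mx u 0) dG).
  by rewrite EG; exact: derive_row_mxl.
have EJ u : 'd G1 y0 (stdJ u) = JZ I J K (ev s0 p) ('d G1 y0 u).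
  have := eh (s0, p) (row_mx u 0); rewrite row_mxKl row_mxKr.
  have -> : stdJ (0 : E2) = 0.
    by rewrite /stdJ !linear0 row_mx0.
  by rewrite !E1.
have Ed w' : def w' p = 'd G1 y0 (toR w') by [].
rewrite !Ed toRZ; apply: etrans (linearD _ _ _) _.
apply: etrans (congr2 +%R (linearZ _ _) (linearZ _ _)) _.
by rewrite -[X in _ + X]/(complex.Im c *: 'd G1 y0 (stdJ (toR w))) EJ.
Qed.

Lemma Omega0_deformation_scale (c : C) w : Om gS (def (c *: w)) = c * Om gS (def w).
Proof.
have E z : def (c *: w) (P1pt z) =
    Zscale I J K (graph_of (sgm s0) (P1pt z)) c (def w (P1pt z)).
  by rewrite deformation_scale (ev_graph hS).
exact: (Omega0_scaler hk (sgm_section hS s0) (genS_at0 hk hka hS s0)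
  (deformation_at0 hk hS s0 w) E).
Qed.

Local Notation U := (fun y : 'rV[R]_(N + N) =>
  complex.Re (energy_loc g J K a mu ev s0 (ofR y))).
Local Notation W := (fun y : 'rV[R]_(N + N) =>
  complex.Im (energy_loc g J K a mu ev s0 (ofR y))).

Lemma half_complex (x y : R) : (2 : C)^-1 * (x +i* y) = (2^-1 * x) +i* (2^-1 * y).
Proof.
apply: (mulfI (_ : (2 : C) != 0)); first by rewrite pnatr_eq0.
rewrite mulrA divff ?pnatr_eq0 // mul1r.
apply/eqP; rewrite eq_complex /=; apply/andP.
by split; apply/eqP; field.
Qed.

Lemma ReD (x y : C) : complex.Re (x + y) = complex.Re x + complex.Re y.
Proof. by case: x y => ? ? []. Qed.

Lemma ImD (x y : C) : complex.Im (x + y) = complex.Im x + complex.Im y.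
Proof. by case: x y => ? ? []. Qed.

Lemma energy_Re_derive w : differentiable U y0 /\
  'D_(toR w) U y0 = 2^-1 * 'D_e1 (pairing g (sgm s0) gS (def w) J) 0.
Proof.
have [D E] := derive_energy_part hk hka hS s0 w (or_introl erefl).
have H := has_diff_mul (has_diff_cst (2^-1 : R) y0) (conj D (fun v => erefl)).
have nE : \forall y \near y0, 2^-1 * loc2 (kform g J) m0 (base_loc ev s0 y)
    (genl a m0 (base_loc ev s0 y)) (dot_loc ev s0 y) = U y.
  apply: filterS (energy_near hk hka mu hS s0) => y Ey.
  by rewrite /energy_loc -/(sh s0 y) Ey half_complex ReD (mu_imaginary hmu) addr0.
have [D1 E1] := has_diff_near H nE (fun v => erefl).
split; first exact: D1.
by apply: etrans (E1 _) _; rewrite mulr0 addr0 E.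
Qed.

Lemma energy_Im_derive w : differentiable W y0 /\
  'D_(toR w) W y0 = 2^-1 * 'D_e1 (pairing g (sgm s0) gS (def w) K) 0 +
    kform g I m0 (rsubmx (gS p0)) (rsubmx (def w p0)).
Proof.
have [D E] := derive_energy_part hk hka hS s0 w (or_intror erefl).
have H1 := has_diff_mul (has_diff_cst (2^-1 : R) y0) (conj D (fun v => erefl)).
pose muc y : R := complex.Im (mu (cinv m0 y)).
have dmu : differentiable muc (base_loc ev s0 y0).
  rewrite (base_loc_base hS); exact: (@Ck_at_differentiable _ _ _ 0 _ _ (mu_smooth hmu m0 1)).
have db := @Ck_at_differentiable _ _ _ 0 _ _ (base_loc_smooth hS s0 1).
have dm : differentiable (muc \o base_loc ev s0) y0 by exact: differentiable_comp.
have H := has_diff_add H1 (conj dm (fun v => erefl)).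
have nE : \forall y \near y0, 2^-1 * loc2 (kform g K) m0 (base_loc ev s0 y)
    (genl a m0 (base_loc ev s0 y)) (dot_loc ev s0 y) + (muc \o base_loc ev s0) y = W y.
  apply: filterS (energy_near hk hka mu hS s0) => y Ey.
  by rewrite /energy_loc -/(sh s0 y) Ey half_complex ImD.
have [D1 E1] := has_diff_near H nE (fun v => erefl).
split; first exact: D1.
apply: etrans (E1 _) _; rewrite mulr0 addr0 E; congr (_ + _).
apply: etrans (deriveE (toR w) dm) _; apply: etrans (diff_compE (toR w) db dmu) _.
have Ev : 'd (base_loc ev s0) y0 (toR w) = rsubmx (def w p0).
  apply: etrans (esym (deriveE (toR w) db)) _.
  apply: etrans (derive_row_mxl (evl ev s0 p0) 0 y0 (toR w)) _.
  rewrite -(vloc_base hk (sgm s0)).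
  exact: esym (nbhs_singleton (vloc_deformation hk hS s0 w)).
rewrite Ev (genS_base hk hka (sgm_section hS s0)) -(generator_base hM ha).
rewrite -(mu_moment hmu) /dfun (base_loc_base hS).
by [].
Qed.

(** The product of i and -i/2 is 1/2, the factor of the first term of the energy; against the 2 in 2
    i z omega_I it leaves omega_I(X, .), the differential of Im mu. *)
Lemma energy_derive_Omega0 w :
  'D_(toR w) U y0 +i* 'D_(toR w) W y0 = Ci R * Om gS (def w).
Proof.
rewrite (energy_Re_derive w).2 (energy_Im_derive w).2.
rewrite (Omega0_graph hk (sgm_section hS s0) (genS_at0 hk hka hS s0)
  (deformation_at0 hk hS s0 w)).
have -> (z : C) : Ci R * (- (Ci R / 2) * z) = 2^-1 * z.
  have CC : Ci R * Ci R = -1 by apply/eqP; rewrite eq_complex /= !(mul0r,mul1r,mulr0,sub0r,addr0,oppr0) !eqxx.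
  by rewrite mulNr mulrN mulrA mulrA CC mulN1r mulNr opprK.
rewrite half_complex mulrDr mulrA.
by rewrite mulVf ?pnatr_eq0 // mul1r.
Qed.

Lemma Re_Ci_mul (x y : R) : complex.Re (Ci R * (x +i* y)) = - y.
Proof. by rewrite /= mul0r mul1r sub0r. Qed.

Lemma Im_Ci_mul (x y : R) : complex.Im (Ci R * (x +i* y)) = x.
Proof. by rewrite /= mul0r mul1r add0r. Qed.

(** The real derivative in the direction w is i Omega_0(X_s, w), complex linear in w by
    [Omega0_deformation_scale]; this yields the Cauchy-Riemann equations of the energy. *)
Lemma energy_holomorphic :
  differentiable (energy_loc g J K a mu ev s0) (chart s0 s0) /\
  forall w, denergy g J K a mu ev s0 w = Ci R * Om gS (def w).
Proof.
have dU := (energy_Re_derive 0).1. have dW := (energy_Im_derive 0).1.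
have HQ (Q : 'rV[R]_(N + N) -> C) : (forall w, Q (toR w) = Ci R * Om gS (def w)) ->
    forall w, Q (stdJ w) = Ci R * Q w.
  move=> QE w; have -> : stdJ w = toR (Ci R *: ofR w).
    by rewrite toRZ ofRK scale0r add0r scale1r.
  by rewrite -{2}(ofRK w) !QE Omega0_deformation_scale.
have HJ := HQ (fun w => 'D_w U y0 +i* 'D_w W y0) energy_derive_Omega0.
have [D E] := @cauchy_riemann R N (energy_loc g J K a mu ev s0) (chart s0 s0) dU dW
  (fun w => etrans (congr1 (@complex.Re R) (HJ w)) (Re_Ci_mul _ _))
  (fun w => etrans (congr1 (@complex.Im R) (HJ w)) (Im_Ci_mul _ _)).
split; first exact: D.
by move=> w; apply: etrans (E w) _; exact: energy_derive_Omega0.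
Qed.

End EnergyMomentMap.

(** * Nondegeneracy of Omega0 *)

Section ZscaleAlgebra.
Variables (R : realType) (n : nat) (M : charted R n) (g : M -> 'M[R]_n).
Variables (I J K : M -> {linear 'rV[R]_n -> 'rV[R]_n}).
Hypothesis hk : is_hyperkaehler g I J K.
Local Notation C := (R[i]).
Local Notation Zs := (Zscale I J K).
Implicit Types (q : Z M) (c e : C) (v w : 'rV[R]_(1 + 1 + n)).

Lemma JZ_linear q : linear (JZ I J K q).
Proof.
move=> b v w; rewrite /JZ scale_row_mx add_row_mx -stdJ_linear -Isphere_linear.
have e1 : lsubmx (b *: v + w) = b *: lsubmx v + lsubmx w := lsubmx_linear b v w.
have e2 : rsubmx (b *: v + w) = b *: rsubmx v + rsubmx w := rsubmx_linear b v w.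
by rewrite e1 e2.
Qed.

Lemma JZK q v : JZ I J K q (JZ I J K q v) = - v.
Proof.
rewrite /JZ row_mxKl row_mxKr stdJK (IsphereK hk) -opp_row_mx hsubmxK //.
Qed.

Lemma JZD q v w : JZ I J K q (v + w) = JZ I J K q v + JZ I J K q w.
Proof. by have := JZ_linear q 1 v w; rewrite !scale1r. Qed.

Lemma JZ0 q : JZ I J K q 0 = 0.
Proof. by apply: (addrI (JZ I J K q 0)); rewrite -JZD !addr0. Qed.

Lemma JZZ q (b : R) v : JZ I J K q (b *: v) = b *: JZ I J K q v.
Proof. by have := JZ_linear q b v 0; rewrite !addr0 JZ0 addr0. Qed.

Lemma Zscale0 q v : Zs q 0 v = 0.
Proof. by rewrite /Zscale !scale0r addr0. Qed.

Lemma Zscale1 q v : Zs q 1 v = v.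
Proof. by rewrite /Zscale scale1r scale0r addr0. Qed.

Lemma Zscalev0 q c : Zs q c 0 = 0.
Proof. by rewrite /Zscale JZ0 !scaler0 addr0. Qed.

Lemma ZscaleA q c e v : Zs q c (Zs q e v) = Zs q (c * e) v.
Proof.
case: c e => [x y] [u t]; rewrite /Zscale /= JZD !JZZ JZK.
move: (JZ I J K q v) => w; apply/rowP => j; rewrite !mxE; ring.
Qed.

Lemma Zscale_lsubmx q c v : lsubmx v = 0 -> lsubmx (Zs q c v) = 0.
Proof.
move=> v0; rewrite /Zscale linearD !linearZ /= v0 /JZ row_mxKl v0.
by rewrite /stdJ !linear0 row_mx0 !scaler0 addr0.
Qed.

End ZscaleAlgebra.

(** * Multiplication of a section by a coordinate vanishing at the point *)

Section VanishingCoordinate.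
Variables (R : realType) (n : nat) (M : charted R n) (g : M -> 'M[R]_n).
Variables (I J K : M -> {linear 'rV[R]_n -> 'rV[R]_n}).
Hypothesis hk : is_hyperkaehler g I J K.
Let hM : is_manifold M := hk_manifold hk.
Local Notation T := ('rV[R]_n).
Local Notation P1 := (P1 R).
Local Notation E2 := ('rV[R]_(1 + 1)).
Local Notation l := (fun y : E2 => lsubmx y 0 0 : R).
Local Notation r := (fun y : E2 => rsubmx y 0 0 : R).

Lemma Ck_at_coords k (y : E2) : Ck_at k l y /\ Ck_at k r y.
Proof.
split.
  exact: ((Ck_at_coord k (fun y : E2 => lsubmx y) y).1 (Ck_at_lsubmx (Ck_at_id k y)) 0).
exact: ((Ck_at_coord k (fun y : E2 => rsubmx y) y).1 (Ck_at_rsubmx (Ck_at_id k y)) 0).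
Qed.

(** Passing from z to 1/z only changes the signs of x_1 and x_2, so one sign s and the same rational
    functions serve in both charts. *)
Lemma sphere_cinv (p : P1) : exists s : R, forall y : E2,
  sphere (cinv p y) =
    (s * ((1 + -1 * (l y * l y + r y * r y)) * (1 + (l y * l y + r y * r y))^-1),
     s * ((2 * r y) * (1 + (l y * l y + r y * r y))^-1),
     - 1 * ((2 * l y) * (1 + (l y * l y + r y * r y))^-1)).
Proof.
have E (y : E2) : ofR y 0 0 = lsubmx y 0 0 +i* rsubmx y 0 0 by rewrite mxE.
case: p => [z|]; [exists 1|exists (-1)] => y; rewrite /= E.
  move: (lsubmx y 0 0) (rsubmx y 0 0) => u t /=.
  have -> : 1 + u ^+ 2 + t ^+ 2 = 1 + (u * u + t * t) by rewrite !expr2 addrA.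
  by congr (_, _, _); ring.
move: (lsubmx y 0 0) (rsubmx y 0 0) => u t.
case: eqP => [[-> ->]|ut0] /=.
  by congr (_, _, _); rewrite !(mul0r, mulr0, addr0, invr1, mulr1).
have N0 : u ^+ 2 + t ^+ 2 != 0.
  apply: contra_notN ut0; rewrite paddr_eq0 ?sqr_ge0 // !sqrf_eq0.
  by move=> /andP[/eqP -> /eqP ->].
have N1 : 1 + u ^+ 2 + t ^+ 2 != 0.
  by apply: lt0r_neq0; rewrite -addrA ltr_pwDl // addr_ge0 ?sqr_ge0.
have N2 : 1 + (u / (u ^+ 2 + t ^+ 2)) ^+ 2 + (- t / (u ^+ 2 + t ^+ 2)) ^+ 2 != 0.
  by apply: lt0r_neq0; rewrite -addrA ltr_pwDl // addr_ge0 ?sqr_ge0.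
have N3 : (u ^+ 2 + t ^+ 2) ^+ 2 + u ^+ 2 + (- t) ^+ 2 != 0.
  by apply: lt0r_neq0; rewrite sqrrN -addrA ltr_pwDl ?addr_ge0 ?sqr_ge0 // exprn_even_gt0.
by congr (_, _, _); field; rewrite N0 N3 -!expr2 addrA N1.
Qed.

Variables (sg : P1 -> M) (p : P1).
Hypothesis hs : is_section I J K (graph_of sg).
Hypothesis p_chart : chart p p = 0.
Variables V V' : P1 -> 'rV[R]_(1 + 1 + n).
Hypothesis Vv : forall q, cdom p q -> lsubmx (V q) = 0.
Hypothesis hV : holomorphic_along_at I J K (graph_of sg) V p.
Hypothesis VV' : forall q, cdom p q ->
  V' q = Zscale I J K (graph_of sg q) (ofR (chart p q) 0 0) (V q).

Let vl := vloc sg V p.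
Let loc (L : M -> {linear T -> T}) (y : E2) : T :=
  locE (fun m => L m) (sg p) (sloc sg p y) (vl y).
(** The complex structure of the fibre over the moving point, applied to V; multiplying V by the
    coordinate gives [l y *: vl y + r y *: Q y]. *)
Let Q (y : E2) : T := locE (Isphere I J K (cinv p y)) (sg p) (sloc sg p y) (vl y).

Lemma vloc_smooth : smooth_at vl 0 /\
  forall k L, is_kaehler g L -> Ck_at k (loc L) 0.
Proof.
have Vn : \forall y \near chart p p, lsubmx (V (cinv p y)) = 0.
  by apply: filterE => y; apply: Vv; exact: P1_cdom_cinv.
have [sV _] := (holomorphic_alongE hM (kaehler_smooth (hk_I hk)) (kaehler_smooth (hk_J hk))
  (kaehler_smooth (hk_K hk)) hs Vn).1 hV.
rewrite p_chart in sV; split=> // k L hL.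
have sl := sloc_smooth hs p k; rewrite p_chart in sl.
apply: (@Ck_at_endo _ _ _ _ k (fun y w => locE (fun m => L m) (sg p) y w)
  (sloc sg p) vl 0 _ _ sl (sV k)) => [y|j]; first exact: locE_linear.
have -> : sloc sg p 0 = chart (sg p) (sg p).
  by rewrite -p_chart /sloc /comp (P1_cinvK (P1_mem p)).
exact: (kaehler_smooth hL).
Qed.

Lemma vloc_mul_coord : \forall y \near (0 : E2),
  l y *: vl y + r y *: Q y = vloc sg V' p y.
Proof.
have [sc _] := smooth_graph hs.1.1.
have := near_section hM p sc; rewrite p_chart.
apply: filterS => y yd.
have E : rsubmx (V' (cinv p y)) = l y *: rsubmx (V (cinv p y)) +
    r y *: Isphere I J K (cinv p y) (sg (cinv p y)) (rsubmx (V (cinv p y))).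
  rewrite VV'; last exact: P1_cdom_cinv.
  by rewrite P1_chartK /Zscale linearD !linearZ /= /JZ row_mxKr mxE.
rewrite /vloc E /coframe linearD !linearZ; congr (_ + _ *: _).
have Es : cinv (sg p) (sloc sg p y) = sg (cinv p y) := mfd_inv hM yd.
have fv : frame (sg p) (sloc sg p y) (vl y) = rsubmx (V (cinv p y)) := frameK hM _ yd.
by rewrite /Q /locE fv Es.
Qed.

Lemma Ck_at_scale k (c : E2 -> R) (f : E2 -> T) y :
  Ck_at k c y -> Ck_at k f y -> Ck_at k (fun y => c y *: f y) y.
Proof.
move=> hc hf; apply/Ck_at_coord => j.
rewrite (_ : (fun y => _) = fun y => c y * f y 0 j).
  exact: Ck_at_mul hc ((Ck_at_coord k f y).1 hf j).
by apply/funext => z; rewrite !mxE.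
Qed.

Lemma mul_coord_smooth : smooth_at Q 0.
Proof.
have [s Es] := sphere_cinv p; have [_ sL] := vloc_smooth.
move=> k; have [cl cr] := Ck_at_coords k 0.
pose N (y : E2) := 1 + (l y * l y + r y * r y).
have cn : Ck_at k (fun y => l y * l y + r y * r y) 0.
  by apply: Ck_at_add; apply: Ck_at_mul.
have N0 : N 0 != 0 by rewrite /N !mxE !mulr0 !addr0 oner_eq0.
have cN : Ck_at k (fun y => (N y)^-1) 0.
  by apply: Ck_at_inv N0 _; apply: Ck_at_add cn; exact: Ck_at_cst.
rewrite (_ : Q = fun y => (s * ((1 + -1 * (l y * l y + r y * r y)) * (N y)^-1)) *: loc I y
  + (s * ((2 * r y) * (N y)^-1)) *: loc J y + (- 1 * ((2 * l y) * (N y)^-1)) *: loc K y).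
  have c2 (c : R) f : Ck_at k f (0 : E2) -> Ck_at k (fun y => c * f y) 0.
    by move=> hf; apply: Ck_at_mul hf; exact: Ck_at_cst.
  apply: Ck_at_add; [apply: Ck_at_add|]; apply: Ck_at_scale.
  - apply: (c2); apply: Ck_at_mul cN; apply: Ck_at_add (c2 _ _ cn); exact: Ck_at_cst.
  - exact: sL (hk_I hk).
  - apply: (c2); apply: Ck_at_mul cN; exact: c2.
  - exact: sL (hk_J hk).
  - apply: (c2); apply: Ck_at_mul cN; exact: c2.
  - exact: sL (hk_K hk).
by apply/funext => y; rewrite /Q locE_Isphere Es.
Qed.

(* Since [V' p = 0], the term of the Cauchy-Riemann equation that differentiates
   the complex structure vanishes at p, and dV' only involves [V p]. *)
Lemma hol_mul_coord : holomorphic_along_at I J K (graph_of sg) V' p.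
Proof.
have p0 : cdom p p := P1_mem p.
have V'v q : cdom p q -> lsubmx (V' q) = 0.
  by move=> pq; rewrite VV' // Zscale_lsubmx // Vv.
have V'p : V' p = 0.
  have -> : V' p = Zscale I J K (graph_of sg p) 0 (V p).
    by rewrite VV' // p_chart -(toR0 R 1) toRK mxE.
  exact: Zscale0.
have V'n : \forall y \near chart p p, lsubmx (V' (cinv p y)) = 0.
  by apply: filterE => y; apply: V'v; exact: P1_cdom_cinv.
apply/(holomorphic_alongE hM (kaehler_smooth (hk_I hk)) (kaehler_smooth (hk_J hk))
  (kaehler_smooth (hk_K hk)) hs V'n).
have [sV _] := vloc_smooth.
rewrite p_chart; split=> [k|b].
  apply: (Ck_at_near vloc_mul_coord); have [cl cr] := Ck_at_coords k 0.
  apply: Ck_at_add; first exact: Ck_at_scale cl (sV k).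
  exact: Ck_at_scale cr (mul_coord_smooth k).
have D u : 'D_u (vloc sg V' p) 0 =
    l u *: rsubmx (V p) + r u *: Isphere I J K p (sg p) (rsubmx (V p)).
  apply: etrans (esym (near_eq_derive u vloc_mul_coord)) _.
  have dl := @Ck_at_differentiable _ _ _ 0 _ _ (Ck_at_coords 1 0).1.
  have dr := @Ck_at_differentiable _ _ _ 0 _ _ (Ck_at_coords 1 0).2.
  have [d1 Ed1] := derive_scale_rV u dl (@Ck_at_differentiable _ _ _ 0 _ _ (sV 1)).
  have [d2 Ed2] := derive_scale_rV u dr (@Ck_at_differentiable _ _ _ 0 _ _ (mul_coord_smooth 1)).
  apply: etrans (deriveD (diff_derivable d1) (diff_derivable d2)) _.
  apply: etrans (congr2 +%R Ed1 Ed2) _.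
  have ll : linear (l : _ -> R^o) by move=> x w z; rewrite !mxE.
  have rl : linear (r : _ -> R^o) by move=> x w z; rewrite !mxE.
  have [Dl el] := linear_is_diff (0 : E2) ll (rV_linear_continuous ll).
  have [Dr er] := linear_is_diff (0 : E2) rl (rV_linear_continuous rl).
  have -> : 'D_u l 0 = l u by apply: etrans (deriveE u Dl) _; rewrite el.
  have -> : 'D_u r 0 = r u by apply: etrans (deriveE u Dr) _; rewrite er.
  have -> : l (0 : E2) = 0 by rewrite !mxE.
  have -> : r (0 : E2) = 0 by rewrite !mxE.
  rewrite !scale0r !add0r.
  have -> : vl 0 = rsubmx (V p).
    by rewrite /vl -p_chart /vloc (P1_cinvK (P1_mem p)) (coframe_id hM).
  have -> : Q 0 = Isphere I J K p (sg p) (vl 0).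
    have sl0 : sloc sg p 0 = chart (sg p) (sg p).
      by rewrite -p_chart /sloc /comp (P1_cinvK (P1_mem p)).
    rewrite /Q /locE sl0 (frame_id hM) (mfd_inv hM (mfd_mem hM (sg p))) (coframe_id hM).
    by rewrite -p_chart (P1_cinvK (P1_mem p)).
  have -> : vl 0 = rsubmx (V p).
    by rewrite /vl -p_chart /vloc (P1_cinvK (P1_mem p)) (coframe_id hM).
  by [].
have V'r : rsubmx (V' p) = 0 by rewrite V'p linear0.
rewrite V'r; apply: esym; apply: etrans (congr1 (+%R _) (derive0 _ _)) _.
apply: etrans (addr0 _) _; rewrite !D.
have lJ : l (stdJ b) = - r b by rewrite /stdJ row_mxKl mxE.
have rJ : r (stdJ b) = l b by rewrite /stdJ row_mxKr.
have Iv : Isphere I J K p (sg p) (r b *: Isphere I J K p (sg p) (rsubmx (V p))) =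
    - (r b *: rsubmx (V p)).
  have := Isphere_linear I J K p (sg p) (r b) (Isphere I J K p (sg p) (rsubmx (V p))) 0.
  rewrite (IsphereK hk) !addr0 => ->.
  have -> : Isphere I J K p (sg p) 0 = 0.
    by rewrite /Isphere !linear0 !addr0.
  by rewrite addr0 scalerN.
by rewrite Isphere_linear Iv lJ rJ scaleNr addrC.
Qed.

End VanishingCoordinate.

(** * Global sections from the two frames *)

Section Frames.
Variables (R : realType) (n : nat) (M : charted R n) (g : M -> 'M[R]_n).
Variables (I J K : M -> {linear 'rV[R]_n -> 'rV[R]_n}).
Hypothesis hk : is_hyperkaehler g I J K.
Local Notation C := (R[i]).
Local Notation P1 := (P1 R).
Local Notation p0 := (P1pt (0 : C)).
Local Notation TZ := ('rV[R]_(1 + 1 + n)).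
Variable sg : P1 -> M.
Hypothesis hs : is_section I J K (graph_of sg).
Local Notation hol := (holomorphic_along_at I J K (graph_of sg)).
Local Notation Zs p := (Zscale I J K (graph_of sg p)).

Lemma holomorphic_along_eq (V W : P1 -> TZ) p :
  (\forall y \near chart p p, V (cinv p y) = W (cinv p y)) -> hol V p -> hol W p.
Proof.
move=> VW [sV CR].
have VWp : V p = W p by have := nbhs_singleton VW; rewrite (P1_cinvK (P1_mem p)).
pose L (U : P1 -> TZ) y := @coframe R _ (Z M) (graph_of sg p) (graph_of sg (cinv p y)) (U (cinv p y)).
have nL : \forall y \near chart p p, L V y = L W y.
  by apply: filterS VW => y; rewrite /L => ->.
have DE b : 'D_b (L V) (chart p p) = 'D_b (L W) (chart p p) := near_eq_derive b nL.
split=> [k|b]; first exact: Ck_at_near nL (sV k).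
by rewrite -VWp; apply: etrans (esym (DE _)) _; apply: etrans (CR b) _; rewrite (DE b).
Qed.

Lemma near_cinv_neq0 p : p <> p0 -> \forall y \near chart p p, cinv p y <> p0.
Proof.
case: p => [z|] pz; last by apply: filterE => y; exact: (@P1_cdom_cinv R (None : P1) y).
have z0 : chart (P1pt z) (P1pt z) != 0.
  apply/eqP => /(congr1 (@ofR R 1)); rewrite toRK -(toR0 R 1) toRK => /rowP/(_ 0).
  by rewrite !mxE /= => z0; apply: pz; rewrite z0.
apply/nbhs_ballP; exists `|chart (P1pt z) (P1pt z)|; first by rewrite /= normr_gt0.
move=> y; rewrite -ball_normE /= => yz [] yy.
have y0 : y = 0.
  by rewrite -(ofRK y) -(toR0 R 1); congr toR; apply/rowP => j; rewrite ord1 yy mxE.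
by move: yz; rewrite y0 subr0 ltxx.
Qed.

(** This and [coord_mul] correspond to the sections 1 and z of O(1): the first vanishes at infinity,
    the second vanishes at 0 and takes its value at infinity from the other frame. *)
Definition extend_by_zero (e : P1 -> TZ) (p : P1) : TZ := if p is Some _ then e p else 0.
Definition coord_mul (e f : P1 -> TZ) (p : P1) : TZ :=
  if p is Some z then Zs p z (e p) else f p.

Variables (r : nat) (e f : 'I_r -> P1 -> TZ).
Hypothesis fe : vertical_frame_on I J K [set p | p <> P1inf R] (graph_of sg) e.
Hypothesis ff : vertical_frame_on I J K [set p | p <> p0] (graph_of sg) f.
Hypothesis ef : forall k (z : C), z != 0 -> f k (P1pt z) = Zs (P1pt z) z (e k (P1pt z)).

(** Near infinity the section is f_k times 1/z, the coordinate that vanishes there, so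
    [hol_mul_coord] applies at infinity. *)
Lemma H0_extend k : H0 I J K (graph_of sg) (extend_by_zero (e k)).
Proof.
move=> [z|] _.
  have zi : Some z <> None :> P1 by [].
  exact: fe.1 k (Some z) zi.
split; first by apply/verticalE; rewrite /extend_by_zero linear0.
apply: (hol_mul_coord hk hs _ (V := f k)) => [|q qi||[z|] qi].
- by rewrite /= -(toR0 R 1); congr toR; apply/rowP => j; rewrite !mxE.
- by apply/verticalE; exact: (ff.1 k q qi).1.
- by apply: (ff.1 k None _).2.
- have z0 : z != 0 by apply/eqP => z0; apply: qi; rewrite z0.
  rewrite -[Some z]/(P1pt z) ef // toRK mxE (ZscaleA hk) mulVf // Zscale1 //.
- by rewrite toRK mxE Zscale0.
Qed.

(** At 0 the section is e_k times the vanishing coordinate z; away from 0 it coincides with f_k. *)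
Lemma H0_coord_mul k : H0 I J K (graph_of sg) (coord_mul (e k) (f k)).
Proof.
have ev q : q <> P1inf R -> lsubmx (e k q) = 0.
  by move=> qi; apply/verticalE; exact: (fe.1 k q qi).1.
move=> p _; have [->|pn0] := pselect (p = p0).
  split; first by apply/verticalE; rewrite /coord_mul /= Zscale_lsubmx // ev.
  apply: (hol_mul_coord hk hs _ (V := e k)) => [|q qi||[z|] qi] //.
  - exact: chart_P1pt0.
  - exact: ev.
  - by apply: (fe.1 k (p0) _).2.
  - by rewrite toRK mxE.
have E q : q <> p0 -> f k q = coord_mul (e k) (f k) q.
  case: q => [z|] // q0; rewrite /coord_mul -ef //.
  by apply/eqP => z0; apply: q0; rewrite z0.
have [vf hf] := ff.1 k p pn0; split; first by rewrite -E.
by apply: (holomorphic_along_eq _ hf); apply: filterS (near_cinv_neq0 pn0) => y /E.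
Qed.

End Frames.

Section Nondegeneracy.
Variables (R : realType) (n : nat) (M : charted R n) (g : M -> 'M[R]_n).
Variables (I J K : M -> {linear 'rV[R]_n -> 'rV[R]_n}).
Hypothesis hk : is_hyperkaehler g I J K.
Local Notation C := (R[i]).
Local Notation P1 := (P1 R).
Local Notation p0 := (P1pt (0 : C)).
Local Notation TZ := ('rV[R]_(1 + 1 + n)).
Variables (r N : nat) (S : charted C N) (ev : S -> P1 -> Z M).
Hypothesis hS : is_section_space I J K r ev.
Hypothesis rN : (r + r = N)%N.
Variable s0 : S.
Local Notation def := (deformation ev s0).
Local Notation sg := (sgm ev s0).
Local Notation Zs p := (Zscale I J K (graph_of sg p)).
Local Notation Om := (Omega0 g I J K (graph_of sg)).
Let hs := sgm_section hS s0.

Lemma deformation_sum (I0 : finType) (c : I0 -> C) (w : I0 -> 'rV[C]_N) p :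
  def (\sum_i c i *: w i) p = \sum_i Zs p (c i) (def (w i) p).
Proof.
have dD x y : def (x + y) p = def x p + def y p.
  by rewrite /deformation toR_additive /tmap linearD.
have d0 : def 0 p = 0 by rewrite /deformation toR0 /tmap linear0.
rewrite (big_morph (fun w => def w p) dD d0); apply: eq_bigr => i _.
by rewrite (deformation_scale hS) (ev_graph hS s0).
Qed.

Lemma kformJK_Zscalel m c V w : kformJK g J K m (rsubmx (Zscale I J K (p0, m) c V)) w =
  c * kformJK g J K m (rsubmx V) w.
Proof. by rewrite !(kformJK_twform g I J K) (twform_Zscalel hk). Qed.

Lemma kformJK_anti m v w : kformJK g J K m v w = - kformJK g J K m w v.
Proof. by rewrite !(kformJK_twform g I J K) (twform_anti hk). Qed.

Lemma kformJK0l m w : kformJK g J K m 0 w = 0.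
Proof.
rewrite (kformJK_twform g I J K).
by have := twformZl g I J K 0 m 0 0 w; rewrite scale0r => ->; rewrite mul0r.
Qed.

Lemma kformJK_suml (I0 : finType) (c : I0 -> C) (V : I0 -> TZ) m w :
  kformJK g J K m (rsubmx (\sum_i Zscale I J K (p0, m) (c i) (V i))) w =
  \sum_i c i * kformJK g J K m (rsubmx (V i)) w.
Proof.
rewrite linear_sum /= -!big_enum /=.
elim: (enum I0) => [|i e IH]; first by rewrite !big_nil kformJK0l.
rewrite !big_cons -IH -kformJK_Zscalel !(kformJK_twform g I J K) twformDl //.
Qed.

Lemma Omega0_nondegenerate V : H0 I J K (ev s0) V ->
  (forall w, Om V (def w) = 0) -> forall p, V p = 0.
Proof.
move=> hV Om0.
have [e [f [fe ff ef]]] := ev_pullback hS s0.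
rewrite (ev_graph hS s0) in fe ff ef.
pose E k := extend_by_zero (e k); pose F k := coord_mul I J K sg (e k) (f k).
have hE k : H0 I J K (ev s0) (E k) by rewrite (ev_graph hS s0); exact: (H0_extend hk hs fe ff ef).
have hF k : H0 I J K (ev s0) (F k) by rewrite (ev_graph hS s0); exact: (H0_coord_mul hk hs fe ff ef).
have FE k z : F k (P1pt z) = Zs (P1pt z) z (E k (P1pt z)) by [].
have frameE z v : lsubmx v = 0 -> exists! c : 'rV[C]_r, v = \sum_(k < r) Zs (P1pt z) (c 0 k) (E k (P1pt z)).
  by move=> v0; apply: (fe.2 (P1pt z)) => //; apply/verticalE.
have wE k : exists w, def w = E k by have [w [h _]] := ss_tangent_iso hS (hE k); exists w.
have wF k : exists w, def w = F k by have [w [h _]] := ss_tangent_iso hS (hF k); exists w.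
have [we Ewe] := choice wE; have [wf Ewf] := choice wF.
(* The rows are the coordinates in T_s S of the sections e_k, followed by those of z e_k. *)
pose A : 'M[C]_(r + r, N) := \matrix_(i < r + r) (match fintype.split i with inl k => we k | inr k => wf k end).
have defA (c : 'rV[C]_(r + r)) p : def (c *m A) p =
    \sum_k Zs p (lsubmx c 0 k) (E k p) + \sum_k Zs p (rsubmx c 0 k) (F k p).
  rewrite mulmx_sum_row deformation_sum big_split_ord /=; congr (_ + _).
    by apply: eq_bigr => k _; rewrite rowK (unsplitK (inl k)) Ewe mxE.
  by apply: eq_bigr => k _; rewrite rowK (unsplitK (inr k)) Ewf mxE.
have uniqE z (c c' : 'rV[C]_r) : \sum_k Zs (P1pt z) (c 0 k) (E k (P1pt z)) =
    \sum_k Zs (P1pt z) (c' 0 k) (E k (P1pt z)) -> c = c'.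
  move=> cc'; have [|b [_ ub]] := frameE z (\sum_k Zs (P1pt z) (c 0 k) (E k (P1pt z))).
    rewrite linear_sum big1 //= => k _; apply: Zscale_lsubmx.
    by apply/verticalE; exact: (hE k (P1pt z) Logic.I).1.
  by rewrite -(ub c) // -(ub c').
(* At z = 0 the sections z e_k vanish, which kills the first half of c; at z = 1 they equal e_k,
   which kills the second half. *)
have Af : row_free A.
  apply: inj_row_free => c cA0.
  have c0 z : \sum_k Zs (P1pt z) (lsubmx c 0 k) (E k (P1pt z)) +
      \sum_k Zs (P1pt z) (rsubmx c 0 k) (F k (P1pt z)) =
      \sum_k Zs (P1pt z) ((0 : 'rV[C]_r) 0 k) (E k (P1pt z)).
    rewrite -defA cA0 [RHS]big1 => [|k _]; last by rewrite mxE Zscale0.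
    by rewrite /deformation toR0 /tmap linear0.
  have l0 : lsubmx c = 0.
    apply: (uniqE 0); rewrite -c0 [X in _ = _ + X]big1 ?addr0 // => k _.
    by rewrite FE Zscale0 Zscalev0.
  have r0 : rsubmx c = 0.
    apply: (uniqE 1); rewrite -c0 l0 [X in _ = X + _]big1 => [|k _].
      by rewrite add0r; apply: eq_bigr => k _; rewrite FE Zscale1.
    by rewrite mxE Zscale0.
  by rewrite -(hsubmxK c) l0 r0 row_mx0.
have Afull : row_full A by apply/eqP; exact: etrans (eqP Af) rN.
have [w [Vw _]] := ss_tangent_iso hS hV.
have [c Ew] : exists c, w = c *m A by exists (w *m pinvmx A); rewrite mulmxKpV // submx_full.
suff c0 : c = 0 by move=> p; rewrite -Vw Ew c0 mul0mx /deformation toR0 /tmap linear0.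
have a0E k : holomorphic_at0 I sg (E k) := H0_at0 hk hS (hE k).
have a0F k : holomorphic_at0 I sg (F k) := H0_at0 hk hS (hF k).
have OmV W : H0 I J K (ev s0) W ->
    \sum_k lsubmx c 0 k * Om (E k) W + \sum_k rsubmx c 0 k * Om (F k) W = 0.
  move=> hW; have [w' [Ww _]] := ss_tangent_iso hS hW.
  rewrite -[RHS](Om0 w') Ww.
  have H := Omega0_suml hk hs (I0 := ('I_r + 'I_r)%type) (V' := fun x => match x with inl k => E k | inr k => F k end)
    (c := fun x => match x with inl k => lsubmx c 0 k | inr k => rsubmx c 0 k end) (V := V) (H0_at0 hk hS hW).
  rewrite H ?big_sumType //.
    by case=> k; [exact: a0E|exact: a0F].
  by move=> z; rewrite -Vw Ew defA big_sumType.
have F0 k : F k p0 = 0 by rewrite FE Zscale0.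
have OmFF k j : Om (F k) (F j) = 0.
  rewrite (Omega0_mul_coord hk hs (a0E k) (a0F j) (FE k)) F0 linear0.
  by rewrite kformJK_anti kformJK0l oppr0 mulr0.
(* Two signs cancel, since [Omega0] and omega_J + i omega_K are both antisymmetric. *)
have OmFE k j : Om (F k) (E j) = Om (E k) (F j).
  rewrite (Omega0_anti hk hs (a0E k) (a0F j)) (Omega0_mul_coord hk hs (a0E k) (a0E j) (FE k)).
  rewrite (Omega0_mul_coord hk hs (a0E j) (a0E k) (FE j)).
  apply: etrans _ (mulrN _ _); congr (_ * _); exact: kformJK_anti.
(* The vector sum_k b_k e_k(0) pairs to zero under omega_J + i omega_K with every e_j(0), hence with
   every vertical vector; so it vanishes, and b = 0 by uniqueness of coordinates. *)
have kill (b : 'rV[C]_r) : (forall j, \sum_k b 0 k * Om (F k) (E j) = 0) -> b = 0.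
  move=> Ob; have Ci2 : - (Ci R / 2) != 0.
    by rewrite oppr_eq0 mulf_neq0 // ?invr_eq0 ?pnatr_eq0 //; apply/eqP => -[] /eqP; rewrite oner_eq0.
  have Kb j : kformJK g J K (sg p0) (rsubmx (\sum_k Zs p0 (b 0 k) (E k p0))) (rsubmx (E j p0)) = 0.
    rewrite kformJK_suml; apply: (mulfI Ci2); rewrite mulr0 -[RHS](Ob j) mulr_sumr.
    by apply: eq_bigr => k _; rewrite (Omega0_mul_coord hk hs (a0E k) (a0E j) (FE k)) mulrCA.
  apply: (uniqE 0); rewrite [RHS]big1 => [|k _]; last by rewrite mxE Zscale0.
  rewrite -[LHS]hsubmxK -[RHS]row_mx0; congr row_mx.
    rewrite linear_sum big1 //= => k _; apply: Zscale_lsubmx.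
    by apply/verticalE; exact: (hE k p0 Logic.I).1.
  apply: (kformJK_nondegenerate hk (m := sg p0)) => w'.
  have [|b' [Eb' _]] := frameE 0 (row_mx 0 w'); first by rewrite row_mxKl.
  rewrite -[w'](row_mxKr (0 : 'rV[R]_(1 + 1))) Eb' kformJK_anti kformJK_suml big1 ?oppr0 // => k _.
  by rewrite kformJK_anti Kb oppr0 mulr0.
(* Pairing V with z e_j only sees the coefficients of the e_k; once these are zero, pairing with e_j
   isolates the others. *)
have l0 : lsubmx c = 0.
  apply: kill => j; have := OmV _ (hF j).
  rewrite [X in _ + X]big1 ?addr0 => [H|k _]; last by rewrite OmFF mulr0.
  apply: etrans _ H; apply: eq_bigr => k _.
  by rewrite OmFE.
have r0 : rsubmx c = 0.
  apply: kill => j; have := OmV _ (hE j).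
  by rewrite l0 [X in X + _]big1 ?add0r // => k _; rewrite mxE mul0r.
by rewrite -(hsubmxK c) l0 r0 row_mx0.
Qed.

End Nondegeneracy.

(** * Fixed sections *)

Section FlatCurves.
Variables (R : realType) (n : nat) (M : charted R n).
Hypothesis hM : is_manifold M.

(** Connectedness of the line by way of the mean value theorem: a locally constant function has
    derivative zero. *)
Lemma locally_constant_constant (f : R -> R) :
  (forall t, \forall s \near t, f t = f s) -> forall t, f t = f 0.
Proof.
move=> lc t.
have D s : differentiable f s /\ 'D_t f s = 0.
  have dc := @differentiable_cst R R R (f s) s.
  have nE : \forall u \near s, (fun=> f s) u = f u := lc s.
  split; first exact: near_eq_differentiable nE dc.
  by apply: etrans (esym (near_eq_derive t nE)) _; exact: derive_cst.
have [u _ E] := @line_MVT _ _ f 0 t 1 ltr01 (fun s _ => (D _).1).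
apply/eqP; rewrite -subr_eq0; apply/eqP.
have := E; rewrite scale1r add0r (D _).2 mulr0.
exact.
Qed.

(** In a chart each coordinate has zero derivative along a short segment, so the curve is locally
    constant; connectedness of the line does the rest. *)
Lemma flat_curve_constant (c : R -> M) : continuous c ->
  (forall t, differentiable (chart (c t) \o c) t /\ 'D_1 (chart (c t) \o c) t = 0) ->
  forall t, c t = c 0.
Proof.
move=> cc flat.
have flat' p t v : cdom p (c t) ->
    differentiable (chart p \o c) t /\ 'D_v (chart p \o c) t = 0.
  move=> pt; have [d0 D0] := flat t.
  have [D E] := diff_to_coframe hM (@cc t) pt d0; split; first exact: D.
  apply: etrans (deriveE v D) _; apply: etrans (E v) _.
  have -> : 'd (chart (c t) \o c) t v = 0.
    have -> : v = v *: (1 : R) by rewrite /GRing.scale /= mulr1.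
    rewrite linearZ -(deriveE _ d0).
    apply: etrans (congr1 (fun x => v *: x) D0) _; exact: scaler0.
  by rewrite /coframe linear0.
have lc t : \forall s \near t, c t = c s.
  have := chart_comp_near hM (@cc t) (mfd_mem hM (c t)).
  move=> /nbhs_ballP[e e0 B]; apply/nbhs_ballP; exists e => // s ts.
  have seg r : 0 <= r <= 1 -> cdom (c t) (c (t + r *: (s - t))).
    move=> /andP[r0 r1]; apply: B; move: ts; rewrite -ball_normE /=.
    apply: le_lt_trans; rewrite opprD addNKr normrN normrZ -normrN opprB ger0_norm //.
    by rewrite ler_piMl.
  have st : t + 1 *: (s - t) = s by rewrite scale1r addrC subrK.
  have cs : cdom (c t) (c s) by rewrite -st; apply: seg; rewrite ler01 lexx.
  rewrite -(mfd_inv hM (mfd_mem hM (c t))) -(mfd_inv hM cs); congr cinv.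
  apply/rowP => j.
  pose f x := (chart (c t) \o c) x 0 j.
  have df r : 0 <= r <= 1 -> differentiable f (t + r *: (s - t)).
    move=> r01; have [D1 _] := flat' _ _ 0 (seg r r01).
    apply: (@differentiable_comp _ _ _ _ (chart (c t) \o c) (fun u : 'rV[R]_n => u 0 j) _ D1).
    exact: differentiable_coord.
  have [r r01 E] := @line_MVT _ _ f t (s - t) 1 ltr01 df.
  have D0 : 'D_(s - t) f (t + r *: (s - t)) = 0.
    have [D1 D2] := flat' _ _ (s - t) (seg r r01).
    apply: etrans (esym (derive_coord (s - t) j D1)) _.
    by rewrite D2 mxE.
  by move: E; rewrite D0 mulr0 st => /eqP; rewrite subr_eq0 => /eqP.
(* The indicator of [c s = c 0] is a locally constant real function with value 1 at 0. *)
move=> t; pose f s : R := if pselect (c s = c 0) then 1 else 0.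
have lf u : \forall s \near u, f u = f s.
  by apply: filterS (lc u) => s; rewrite /f => ->.
have := locally_constant_constant lf t; rewrite /f.
case: pselect => // ct; case: pselect => // _ /eqP.
by rewrite eq_sym oner_eq0.
Qed.

End FlatCurves.

Section FixedSections.
Variables (R : realType) (n : nat) (M : charted R n) (g : M -> 'M[R]_n).
Variables (I J K : M -> {linear 'rV[R]_n -> 'rV[R]_n}).
Hypothesis hk : is_hyperkaehler g I J K.
Let hM : is_manifold M := hk_manifold hk.
Local Notation C := (R[i]).
Local Notation P1 := (P1 R).
Variable a : C -> M -> M.
Hypothesis hka : is_hk_circle_action g I J K a.
Let ha : is_circle_action a := hka_action hka.
Variable sg : P1 -> M.
Hypothesis hs : is_section I J K (graph_of sg).
Local Notation flow := (flow a sg).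
Local Notation gS := (genS a sg).

(** The group law turns a shift of time into the action on M, at the price of rotating the base
    point. *)
Lemma flowD p t h :
  flow p (t + h) = a (expi t) (flow (actP1 (expi t)^-1 p) h).
Proof.
rewrite /flow -(act_mul ha) ?expi_norm // -expiD; congr (a _ (sg _)).
by rewrite expiD invfM; case: p => [z|] //=; rewrite /P1pt mulrA (mulrC (expi t)^-1).
Qed.

Lemma flow_shift p t : flow p =
  a (expi t) \o flow (actP1 (expi t)^-1 p) \o (fun s => s - t).
Proof. by apply/funext => s; rewrite /comp -flowD addrC subrK. Qed.

Hypothesis gS0 : forall p, gS p = 0.

(** By [flowD] the velocity at time t over p is the image under the action of the velocity at time 0
    over the rotated point, where the generator vanishes. *)
Lemma flow_constant p t : flow p t = flow p 0.
Proof.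
move: t; apply: (flat_curve_constant hM) => t.
  rewrite (flow_shift p t); apply: continuous_comp.
    by apply: cvgB; [exact: cvg_id|exact: cvg_cst].
  rewrite subrr; apply: (act_path_continuous ha (tau := fun=> t)); first exact: cst_continuous.
  exact: (flow_continuous hka hs).
set q := actP1 (expi t)^-1 p.
have qd : differentiable (chart (sg q) \o flow q) 0 /\ 'D_1 (chart (sg q) \o flow q) 0 = 0.
  have D := @Ck_at_differentiable _ _ _ 0 _ _ (flowl_smooth hk hka hs q 1).
  have [D1 _] := flow_differentiable D.
  rewrite (P1_cinvK (P1_mem q)) in D1; split=> //.
  have := gS0 q; rewrite /genS (generatorS_graph hk hka hs) derive1E -[RHS]row_mx0.
  by move=> /eq_row_mx[].
pose m := sg q; pose psi := chart m \o flow q.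
pose Phi := chart (a (expi t) m) \o a (expi t) \o cinv m.
have f0 : flow q 0 = m := flow0 hka sg q.
have ft : flow p t = a (expi t) m.
  by rewrite -{1}[t]addr0 flowD f0.
have psi0 : psi 0 = chart m m by rewrite /psi /comp f0.
have dPhi : differentiable Phi (psi 0).
  by rewrite psi0; exact: (@Ck_at_differentiable _ _ _ 0 _ _ (act_space_smooth ha t m 1)).
have dG : differentiable (Phi \o psi) 0 := differentiable_comp qd.1 dPhi.
have DG : 'D_1 (Phi \o psi) 0 = 0.
  apply: etrans (deriveE _ dG) _; apply: etrans (diff_compE (1 : R) qd.1 dPhi) _.
  by rewrite -(deriveE _ qd.1) qd.2 linear0.
have tt : {for t, continuous (fun s : R => s - t)}.
  by apply: cvgB; [exact: cvg_id|exact: cvg_cst].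
have nE : \forall s \near t, (Phi \o psi) (s - t) = (chart (flow p t) \o flow p) s.
  have N : \forall h \near t - t, cdom m (flow q h).
    by rewrite subrr; exact: (near_flow_cdom hk hka hs q).
  have N' : \forall s \near t, cdom m (flow q (s - t)) := tt _ N.
  apply: filterS N' => s sd.
  rewrite ft /comp /Phi /psi /comp (mfd_inv hM sd) -flowD.
  by rewrite addrC subrK.
have dS : differentiable (fun s => (Phi \o psi) (s - t)) t.
  apply: (@differentiable_comp _ _ _ _ (fun s : R => s - t) (Phi \o psi)).
    apply: (@Ck_at_differentiable _ _ _ 0).
    exact: Ck_at_add (Ck_at_id 1 t) (Ck_at_cst 1 (- t) t).
  by rewrite subrr.
split; first exact: near_eq_differentiable nE dS.
apply: etrans (esym (near_eq_derive (1 : R) nE)) _.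
apply: etrans (derive_shift_in (Phi \o psi) t (1 : R) (- t)) _.
by rewrite subrr.
Qed.

Lemma actS_fixed z : `|z| = 1 -> actS a z (graph_of sg) = graph_of sg.
Proof.
move=> /expi_surjective[t ->]; apply/funext => p.
rewrite /actS /actZ /graph_of /= actP1K ?expi_neq0 //.
congr pair; have := flow_constant p t.
by rewrite (flow0 hka).
Qed.

End FixedSections.



Theorem theorem3p3 (R : realType) (d : nat)
    (M : charted R (4 * d)) (g : M -> 'M[R]_(4 * d))
    (I J K : M -> {linear 'rV[R]_(4 * d) -> 'rV[R]_(4 * d)})
    (hM : is_hyperkaehler g I J K)
    (a : R[i] -> M -> M) (ha : is_hk_circle_action g I J K a)
    (mu : M -> R[i]) (hmu : is_I_moment_map g I a mu)
    (hint : integral_class (fun m v w => kform g I m v w / (2 * pi)))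
    (Sp : charted R[i] (4 * d)) (ev : Sp -> P1 R -> Z M)
    (hS : is_section_space I J K (2 * d) ev) :
  (forall s : Sp,
    differentiable (energy_loc g J K a mu ev s) (chart s s) /\
    H0 I J K (ev s) (generatorS a (ev s)) /\
    (forall w : 'rV[R[i]]_(4 * d),
      denergy g J K a mu ev s w =
        Ci R * Omega0 g I J K (ev s) (generatorS a (ev s)) (deformation ev s w)))
  /\
  (forall s : Sp,
    (forall z : R[i], `|z| = 1 -> actS a z (ev s) = ev s) <->
    (forall w : 'rV[R[i]]_(4 * d), denergy g J K a mu ev s w = 0)).
Proof.
have hs s := sgm_section hS s.
have sE (s : Sp) : generatorS a (ev s) = genS a (sgm ev s) by rewrite /genS -(ev_graph hS s).
have dE s w : denergy g J K a mu ev s w =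
    Ci R * Omega0 g I J K (ev s) (generatorS a (ev s)) (deformation ev s w).
  by rewrite (energy_holomorphic hM ha hmu hS s).2 sE (ev_graph hS s).
have gS_H0 s : H0 I J K (ev s) (generatorS a (ev s)).
  by rewrite sE (ev_graph hS s); exact: (genS_H0 hM ha (hs s)).
split=> s.
  by split; [exact: (energy_holomorphic hM ha hmu hS s).1|split].
split=> [fixed w|crit].
  have gS0 : genS a (sgm ev s) = fun=> 0.
    rewrite -sE; apply/funext => p; rewrite /generatorS derive1E.
    have -> : (fun t : R => @chart R _ (Z M) (ev s p) (actS a (expi t) (ev s) p)) =
        fun=> @chart R _ (Z M) (ev s p) (ev s p).
      by apply/funext => t; rewrite fixed ?expi_norm.
    exact: derive_cst.
  have at0 := deformation_at0 hM hS s w.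
  (* The zero field is written as an empty sum, so that additivity of [Omega0] gives its
     vanishing. *)
  have V0 z : genS a (sgm ev s) (P1pt z) =
      \sum_(i < 0) Zscale I J K (graph_of (sgm ev s) (P1pt z)) 0 0 by rewrite gS0 big_ord0.
  have O0 : Omega0 g I J K (graph_of (sgm ev s)) (genS a (sgm ev s)) (deformation ev s w) = 0.
    have hol0 (i : 'I_0) : holomorphic_at0 I (sgm ev s) (fun=> 0).
      by exfalso; case: i.
    apply: etrans (Omega0_suml hM (hs s) (c := fun=> 0) at0 hol0 V0) _.
    exact: big_ord0.
  rewrite dE sE; apply: etrans (congr1 (fun V => Ci R * V) _) (mulr0 _).
  by rewrite (ev_graph hS s); exact: O0.
move=> z z1; rewrite (ev_graph hS s); apply: (actS_fixed hM ha (hs s)) => //.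
(* Each summand O(1) contributes two dimensions to the space of sections, so twice the rank is the
   dimension of [Sp]. *)
have dN : (2 * d + 2 * d = 4 * d)%N by rewrite -mulnDl.
apply: (Omega0_nondegenerate hM hS dN) => [|w]; first by rewrite -sE; exact: gS_H0.
have := crit w; rewrite dE sE (ev_graph hS s) => /eqP.
rewrite mulf_eq0 => /orP[|/eqP //].
by move=> /eqP[] /eqP; rewrite oner_eq0.
Qed.
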